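(* Let $1<q<\infty$, $\frac1p+\frac1q=1$. Let $k:\mathbb R^n\to\mathbb R$ be a positive radial function of the form $k(x)=h(\|x\|)$ for $x\ne0$, where $h$ is decreasing and $\inf_{r>0}\frac{h(2r)}{h(r)}>0$. Suppose $k\in L^1+L^q$. Let $\lambda$ be Lebesgue measure on $\mathbb R^n$ and let $\omega$ be any locally finite positive Borel measure on $\mathbb R^n$. Then the following are equivalent. (1) There exists $C$ such that $\int(k*f)^p\,d\omega\le C\int f^p\,d\lambda$ for all measurable $f\ge0$. (2) $k*\omega\in L^0_+$ (i.e. $k*\omega<\infty$ $\lambda$-a.e.) and $k*(k*\omega)^q\le C'\,k*\omega$ $\lambda$-a.e. for some constant $C'$. (3) $k*\omega\in\mathcal Z$, or equivalently the equation $u=k*u^q+\epsilon\,(k*\omega)$ has a solution for all sufficiently small $\epsilon>0$. (4) There exists $C$ such that $\int_B(k*\omega_B)^q\,d\lambda\le C\,|B|_\omega$ for all Euclidean balls $B$ in $\mathbb R^n$. (5) There exists $C$ such that $|E|_\omega\le C\,\mathrm{Cap}_{p,k}(E)$ for all compact sets $E\subset\mathbb R^n$.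
   Context: $(k*\mu)(x)=\int k(x-y)\,d\mu(y)$ for a positive measure $\mu$ and $(k*f)(x)=\int k(x-y)f(y)\,dy$ for measurable $f\ge0$. $|E|_\omega=\omega(E)$ and $d\omega_B=\chi_B\,d\omega$. A solution of an equation $u=k*u^q+F$ is a measurable $u$, $0\le u<\infty$ a.e., satisfying it $\lambda$-a.e. $\mathcal Z$ is the set of measurable $f$ such that $u=k*u^q+\epsilon|f|$ has a solution for some $\epsilon>0$. $\mathrm{Cap}_{p,k}(E)=\inf\{\int g^p\,d\lambda:\ g\ge0,\ (k*g)(x)\ge1\text{ for every }x\in E\}$. *)

(* Defs.v *)
From HB Require Import structures.
From mathcomp Require Import all_boot all_order all_algebra.
From mathcomp Require Import all_classical all_reals all_analysis.
From mathcomp Require Import measurable_realfun.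

Set Implicit Arguments.
Unset Strict Implicit.
Unset Printing Implicit Defensive.

Import Order.TTheory GRing.Theory Num.Theory.
Import numFieldNormedType.Exports.

Local Open Scope classical_set_scope.
Local Open Scope ring_scope.

(* R^n is 'rV[R]_n with its product topology, and carries the Borel
   sigma-algebra of that topology. *)
HB.instance Definition _ (R : realType) (m n : nat) :=
  @isMeasurable.Build default_measure_display 'M[R]_(m, n)
    <<s @open 'M[R]_(m, n) >> (@sigma_algebra0 _ setT _)
    (@sigma_algebraC _ _) (@sigma_algebra_bigcup _ setT _).

Section borel_rV.
Context {R : realType}.

Lemma rV_open_measurable n (U : set 'rV[R]_n) : open U -> measurable U.
Proof. by move=> oU; apply: sub_sigma_algebra. Qed.

Lemma measurable_coord n (i : 'I_n) :
  measurable_fun [set: 'rV[R]_n] (fun x : 'rV[R]_n => x ord0 i).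
Proof.
apply: (measurability _ (RGenOpens.measurableE R)).
move=> _ [_ [a [b ->]] <-]; rewrite setTI; apply: rV_open_measurable.
by apply: open_comp; [move=> x _; exact: coord_continuous|exact: interval_open].
Qed.

(* Coordinatewise measurability suffices: every open set is a countable union
   of cubes with rational centers and radii 1/(m+1). *)
Lemma measurable_fun_rV d (T : measurableType d) n (f : T -> 'rV[R]_n) :
  (forall i, measurable_fun [set: T] (fun t => f t ord0 i)) ->
  measurable_fun [set: T] f.
Proof.
move=> mf; apply: (@measurability _ _ _ _ _ _ (@open 'rV[R]_n)) => //.
move=> _ [U oU <-]; rewrite setTI.
pose cube (c : 'rV[rat]_n * nat) : set 'rV[R]_n :=
  [set x | forall i, `|ratr (c.1 ord0 i) - x ord0 i| < c.2.+1%:R^-1].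
pose G c : set 'rV[R]_n := if `[< cube c `<=` U >] then cube c else set0.
have UE : U = \bigcup_c G c.
  apply/seteqP; split => [x Ux|x [c _]]; last first.
    by rewrite /G; case: asboolP => // cU /cU.
  have /nbhs_ballP[e /= e0 xeU] : nbhs x U by exact: open_nbhs_nbhs.
  have [k ke] : exists k : nat, k.+1%:R^-1 + k.+1%:R^-1 < e.
    have e20 : 0 < e / 2 by rewrite divr_gt0.
    have [k _ /(_ k (leqnn k)) /= ke] := near_infty_natSinv_lt (PosNum e20).
    by exists k; rewrite [ltRHS]splitr ltrD.
  have q_ i : {q : rat | `|ratr q - x ord0 i| < k.+1%:R^-1}.
    apply: cid; have xk : x ord0 i - k.+1%:R^-1 < x ord0 i + k.+1%:R^-1.
      by rewrite ltrD2l gtrN.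
    have [q] := rat_in_itvoo xk; rewrite in_itv /= => /andP[q1 q2].
    by exists q; rewrite ltr_distl q1 q2.
  pose c := (\row_i sval (q_ i), k).
  have xc : cube c x by move=> i /=; rewrite mxE; exact: (svalP (q_ i)).
  exists c => //; rewrite /G; case: asboolP => // -[] y yc.
  apply: xeU; split=> // i j; rewrite (ord1 i) /ball /=.
  rewrite (le_lt_trans _ ke)// -[_ - _](subrKA (ratr (c.1 ord0 j))).
  rewrite (le_trans (ler_normD _ _))// lerD//; apply: ltW; last exact: yc.
  by rewrite distrC; exact: xc.
rewrite UE preimage_bigcup; apply: countable_bigcupT_measurable => [|c]; first exact: countableP.
rewrite /G; case: asboolP => _; last by rewrite preimage_set0.
rewrite (_ : f @^-1` _ = \bigcap_(i in [set: 'I_n])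
  ((fun t => f t ord0 i) @^-1`
    [set y | `|ratr (c.1 ord0 i) - y| < c.2.+1%:R^-1])); last first.
  by apply/seteqP; split=> [t + i _|t + i]; [exact|move=> /(_ i I)].
apply: fin_bigcap_measurable => // i _; rewrite -[X in measurable X]setTI.
apply: (mf i) => //.
rewrite (_ : [set y | _] = ball (ratr (c.1 ord0 i) : R) c.2.+1%:R^-1) //.
by apply: open_measurable; exact: ball_open.
Qed.

End borel_rV.

Section lebesgue_rV.
Context {R : realType}.

Definition consrV n (tx : measurableTypeR R * 'rV[R]_n) : 'rV[R]_n.+1 :=
  row_mx (tx.1 : R)%:M tx.2.

Lemma consrV0 n tx : @consrV n tx ord0 ord0 = tx.1.
Proof.
have -> : tx.1 = ((tx.1 : R)%:M : 'M[R]_1) ord0 ord0 by rewrite mxE.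
by rewrite -[RHS](row_mxEl _ tx.2); congr (fun_of_matrix _ _ _); exact: val_inj.
Qed.

Lemma consrVS n tx i : @consrV n tx ord0 (lift ord0 i) = tx.2 ord0 i.
Proof.
by rewrite -[RHS](row_mxEr (tx.1 : R)%:M); congr (fun_of_matrix _ _ _); exact: val_inj.
Qed.

Lemma measurable_consrV n : measurable_fun setT (@consrV n).
Proof.
apply: measurable_fun_rV => i; case: (unliftP ord0 i) => [j|] ->.
  under eq_fun do rewrite consrVS.
  by apply: (measurableT_comp (measurable_coord j)).
by under eq_fun do rewrite consrV0; exact: measurable_fst.
Qed.

Section step.
Variables (n : nat) (mu : {sigma_finite_measure set 'rV[R]_n -> \bar R}).

Definition lebesgue_rVS : set 'rV[R]_n.+1 -> \bar R :=
  pushforward (lebesgue_measure \x mu)%E (@consrV n).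

Let lebesgue_rVS_measure : {measure set 'rV[R]_n.+1 -> \bar R} :=
  measure_function_pushforward__canonical__measure_function_Measure
    (lebesgue_measure \x mu)%E (@measurable_consrV n).

HB.instance Definition _ := Measure.copy lebesgue_rVS lebesgue_rVS_measure.

Let lebesgue_rVS_sigma_finite : sigma_finite setT lebesgue_rVS.
Proof.
have /sigma_finiteP[F [FT ndF Foo]] := sigma_finiteT (@lebesgue_measure R).
have /sigma_finiteP[G [GT ndG Goo]] := sigma_finiteT mu.
pose uncons (x : 'rV[R]_n.+1) : measurableTypeR R * 'rV[R]_n :=
  (x ord0 ord0, \row_i x ord0 (lift ord0 i)).
have muncons : measurable_fun setT uncons.
  apply/measurable_fun_pair; first exact: measurable_coord.
  apply: measurable_fun_rV => i; under eq_fun do rewrite mxE.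
  exact: measurable_coord.
have consK : cancel (@consrV n) uncons.
  move=> [t x]; rewrite /uncons consrV0 /=; congr pair.
  by apply/rowP => i; rewrite mxE consrVS.
have FGT : \bigcup_k (F k `*` G k) = setT.
  apply/seteqP; split=> // -[t x] _.
  have [i _ Fit] : (\bigcup_k F k) t by rewrite -FT.
  have [j _ Gjx] : (\bigcup_k G k) x by rewrite -GT.
  exists (maxn i j) => //; split=> /=.
    by move: t Fit; exact/subsetPset/ndF/leq_maxl.
  by move: x Gjx; exact/subsetPset/ndG/leq_maxr.
exists (fun k => uncons @^-1` (F k `*` G k)).
  by rewrite -preimage_bigcup FGT preimage_setT.
move=> k; have [mF Fkoo] := Foo k; have [mG Gkoo] := Goo k; split.
  by rewrite -[X in measurable X]setTI; apply: muncons => //; exact: measurableX.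
rewrite /lebesgue_rVS /pushforward -comp_preimage (_ : uncons \o _ = id); last first.
  by apply/funext => tx /=; rewrite consK.
rewrite preimage_id product_measure1E//.
by rewrite lte_mul_pinfty// ge0_fin_numE.
Qed.

HB.instance Definition _ := Measure_isSigmaFinite.Build _ _ _ lebesgue_rVS
  lebesgue_rVS_sigma_finite.

End step.

(* Iterated product of one-dimensional Lebesgue measures, transported along
   R * R^n -> R^(n+1); lebesgue_rV_box gives its normalisation. *)
Fixpoint lebesgue_rV n : {sigma_finite_measure set 'rV[R]_n -> \bar R} :=
  if n is m.+1 then lebesgue_rVS (lebesgue_rV m) else \d_(0 : 'rV[R]_0).

Lemma lebesgue_rV_box n (a b : 'rV[R]_n) : (forall i, a ord0 i <= b ord0 i) ->
  lebesgue_rV n [set x | forall i, a ord0 i <= x ord0 i <= b ord0 i] =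
  (\prod_i (b ord0 i - a ord0 i))%:E.
Proof.
elim: n => [|n IH] in a b * => ab.
  rewrite big_ord0 /= diracE mem_set // => -[]//.
pose tl (x : 'rV[R]_n.+1) : 'rV[R]_n := \row_i x ord0 (lift ord0 i).
rewrite /= /lebesgue_rVS /pushforward.
pose B : set 'rV[R]_n :=
  [set x | forall i, tl a ord0 i <= x ord0 i <= tl b ord0 i].
have mB : measurable B.
  rewrite (_ : B = \bigcap_(i in [set: 'I_n]) ((fun x : 'rV[R]_n => x ord0 i)
    @^-1` `[tl a ord0 i, tl b ord0 i])); last first.
    apply/seteqP; split=> [x Bx i _|x Bx i] /=; rewrite ?in_itv; first exact: Bx.
    by have := Bx i I; rewrite /= in_itv.
  apply: fin_bigcap_measurable => // i _; rewrite -[X in measurable X]setTI.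
  by apply: measurable_coord => //; exact: measurable_itv.
rewrite (_ : _ @^-1` _ = `[a ord0 ord0, b ord0 ord0]%classic `*` B); last first.
  apply/seteqP; split=> [tx /= xab|tx /= [t0 xB] i].
    split=> [|i]; first by have := xab ord0; rewrite consrV0 in_itv.
    by rewrite !mxE -consrVS; exact: xab.
  case: (unliftP ord0 i) => [j|] ->; last by rewrite consrV0; move: t0; rewrite in_itv.
  by rewrite consrVS; have := xB j; rewrite !mxE.
rewrite product_measure1E //= IH; last by move=> i; rewrite !mxE.
rewrite lebesgue_measure_itv /= lte_fin big_ord_recl EFinM; congr (_ * _)%E.
  have [//|ba] := ltP; rewrite (_ : b _ _ = a ord0 ord0) ?subrr //.
  by apply/eqP; rewrite eq_le ba ab.
by congr EFin; apply: eq_bigr => i _; rewrite !mxE.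
Qed.

End lebesgue_rV.

Section potential.
Context {R : realType} {n : nat}.
Implicit Types (p q r : R) (x c : 'rV[R]_n) (k : 'rV[R]_n -> R).
Implicit Types (f g u F : 'rV[R]_n -> \bar R) (E : set 'rV[R]_n).
Implicit Type mu : {measure set 'rV[R]_n -> \bar R}.

(* The library norm `|x| on 'rV[R]_n is the sup norm. *)
Definition enorm x : R := Num.sqrt (\sum_i x ord0 i ^+ 2).

Definition eball c r : set 'rV[R]_n := [set x | enorm (x - c) < r].

Lemma measurable_eball c r : measurable (eball c r).
Proof.
have mE : measurable_fun setT (fun x => enorm (x - c)).
  apply: (@measurableT_comp _ _ _ _ _ _ (@Num.sqrt R)).
    by apply: continuous_measurable_fun; exact: sqrt_continuous.
  apply: measurable_sum => i; apply: measurable_funX.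
  under eq_fun do rewrite !mxE.
  by apply: measurable_funB => //; exact: measurable_coord.
rewrite (_ : eball c r = setT `&` (fun x => enorm (x - c)) @^-1` `]-oo, r[).
  exact: mE.
by rewrite setTI; apply/seteqP; split=> x /=; rewrite in_itv.
Qed.

Definition locally_finite mu : Prop :=
  forall x, exists U : set 'rV[R]_n, [/\ open U, U x & (mu U < +oo)%E].

(* L^p1 + L^p2 with respect to mu *)
Definition in_Lsum mu (p1 p2 : \bar R) k : Prop :=
  exists k1 k2 : 'rV[R]_n -> R,
    [/\ k1 \in Lfun mu p1, k2 \in Lfun mu p2 &
        {ae mu, forall x, k x = k1 x + k2 x}].

Local Open Scope ereal_scope.

Definition conv_measure k mu : 'rV[R]_n -> \bar R :=
  fun x => \int[mu]_y (k (x - y)%R)%:E.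

Definition conv_fun k f : 'rV[R]_n -> \bar R :=
  fun x => \int[lebesgue_rV n]_y ((k (x - y)%R)%:E * f y).

(* u is an a.e. finite solution of u = k * u^q + F *)
Definition is_solution k q F u : Prop :=
  [/\ measurable_fun setT u,
      {ae lebesgue_rV n, forall x, 0 <= u x < +oo} &
      {ae lebesgue_rV n, forall x,
         u x = conv_fun k (fun y => u y `^ q) x + F x}].

Definition Zset k q : set ('rV[R]_n -> \bar R) :=
  [set f | measurable_fun setT f /\
     exists2 e : R, (0 < e)%R &
       exists u, is_solution k q (fun x => e%:E * `|f x|) u].

Definition capacity p k E : \bar R :=
  ereal_inf [set \int[lebesgue_rV n]_x (g x `^ p) | g in
    [set g | [/\ measurable_fun setT g, forall x, 0 <= g x &
                 forall x, E x -> 1 <= conv_fun k g x]]].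

End potential.

(* Main.v *)
(* The implications run (1) -> (5) -> (4) -> (2) -> (3') -> (3) -> (1), with (3') the
   equivalent form of (3). Write K f for the potential of f and w for k * omega.

   (3) -> (1). By doubling, k is the inverse of a quasi-metric, so if |x - y| <= |x - z| then
   k (x - z) <= D k (y - z). Hence (K f)^p <= C K (f (K f)^(p - 1)). A solution u satisfies
   e w <= u, so the integral of (K f)^p against omega is at most C / e times that of
   f (K f)^(p - 1) u against lambda. Young's inequality bounds it by the integral of f^p plus a
   multiple of that of (K f)^p u^q, which the same argument and K (u^q) <= u absorb.

   (5) -> (4). The capacity inequality is the weak type trace inequality. Summed over the dyadic
   levels of the potential of f = (k * omega_B)^(q - 1) 1_B, it costs only a convergent
   geometric series.

   (4) -> (2). Let Phi(r) be the integral of k over a centred ball of radius r. Testing and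
   Young's inequality give omega(B(c, r)) <= C r^n Phi(r)^(-p), after absorbing the supremum over
   c of the left-hand side. Since Phi(2 r) - Phi(r) dominates r^n h(2 r), the tail of k * omega
   at distance s telescopes to at most C Phi(s)^(1 - p). In k * w^q at x, w(y) is split at
   distance 2 |x - y| from x. The far part is handled by this tail bound. The near part is the
   layer cake decomposition of k (x - y) over balls centred at x, on each of which the testing
   condition applies.

   (2) -> (3'). A small multiple of w is a supersolution, so a monotone iteration converges. *)

Require Import Defs.
From HB Require Import structures.
From mathcomp Require Import all_boot all_order all_algebra.
From mathcomp Require Import all_classical all_reals all_analysis.
From mathcomp Require Import measurable_realfun.
From mathcomp Require Import ring lra.

Set Implicit Arguments.
Unset Strict Implicit.
Unset Printing Implicit Defensive.

Import Order.TTheory GRing.Theory Num.Theory.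
Import numFieldNormedType.Exports.

Local Open Scope classical_set_scope.
Local Open Scope ring_scope.

(** The step from (4) to (2) closes because (p - 1)(q - 1) = 1: the tail bound raised to the power q
    - 1 is a multiple of Phi(s)^(-1), while the integral of k over the points nearer than s is at
    most Phi(s), so the two cancel at every scale. An obstacle throughout is the diagonal. The
    number [k 0] is not tied to h and omega may have atoms, so kernel values are compared only away
    from the origin, and the pointwise inequality in (2) is proved at the points that omega does not
    charge. Since omega may also charge spheres, the inequality for powers of integrals is proved by
    counting pairs, ties included, and not by integration by parts. Every absorption subtracts a
    quantity from itself and so requires it to be finite. This is the origin of the truncations of f
    and of the potential, removed afterwards by monotone convergence, and of the crude bound on the
    mass of balls. *)

Section poweR_measurable.
Local Open Scope ereal_scope.

Lemma measurable_poweR d (T : measurableType d) (R : realType) (p : R) (f : T -> \bar R) :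
  measurable_fun setT f -> measurable_fun setT (fun x => f x `^ p).
Proof.
(* The exponent 0 is treated apart: it sends both infinities to 1, every other exponent sends them
   to [+oo] and 0. *)
move=> mf; have [->|p0] := eqVneq p 0%R.
  by under eq_fun do rewrite poweRe0; exact: measurable_cst.
apply: (measurableT_comp (f := @poweR R ^~ p) _ mf) => {f mf}.
rewrite (_ : poweR^~ p = fun x : \bar R => if x == +oo then +oo else
   if x == -oo then 0 else (fine x `^ p)%:E); last first.
  by apply/funext => -[x| |]; rewrite ?poweR_EFin ?poweRyr ?poweRNyr.
apply: measurable_fun_ifT => //.
  apply: (measurable_fun_bool true); rewrite setTI.
  rewrite (_ : _ @^-1` _ = [set +oo]); first exact: emeasurable_set1.
  by apply/seteqP; split=> x /= /eqP.
apply: measurable_fun_ifT => //.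
  apply: (measurable_fun_bool true); rewrite setTI.
  rewrite (_ : _ @^-1` _ = [set -oo]); first exact: emeasurable_set1.
  by apply/seteqP; split=> x /= /eqP.
apply/measurable_EFinP; apply: (measurableT_comp (measurable_powR p)).
exact: fine_measurable.
Qed.

End poweR_measurable.

(** * Tonelli's theorem for curried integrands *)

Section tonelli.
Local Open Scope ereal_scope.
Context d1 d2 (T1 : measurableType d1) (T2 : measurableType d2) (R : realType).
Variables (m1 : {sigma_finite_measure set T1 -> \bar R})
  (m2 : {sigma_finite_measure set T2 -> \bar R}) (F : T1 -> T2 -> \bar R).
Hypotheses (mF : measurable_fun setT (fun z : T1 * T2 => F z.1 z.2 : \bar R))
  (F0 : forall x y, 0 <= F x y).

Lemma tonelli_exchange : \int[m1]_x \int[m2]_y F x y = \int[m2]_y \int[m1]_x F x y.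
Proof. exact: (fubini_tonelli _ mF (fun z => F0 z.1 z.2)). Qed.

Lemma measurable_integral2 : measurable_fun setT (fun x => \int[m2]_y F x y).
Proof. exact: (measurable_fun_fubini_tonelli_F (m2 := m2) _ mF (fun z => F0 z.1 z.2)). Qed.

Lemma measurable_integral1 : measurable_fun setT (fun y => \int[m1]_x F x y).
Proof. exact: (measurable_fun_fubini_tonelli_G (m1 := m1) _ mF (fun z => F0 z.1 z.2)). Qed.

Lemma measurable_section2 x : measurable_fun setT (F x).
Proof. exact: (measurable_fun_pair2 x mF). Qed.

Lemma measurable_section1 y : measurable_fun setT (F^~ y).
Proof. exact: (measurable_fun_pair1 y mF). Qed.

End tonelli.
Arguments tonelli_exchange {d1 d2 T1 T2 R m1 m2 F}.
Arguments measurable_integral1 {d1 d2 T1 T2 R m1 F}.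
Arguments measurable_integral2 {d1 d2 T1 T2 R m2 F}.

(** * Powers of an integral along a ranking of the points *)

Section rank.
Local Open Scope ereal_scope.
Context d (T : measurableType d) (R : realType).
Variable mu : {sigma_finite_measure set T -> \bar R}.

Lemma measurable_if0 (b : T -> bool) (f : T -> \bar R) :
  measurable_fun setT b -> measurable_fun setT f ->
  measurable_fun setT (fun x => if b x then f x else 0).
Proof. by move=> mb mf; apply: measurable_fun_ifT. Qed.

Lemma measurable_fun_geec (f : T -> \bar R) (c : \bar R) :
  measurable_fun setT f -> measurable_fun setT (fun x => c <= f x).
Proof.
by move=> mf; apply: (measurable_fun_bool true); exact: emeasurable_fun_c_infty.
Qed.

(* Points y whose upper mass, the integral of g over rho >= rho y, is below a quarter of the
   total mass carry at most half of it: symmetrise the product over the pairs of such points. *)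
Lemma rank_power (g : T -> \bar R) (rho : T -> R) (s : R) : (0 <= s)%R ->
  measurable_fun setT g -> (forall x, 0 <= g x) -> measurable_fun setT rho ->
  \int[mu]_x g x < +oo ->
  (\int[mu]_x g x) `^ (s + 1)%R <= (4 `^ s * 2)%:E *
    \int[mu]_y (g y * (\int[mu]_z (if (rho y <= rho z)%R then g z else 0)) `^ s).
Proof.
move=> s0 mg g0 mrho Sfin.
have mle : measurable_fun setT (fun z : T * T => (rho z.1 <= rho z.2)%R).
  by apply: measurable_fun_ler; apply: measurableT_comp.
have mle2 y : measurable_fun setT (fun z => (rho y <= rho z)%R).
  by apply: measurable_fun_ler.
pose F y z := if (rho y <= rho z)%R then g z else 0.
have mF : measurable_fun setT (fun z : T * T => F z.1 z.2).
  by apply: measurable_fun_ifT => //; apply: measurableT_comp.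
have F0 y z : 0 <= F y z by rewrite /F; case: ifP.
pose G y := \int[mu]_z F y z.
have mG : measurable_fun setT G by exact: (measurable_integral2 mF F0).
have G0 y : 0 <= G y by apply: integral_ge0.
set S := \int[mu]_x g x in Sfin *.
have S0 : 0 <= S by apply: integral_ge0.
have [t SE] : exists t, S = t%:E by exists (fine S); rewrite fineK// ge0_fin_numE.
rewrite SE lee_fin in S0.
pose c := (t / 4)%R; have c0 : (0 <= c)%R by rewrite divr_ge0.
have mb : measurable_fun setT (fun y => c%:E <= G y) by exact: measurable_fun_geec.
pose gN := fun y => if c%:E <= G y then g y else 0.
pose gM := fun y => if c%:E <= G y then 0 else g y.
have mgN : measurable_fun setT gN by exact: measurable_if0.
have mgM : measurable_fun setT gM by exact: measurable_fun_ifT.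
have gN0 y : 0 <= gN y by rewrite /gN; case: ifP.
have gM0 y : 0 <= gM y by rewrite /gM; case: ifP.
have SNM : S = \int[mu]_y gN y + \int[mu]_y gM y.
  rewrite -ge0_integralD//; apply: eq_integral => y _; rewrite /gN /gM.
  by case: ifP => _; rewrite ?adde0 ?add0e.
have [m ME] : exists m, \int[mu]_y gM y = m%:E.
  exists (fine (\int[mu]_y gM y)); rewrite fineK// ge0_fin_numE ?integral_ge0//.
  by rewrite (le_lt_trans _ Sfin)// SNM leeDr// integral_ge0.
have m0 : (0 <= m)%R by rewrite -lee_fin -ME integral_ge0.
pose H y z := if (rho y <= rho z)%R then gM y * gM z else 0.
have mH : measurable_fun setT (fun z : T * T => H z.1 z.2).
  apply: measurable_fun_ifT => //; apply: emeasurable_funM; exact: measurableT_comp.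
have H0 y z : 0 <= H y z by rewrite /H; case: ifP => // _; rewrite mule_ge0.
pose J := \int[mu]_y \int[mu]_z H y z.
(* Each pair of low points is counted by [H] in at least one of its two orders, and in both if the
   ranks are equal. *)
have Jge : (m * m)%:E <= J + J.
  rewrite {2}/J (tonelli_exchange mH H0) -ge0_integralD//; last 4 first.
  - by move=> y _; apply: integral_ge0.
  - exact: (measurable_integral2 mH H0).
  - by move=> y _; apply: integral_ge0.
  - exact: (measurable_integral1 mH H0).
  rewrite EFinM -{1}ME -ge0_integralZr//.
  apply: ge0_le_integral => //.
  - by move=> y _; rewrite mule_ge0// lee_fin.
  - by apply: emeasurable_funM => //; exact: measurable_cst.
  - apply: emeasurable_funD; first exact: (measurable_integral2 mH H0).
    exact: (measurable_integral1 mH H0).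
  move=> y _; rewrite -ME -ge0_integralZl// -ge0_integralD//; last 2 first.
  - exact: (measurable_section2 mH).
  - exact: (measurable_section1 mH).
  apply: ge0_le_integral => //.
  - by move=> z _; rewrite mule_ge0.
  - by apply: emeasurable_funM => //; exact: measurable_cst.
  - apply: emeasurable_funD; first exact: (measurable_section2 mH).
    exact: (measurable_section1 mH).
  move=> z _; rewrite /H; have [le1|/ltW ->] := leP (rho y) (rho z).
    by rewrite leeDl//; case: ifP => // _; rewrite mule_ge0.
  by rewrite muleC leeDr//; case: ifP => // _; rewrite mule_ge0.
(* For a low point y, the low points ranked at or above y have mass at most [G y], which is below
   [c]. *)
have Jle : J <= (m * c)%:E.
  rewrite EFinM -ME -ge0_integralZr//.
  apply: ge0_le_integral => //.
  - by move=> y _; apply: integral_ge0.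
  - exact: (measurable_integral2 mH H0).
  - by apply: emeasurable_funM => //; exact: measurable_cst.
  move=> y _; rewrite (_ : H y =
      (fun z => gM y * (if (rho y <= rho z)%R then gM z else 0))); last first.
    by apply/funext => z; rewrite /H; case: ifP; rewrite ?mule0.
  rewrite ge0_integralZl//; last 2 first.
  - apply: measurable_if0 => //; exact: mle2.
  - by move=> z _; case: ifP.
  rewrite {1 3}/gM; case: ifPn => [|]; first by rewrite !mul0e.
  rewrite -ltNge => /ltW Gyc; rewrite lee_pmul//.
    by apply: integral_ge0 => z _; case: ifP.
  apply: le_trans Gyc; apply: ge0_le_integral => //.
  - by move=> z _; case: ifP.
  - apply: measurable_if0 => //; exact: mle2.
  - exact: (measurable_section2 mF).
  by move=> z _; rewrite /gM /F; case: ifP => // _; case: ifP.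
have mt : (m <= t / 2)%R.
  have : (m * m)%:E <= (m * c + m * c)%:E.
    by rewrite EFinD (le_trans Jge)// leeD.
  rewrite lee_fin /c => mm.
  have [->|m_neq0] := eqVneq m 0%R; first by rewrite divr_ge0.
  have mp : (0 < m)%R by rewrite lt_neqAle eq_sym m_neq0.
  rewrite -(ler_pM2l mp); lra.
have Nge : (t / 2)%:E <= \int[mu]_y gN y.
  rewrite -(@leeD2rE _ m%:E)// -{2}ME -SNM SE -EFinD lee_fin; lra.
(* A Chebyshev bound: [G] is at least [c] on a set carrying half of the mass. With [c = t / 4] this
   is where the constant of the statement comes from. *)
have : (c `^ s * (t / 2))%:E <= \int[mu]_y (g y * G y `^ s).
  rewrite EFinM; apply: (@le_trans _ _ ((c `^ s)%:E * \int[mu]_y gN y)).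
    by rewrite lee_wpmul2l// lee_fin powR_ge0.
  rewrite -ge0_integralZl//; last by rewrite lee_fin powR_ge0.
  apply: ge0_le_integral => //.
  - by move=> y _; rewrite mule_ge0// lee_fin powR_ge0.
  - by apply: emeasurable_funM => //; exact: measurable_cst.
  - by apply: emeasurable_funM => //; exact: measurable_poweR.
  move=> y _; rewrite muleC /gN; case: ifP => [cG|_]; last first.
    by rewrite mul0e mule_ge0// poweR_ge0.
  rewrite lee_wpmul2l// -poweR_EFin gt0_ler_poweR//; rewrite in_itv/= ?leey ?andbT//.
move=> cN; apply: (@le_trans _ _ ((4 `^ s * 2)%:E * (c `^ s * (t / 2))%:E)); last first.
  by apply: lee_wpmul2l => //; rewrite lee_fin mulr_ge0// powR_ge0.
rewrite SE poweR_EFin -EFinM lee_fin /c.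
rewrite (powRM _ S0) ?invr_ge0//.
have -> : (t `^ (s + 1) = t `^ s * t)%R by rewrite powRD ?powRr1// (gt_eqF (ltr_wpDl _ _)).
rewrite (_ : _ * 2 * _ = (4 `^ s * 4^-1 `^ s) * (t `^ s * t))%R; last by field.
by rewrite -powRM ?invr_ge0// divff// powR1 mul1r.
Qed.
End rank.

(** * Invariance of Lebesgue measure under reflections *)

Section reflection.
Local Open Scope ereal_scope.
Context {R : realType}.

(** Lebesgue measure is determined by its values on half-open intervals, and a reflection only moves
    the closed end of such an interval to the other side. *)
Lemma lebesgue_measure_reflect (a : R) (f : R -> \bar R) :
  measurable_fun setT f -> (forall x, 0 <= f x) ->
  \int[lebesgue_measure]_x f (a - x)%R = \int[lebesgue_measure]_x f x.
Proof.
move=> mf f0; pose phi (x : R) : measurableTypeR R := (a - x)%R.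
have mphi : measurable_fun setT phi by apply: measurable_funB.
transitivity (\int[pushforward lebesgue_measure phi]_x f x).
  by rewrite ge0_integral_pushforward//= preimage_setT.
apply: eq_measure_integral => A mA _; apply/esym/lebesgue_measure_unique => //.
move=> _ [[u v]] _ <-; rewrite /= /pushforward.
rewrite (_ : phi @^-1` _ = `[(a - v)%R, (a - u)%R[%classic); last first.
  apply/seteqP; split=> x /=; rewrite /phi !in_itv/= => /andP[ux xv];
    by apply/andP; split; lra.
rewrite !lebesgue_measure_itv/= !lte_fin ltrD2l ltrN2; case: ifP => // _.
by congr EFin; ring.
Qed.

Lemma integral_lebesgue_rVS n (f : 'rV[R]_n.+1 -> \bar R) :
  measurable_fun setT f -> (forall x, 0 <= f x) ->
  \int[lebesgue_rV n.+1]_x f x =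
  \int[lebesgue_measure]_t \int[lebesgue_rV n]_v f (consrV (t, v)).
Proof.
move=> mf f0; rewrite /= /lebesgue_rVS.
rewrite (ge0_integral_pushforward (@measurable_consrV R n))// preimage_setT.
rewrite fubini_tonelli1//; last by move=> z; exact: f0.
exact: (measurableT_comp mf (@measurable_consrV R n)).
Qed.

Lemma measurable_subrV d (T : measurableType d) n (f g : T -> 'rV[R]_n) :
  measurable_fun setT f -> measurable_fun setT g ->
  measurable_fun setT (fun t => f t - g t)%R.
Proof.
move=> mf mg; apply: measurable_fun_rV => i; under eq_fun do rewrite !mxE.
by apply: measurable_funB; apply: (measurableT_comp (measurable_coord i)).
Qed.

(** Induction on the dimension, one coordinate at a time. The reflection is exactly the substitution
    that makes the integral of [k (x - y)] over a ball centred at x independent of x. *)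
Lemma lebesgue_rV_reflect n (a : 'rV[R]_n) (f : 'rV[R]_n -> \bar R) :
  measurable_fun setT f -> (forall x, 0 <= f x) ->
  \int[lebesgue_rV n]_x f (a - x)%R = \int[lebesgue_rV n]_x f x.
Proof.
elim: n => [|n IH] in a f *.
  by move=> mf f0; apply: eq_integral => x _; congr f; apply/rowP => -[].
move=> mf f0; rewrite !integral_lebesgue_rVS//; last first.
  by apply: (measurableT_comp mf); exact: measurable_subrV.
pose tl : 'rV[R]_n := \row_i a ord0 (lift ord0 i).
have subE t v : (a - consrV (t, v) = consrV ((a ord0 ord0 - t)%R, tl - v))%R.
  apply/rowP => i; rewrite mxE; case: (unliftP ord0 i) => [j|] ->.
    by rewrite mxE !consrVS /= !mxE.
  by rewrite mxE !consrV0.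
have mfc : measurable_fun setT (fun z : measurableTypeR R * 'rV[R]_n => f (consrV (z.1, z.2))).
  apply: (measurableT_comp mf); apply: (eq_measurable_fun (@consrV R n)).
    by case.
  exact: measurable_consrV.
transitivity (\int[lebesgue_measure]_t \int[lebesgue_rV n]_v
    f (consrV ((a ord0 ord0 - t)%R, v))).
  apply: eq_integral => t _; under eq_integral do rewrite subE.
  rewrite (IH tl (fun v => f (consrV (a ord0 ord0 - t, v)%R)))//.
  exact: (measurable_section2 (F := fun t v => f (consrV (t, v))) mfc).
rewrite (lebesgue_measure_reflect _
  (f := fun t => \int[lebesgue_rV n]_v f (consrV (t, v))))//.
  exact: (measurable_integral2 (F := fun t v => f (consrV (t, v))) mfc).
by move=> t; exact: integral_ge0.
Qed.

End reflection.

(** * The Euclidean norm and the volume of its balls *)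

Section euclidean_norm.
Context {R : realType} {n : nat}.
Implicit Types x y : 'rV[R]_n.

Lemma enorm_ge0 x : 0 <= enorm x. Proof. exact: sqrtr_ge0. Qed.

Lemma enorm_sqr x : enorm x ^+ 2 = \sum_i x ord0 i ^+ 2.
Proof. by rewrite sqr_sqrtr// sumr_ge0// => i _; rewrite sqr_ge0. Qed.

Lemma ler_enorm_coord x i : `|x ord0 i| <= enorm x.
Proof.
rewrite -(@ler_sqr _ `|x ord0 i|) ?nnegrE ?enorm_ge0// enorm_sqr real_normK ?num_real//.
by rewrite (bigD1 i)//= lerDl sumr_ge0// => j _; rewrite sqr_ge0.
Qed.

Lemma enorm_eq0 x : (enorm x == 0) = (x == 0).
Proof.
apply/eqP/eqP => [x0|->].
  apply/rowP => i; rewrite mxE; apply/eqP; rewrite -normr_le0 -x0.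
  exact: ler_enorm_coord.
by rewrite /enorm big1 ?sqrtr0// => i _; rewrite mxE expr0n.
Qed.

Lemma enorm0 : enorm (0 : 'rV[R]_n) = 0.
Proof. by apply/eqP; rewrite enorm_eq0. Qed.

Lemma enorm_gt0 x : (0 < enorm x) = (x != 0).
Proof. by rewrite lt_neqAle eq_sym enorm_eq0 enorm_ge0 andbT. Qed.

Lemma enormN x : enorm (- x) = enorm x.
Proof. by congr Num.sqrt; apply: eq_bigr => i _; rewrite mxE sqrrN. Qed.

Lemma enormB x y : enorm (x - y) = enorm (y - x).
Proof. by rewrite -enormN opprB. Qed.

Lemma enormZ (a : R) x : enorm (a *: x) = `|a| * enorm x.
Proof.
rewrite /enorm -sqrtr_sqr -sqrtrM ?sqr_ge0// mulr_sumr.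
by congr Num.sqrt; apply: eq_bigr => i _; rewrite mxE exprMn.
Qed.

Lemma enorm_cauchy_schwarz x y :
  \sum_i x ord0 i * y ord0 i <= enorm x * enorm y.
Proof.
have [->|x0] := eqVneq x 0.
  by rewrite enorm0 mul0r big1// => i _; rewrite mxE mul0r.
have [->|y0] := eqVneq y 0.
  by rewrite enorm0 mulr0 big1// => i _; rewrite mxE mulr0.
have ex0 : 0 < enorm x by rewrite enorm_gt0.
have ey0 : 0 < enorm y by rewrite enorm_gt0.
have [ex ey] : enorm x != 0 /\ enorm y != 0 by rewrite !gt_eqF.
(* After normalising both vectors, the inequality between arithmetic and geometric means applies in
   each coordinate. *)
rewrite [leRHS](_ : _ = \sum_i (enorm x * enorm y / 2 * ((x ord0 i / enorm x) ^+ 2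
    + (y ord0 i / enorm y) ^+ 2))); last first.
  rewrite -mulr_sumr big_split/= (eq_bigr (fun i => x ord0 i ^+ 2 * (enorm x) ^- 2)); last first.
    by move=> i _; rewrite expr_div_n.
  rewrite [X in _ + X](eq_bigr (fun i => y ord0 i ^+ 2 * (enorm y) ^- 2)); last first.
    by move=> i _; rewrite expr_div_n.
  by rewrite -!mulr_suml -!enorm_sqr; field; rewrite ex ey.
apply: ler_sum => i _.
set a := x ord0 i; set b := y ord0 i.
rewrite -subr_ge0 [leRHS](_ : _ = enorm x * enorm y / 2 * (a / enorm x - b / enorm y) ^+ 2).
  by rewrite mulr_ge0 ?sqr_ge0// divr_ge0// mulr_ge0// enorm_ge0.
by field; rewrite ex ey.
Qed.

Lemma ler_enormD x y : enorm (x + y) <= enorm x + enorm y.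
Proof.
rewrite -(@ler_sqr _ (enorm (x + y))) ?nnegrE ?addr_ge0 ?enorm_ge0//.
rewrite sqrrD !enorm_sqr (eq_bigr (fun i => x ord0 i ^+ 2 + y ord0 i ^+ 2 +
  (x ord0 i * y ord0 i) *+ 2)); last by move=> i _; rewrite mxE; ring.
rewrite big_split /= big_split /= sumrMnl addrAC lerD2r lerD2l lerMn2r/=.
exact: enorm_cauchy_schwarz.
Qed.

Lemma ler_enorm_trans x y z : enorm (x - z) <= enorm (x - y) + enorm (y - z).
Proof. by rewrite -[x - z](subrKA y) ler_enormD. Qed.

Lemma enorm_le_sum x : enorm x <= \sum_i `|x ord0 i|.
Proof.
rewrite -(@ler_sqr _ (enorm x)) ?nnegrE ?enorm_ge0 ?sumr_ge0//.
rewrite enorm_sqr expr2 mulr_suml; apply: ler_sum => i _.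
rewrite -real_normK ?num_real// expr2 ler_wpM2l// (bigD1 i)//= lerDl sumr_ge0//.
Qed.

Lemma measurable_enorm : measurable_fun setT (@enorm R n).
Proof.
apply: (@measurableT_comp _ _ _ _ _ _ (@Num.sqrt R)).
  by apply: continuous_measurable_fun; exact: sqrt_continuous.
by apply: measurable_sum => i; apply: measurable_funX; exact: measurable_coord.
Qed.

Local Notation lam := (lebesgue_rV n).

Lemma lebesgue_cube (c : 'rV[R]_n) (r : R) : 0 <= r ->
  lam [set x | forall i, c ord0 i - r <= x ord0 i <= c ord0 i + r]
  = ((2 * r) ^+ n)%:E.
Proof.
move=> r0.
pose a : 'rV[R]_n := \row_i (c ord0 i - r); pose b : 'rV[R]_n := \row_i (c ord0 i + r).
rewrite (_ : mkset _ = [set x | forall i, a ord0 i <= x ord0 i <= b ord0 i]); last first.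
  by apply/seteqP; split=> x /= + i => /(_ i); rewrite !mxE.
rewrite lebesgue_rV_box; last by move=> i; rewrite !mxE; lra.
congr EFin; rewrite (eq_bigr (fun=> 2 * r)) => [|i _]; last by rewrite !mxE; ring.
by rewrite prodr_const card_ord.
Qed.

Lemma measurable_cube (c : 'rV[R]_n) (r : R) :
  measurable [set x : 'rV[R]_n | forall i, c ord0 i - r <= x ord0 i <= c ord0 i + r].
Proof.
rewrite (_ : mkset _ = \bigcap_(i in [set: 'I_n]) ((fun x : 'rV[R]_n => x ord0 i)
    @^-1` `[c ord0 i - r, c ord0 i + r])); last first.
  apply/seteqP; split=> [x Bx i _|x Bx i] /=; rewrite ?in_itv; first exact: Bx.
  by have := Bx i I; rewrite /= in_itv.
apply: fin_bigcap_measurable => // i _; rewrite -[X in measurable X]setTI.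
by apply: measurable_coord => //; exact: measurable_itv.
Qed.

Lemma measurable_rV_set1 x : measurable [set x].
Proof.
rewrite (_ : [set x] = [set y : 'rV[R]_n | forall i, x ord0 i - 0 <= y ord0 i <= x ord0 i + 0]).
  exact: measurable_cube.
apply/seteqP; split=> [y -> i|y xy] /=; first by rewrite subr0 addr0 lexx.
by apply/rowP => i; apply/eqP; rewrite eq_le; have := xy i; rewrite subr0 addr0 andbC.
Qed.

Lemma lebesgue_eball_le (c : 'rV[R]_n) (r : R) : 0 <= r ->
  (lam (eball c r) <= (2 ^+ n * r ^+ n)%:E)%E.
Proof.
move=> r0; rewrite -exprMn -(lebesgue_cube c r0); apply: le_measure; rewrite ?inE.
- exact: measurable_eball.
- exact: measurable_cube.
move=> x /= xc i; have := ler_enorm_coord (x - c) i.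
by move=> /le_lt_trans /(_ xc); rewrite !mxE ltr_norml => /andP[]; lra.
Qed.

(** The cube of half-side r / (n + 1) is inscribed, since the norm is at most the sum of the n
    coordinates. Taking n + 1 and not n makes the inclusion in the open ball strict, also for n =
    0. *)
Lemma lebesgue_eball_ge (c : 'rV[R]_n) (r : R) : 0 < r ->
  (((2 / n.+1%:R) ^+ n * r ^+ n)%:E <= lam (eball c r))%E.
Proof.
move=> r0; rewrite -exprMn (_ : 2 / _ * _ = 2 * (r / n.+1%:R)); last by ring.
rewrite -(lebesgue_cube c); last by rewrite divr_ge0// ltW.
apply: le_measure; rewrite ?inE.
- exact: measurable_cube.
- exact: measurable_eball.
move=> x /= xc; rewrite /eball/=; apply: le_lt_trans (enorm_le_sum _) _.
apply: (@le_lt_trans _ _ (\sum_(i < n) (r / n.+1%:R))).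
  apply: ler_sum => i _; rewrite !mxE ler_norml; have /andP[x1 x2] := xc i.
  by move: (r / n.+1%:R) x1 x2 => e; move=> x1 x2; apply/andP; split; lra.
rewrite big_const_ord iter_addr_0 -(mulr_natr (r / _) n) mulrAC ltr_pdivrMr//.
by rewrite ltr_pM2l// ltr_nat.
Qed.

End euclidean_norm.

Lemma closed_rV_measurable {R : realType} {n : nat} (F : set 'rV[R]_n) :
  closed F -> measurable F.
Proof.
move=> cF; rewrite -(setCK F); apply: measurableC; apply: rV_open_measurable.
exact: closed_openC.
Qed.

(** * Locally finite measures *)

Section locally_finite.
Local Open Scope ereal_scope.
Context {R : realType} {n : nat}.
Variable mu : {measure set 'rV[R]_n -> \bar R}.

Lemma eball_bounded_closure (c : 'rV[R]_n) (r : R) : exists2 K : set 'rV[R]_n,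
  compact K & eball c r `<=` K.
Proof.
pose A (i : 'I_n) : set R := `[(c ord0 i - r)%R, (c ord0 i + r)%R]%classic.
exists [set v | forall i, A i (v ord0 i)].
  by apply: rV_compact => i; exact: segment_compact.
move=> v /= vc i; have := ler_enorm_coord (v - c)%R i.
move=> /le_lt_trans /(_ vc); rewrite !mxE ltr_norml /A /= in_itv/= => /andP[? ?].
by apply/andP; split; lra.
Qed.

Lemma locally_finite_eball (c : 'rV[R]_n) (r : R) : locally_finite mu ->
  mu (eball c r) < +oo.
Proof.
move=> lf; have [K cK BK] := eball_bounded_closure c r.
have [U UP] := choice lf.
move: cK; rewrite compact_cover => /(_ _ setT U) [|x _|D _ KD].
- by move=> x _; have [] := UP x.
- by exists x => //; have [] := UP x.
have mU x : measurable (U x) by apply: rV_open_measurable; have [] := UP x.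
have := content_sub_fsum mu (finite_fset D) (fun i _ => mU i) (measurable_eball c r)
  (subset_trans BK KD).
move=> /le_lt_trans; apply; rewrite fsbig_finite//=.
by apply: lte_sum_pinfty => i _; have [] := UP i.
Qed.

Lemma bigcup_eball (c : 'rV[R]_n) : \bigcup_j eball c j.+1%:R = setT.
Proof.
apply/seteqP; split=> // x _; exists (Num.Def.trunc (enorm (x - c)%R)) => //.
by rewrite /eball/=; exact: truncnS_gt.
Qed.

Lemma locally_finite_sigma_finite : locally_finite mu -> sigma_finite setT mu.
Proof.
move=> lf; exists (fun j => eball 0 j.+1%:R); first by rewrite bigcup_eball.
by move=> j; split; [exact: measurable_eball|exact: locally_finite_eball].
Qed.

End locally_finite.

(** * Regularity of finite Borel measures *)

Section inner_regularity.
Local Open Scope ereal_scope.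
Context {R : realType} {n : nat}.
Variable mu : {measure set 'rV[R]_n -> \bar R}.
Hypothesis mufin : mu setT < +oo.

Let fin_mu A : measurable A -> mu A < +oo.
Proof. by move=> mA; apply: le_lt_trans mufin; apply: le_measure; rewrite ?inE. Qed.

(** Only inner approximation is wanted, but approximating from both sides makes the class stable
    under complements. *)
Let regular_set (A : set 'rV[R]_n) := forall e : R, (0 < e)%R ->
  exists F U, [/\ closed F, open U, F `<=` A, A `<=` U & mu (U `\` F) < e%:E].

Let cvg_mu_lt (A : (set 'rV[R]_n)^nat) (e : R) : (forall i, measurable (A i)) ->
  {homo A : n m / (n <= m)%N >-> (m <= n)%O} ->
  mu (\bigcap_i A i) < e%:E -> exists i, mu (A i) < e%:E.
Proof.
move=> mA Adec Ae.
have cvgA := nonincreasing_cvg_mu (mu := mu) (fin_mu (mA 0%N)) mA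
  (bigcap_measurable (ex_intro _ 0%N I) (fun i _ => mA i)) Adec.
have ltA : nbhs (mu (\bigcap_i A i)) [set x | x < e%:E].
  by apply: open_nbhs_nbhs; split=> //; exact: open_ereal_lt_ereal.
by have [N _ /(_ N (leqnn N))] := cvgA _ ltA; exists N.
Qed.

(** The points at distance at least 1 / (i + 1) from the complement form closed sets that increase
    to [U]. *)
Let regular_open U : open U -> regular_set U.
Proof.
move=> oU e e0.
pose F (i : nat) : set 'rV[R]_n := ~` \bigcup_(y in ~` U) ball y (i.+1%:R^-1 : R).
have cF i : closed (F i).
  by apply: open_closedC; apply: bigcup_open => y _; exact: ball_open.
have FU i : F i `<=` U.
  by move=> x Fx; apply: contrapT => Ux; apply: Fx; exists x => //; exact: ballxx.
have [i Ui] : exists i, mu (U `\` F i) < e%:E.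
  apply: cvg_mu_lt.
  - move=> i; apply: measurableD; first exact: rV_open_measurable.
    exact: closed_rV_measurable.
  - move=> i j ij; apply/subsetPset; apply: setDS; apply: subsetC; apply: subset_bigcup => y _.
    by apply: le_ball; rewrite lef_pV2 ?posrE// ler_nat.
  - rewrite (_ : \bigcap_i _ = set0) ?measure0 ?lte_fin// -subset0 => x UFx.
    have [Ux _] := UFx 0%N I.
    have /nbhs_ballP[r /= r0 xrU] : nbhs x U by exact: open_nbhs_nbhs.
    have [i _ /(_ i (leqnn i)) /= ir] := near_infty_natSinv_lt (PosNum r0).
    have [_] := UFx i I; apply => -[y Uy /= /(le_ball (ltW ir)) yx]; apply: Uy.
    by apply: xrU; exact: ball_sym.
by exists (F i), U; split.
Qed.

Let regular_sigma : sigma_algebra setT regular_set.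
Proof.
split.
- by apply: regular_open; exact: open0.
- move=> A regA e e0; have [F [U [cF oU FA AU UFe]]] := regA _ e0.
  exists (~` U), (~` F); split; rewrite ?openC ?closedC ?setTD//.
  + exact: subsetC.
  + exact: subsetC.
  + by rewrite setDE setCK setIC -setDE.
- move=> A regA e e0.
  (* These errors sum to at most e / 2. The slack up to e pays for cutting the union of the inner
     closed sets, which need not be closed, down to a finite one. *)
  have e1 i : (0 < (e / 2) / (2 ^ i.+1)%:R)%R by rewrite !divr_gt0// ltr0n expn_gt0.
  have /choice[FU FUP] i : exists FU : set 'rV[R]_n * set 'rV[R]_n,
      [/\ closed FU.1, open FU.2, FU.1 `<=` A i, A i `<=` FU.2 &
        mu (FU.2 `\` FU.1) < ((e / 2) / (2 ^ i.+1)%:R)%:E].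
    by have [F [U ?]] := regA i _ (e1 i); exists (F, U).
  pose F i := (FU i).1; pose U := \bigcup_i (FU i).2.
  have mF i : measurable (F i) by apply: closed_rV_measurable; have [] := FUP i.
  have oU : open U by apply: bigcup_open => i _; have [] := FUP i.
  have mFU i : measurable ((FU i).2 `\` F i).
    by apply: measurableD => //; apply: rV_open_measurable; have [] := FUP i.
  have mU := rV_open_measurable oU.
  have [N UN] : exists N, mu (U `\` \big[setU/set0]_(i < N) F i) < e%:E.
    apply: cvg_mu_lt.
    + by move=> i; apply: measurableD => //; exact: bigsetU_measurable.
    + move=> i j ij; apply/subsetPset; apply: setDS; exact: subset_bigsetU.
    + apply: (@le_lt_trans _ _ (e / 2)%:E); last by rewrite lte_fin ltr_pdivrMr// ltr_pMr// ltr1n.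
      apply: le_trans (epsilon_trick0 xpredT _); last by rewrite divr_ge0// ltW.
      apply: (@le_trans _ _ (\sum_(0 <= i <oo) mu ((FU i).2 `\` F i))).
        apply: measure_sigma_subadditive => //.
          apply: bigcap_measurable; first by exists 0%N.
          by move=> i _; apply: measurableD => //; exact: bigsetU_measurable.
        move=> x UFx; have [[i _ Ux] _] := UFx 0%N I; exists i => //; split=> // Fix.
        by have [_] := UFx i.+1 I; apply; rewrite big_ord_recr/=; right.
      by apply: lee_nneseries => i _ //; apply: ltW; have [] := FUP i.
  exists (\big[setU/set0]_(i < N) F i), U; split=> //.
  + by apply: closed_bigsetU => i _; have [] := FUP i.
  + rewrite -bigcup_mkord => x [i _ Fix]; exists i => //.
    by have [_ _ FA _ _] := FUP i; exact: FA.
  + by apply: subset_bigcup => i _; have [] := FUP i.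
Qed.

Lemma finite_measure_inner_regular (A : set 'rV[R]_n) (e : R) : measurable A -> (0 < e)%R ->
  exists2 F, closed F /\ F `<=` A & mu A <= mu F + e%:E.
Proof.
move=> mA e0; have : regular_set A.
  exact: (smallest_sub regular_sigma (fun U => @regular_open U)).
move=> /(_ _ e0) [F [U [cF oU FA AU UFe]]]; exists F => //.
have mF := closed_rV_measurable cF; have mU := rV_open_measurable oU.
apply: (@le_trans _ _ (mu (F `|` (U `\` F)))).
  apply: le_measure; rewrite ?inE//.
    by apply: measurableU => //; exact: measurableD.
  by move=> x /AU Ux; have [|] := pselect (F x); [left|right].
apply: (le_trans (measureU2 _ _ _)) => //; first exact: measurableD.
by rewrite leeD2l// ltW.
Qed.

End inner_regularity.

(** * Restricted measures and inner regularity by compact sets *)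

Section integral_mrestr.
Local Open Scope ereal_scope.

Lemma ge0_integral_mrestr d (T : measurableType d) (R : realType)
    (mu : {measure set T -> \bar R}) (B : set T) (mB : measurable B) (f : T -> \bar R) :
  measurable_fun setT f -> (forall x, 0 <= f x) ->
  \int[mrestr mu mB]_x f x = \int[mu]_(x in B) f x.
Proof.
move=> mf f0.
rewrite (@ge0_negligible_integral _ _ _ (mrestr mu mB) setT (~` B))//.
- rewrite setTD setCK; apply: eq_measure_integral => A mA AB.
  by rewrite /= /mrestr setIidl.
- exact: measurableC.
- by rewrite /= /mrestr setICl measure0.
Qed.

End integral_mrestr.

(** Restricting to the ball makes the measure finite, and closed subsets of a bounded set are
    compact. *)
Lemma compact_inner_regular {R : realType} {n : nat}
    (mu : {measure set 'rV[R]_n -> \bar R}) (c : 'rV[R]_n) (r : R) (A : set 'rV[R]_n) (e : R) :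
  locally_finite mu -> measurable A -> A `<=` eball c r -> 0 < e ->
  exists2 K, compact K /\ K `<=` A & (mu A <= mu K + e%:E)%E.
Proof.
move=> lf mA AB e0.
have fin : (mrestr mu (measurable_eball c r) setT < +oo)%E.
  by rewrite /= /mrestr setTI; exact: locally_finite_eball.
have [F [cF FA] AF] := finite_measure_inner_regular fin mA e0.
exists F; last by move: AF; rewrite /= /mrestr !setIidl//; exact: subset_trans AB.
split=> //; have [K cK BK] := eball_bounded_closure c r.
by apply: (subclosed_compact cF cK); exact: subset_trans (subset_trans AB BK).
Qed.

(** * Monotone convergence *)

Section monotone.
Local Open Scope ereal_scope.
Context d (T : measurableType d) (R : realType) (mu : {measure set T -> \bar R}).

Lemma cvg_integral_nd (F : nat -> T -> \bar R) (f : T -> \bar R) :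
  (forall i, measurable_fun setT (F i)) -> (forall i y, 0 <= F i y) ->
  (forall y, {homo F^~ y : i j / (i <= j)%N >-> i <= j}) ->
  (forall y, F i y @[i --> \oo] --> f y) ->
  \int[mu]_y F i y @[i --> \oo] --> \int[mu]_y f y.
Proof.
move=> mF F0 ndF Ff; rewrite (_ : f = fun y => limn (F^~ y)); last first.
  by apply/funext => y; apply/esym/cvg_lim.
by apply: cvg_monotone_convergence => // y _; exact: ndF.
Qed.

Lemma le_integral_nd (F : nat -> T -> \bar R) (f : T -> \bar R) (M : \bar R) :
  (forall i, measurable_fun setT (F i)) -> (forall i y, 0 <= F i y) ->
  (forall y, {homo F^~ y : i j / (i <= j)%N >-> i <= j}) ->
  (forall y, F i y @[i --> \oo] --> f y) ->
  (forall i, \int[mu]_y F i y <= M) -> \int[mu]_y f y <= M.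
Proof.
move=> mF F0 ndF Ff FM; have cF := cvg_integral_nd mF F0 ndF Ff.
by rewrite -(cvg_lim _ cF)//; apply: lime_le; [apply/cvg_ex; eexists; exact: cF|exact: nearW].
Qed.

End monotone.

(** * Potentials of doubling radial kernels *)

Section potentials.
Local Open Scope ereal_scope.
Context {R : realType} {n : nat}.
Implicit Types (f g : 'rV[R]_n -> \bar R).

(* Both k * (f dm) and, with [f = 1], k * m. *)
Definition pot (k : 'rV[R]_n -> R) (m : set 'rV[R]_n -> \bar R) f x :=
  \int[m]_y ((k (x - y)%R)%:E * f y).

Lemma conv_funE k f : conv_fun k f = pot k (lebesgue_rV n) f.
Proof. by []. Qed.

Lemma measurable_indicE (B : set 'rV[R]_n) : measurable B ->
  measurable_fun setT (fun x : 'rV[R]_n => (\1_B x : R)%:E).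
Proof. by move=> mB; apply/measurable_EFinP; exact: measurable_indic. Qed.

Lemma indicE_ge0 (B : set 'rV[R]_n) x : 0 <= (\1_B x : R)%:E.
Proof. by rewrite lee_fin. Qed.

Lemma integral_indicr (m : {measure set 'rV[R]_n -> \bar R}) B f : measurable B ->
  \int[m]_(x in B) f x = \int[m]_x (f x * (\1_B x)%:E).
Proof.
move=> mB; rewrite integral_mkcond; apply: eq_integral => x _.
by rewrite patchE indicE; case: ifP => _; rewrite ?mule1 ?mule0.
Qed.

Variable k : 'rV[R]_n -> R.
Hypotheses (mk : measurable_fun setT k) (k_gt0 : forall x, (0 < k x)%R)
  (kN : forall x, k (- x) = k x).

Let k_ge0 x : 0 <= (k x)%:E. Proof. by rewrite lee_fin ltW. Qed.

Let kC x y : k (x - y) = k (y - x).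
Proof. by rewrite -kN opprB. Qed.

Lemma measurable_kernel :
  measurable_fun setT (fun z : 'rV[R]_n * 'rV[R]_n => (k (z.1 - z.2)%R)%:E).
Proof.
apply/measurable_EFinP; apply: (measurableT_comp mk).
exact: measurable_subrV.
Qed.

Lemma measurable_kernel1 (x : 'rV[R]_n) : measurable_fun setT (fun y : 'rV[R]_n => (k (x - y)%R)%:E).
Proof. exact: (measurable_section2 (F := fun x y : 'rV[R]_n => (k (x - y)%R)%:E) measurable_kernel). Qed.

Section one_measure.
Variable m : {sigma_finite_measure set 'rV[R]_n -> \bar R}.

Lemma pot_ge0 f x : (forall y, 0 <= f y) -> 0 <= pot k m f x.
Proof. by move=> f0; apply: integral_ge0 => y _; rewrite mule_ge0. Qed.

Lemma measurable_pot f : measurable_fun setT f -> (forall y, 0 <= f y) ->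
  measurable_fun setT (pot k m f).
Proof.
move=> mf f0.
apply: (measurable_integral2 (F := fun x y : 'rV[R]_n => (k (x - y)%R)%:E * f y)).
  apply: emeasurable_funM; first exact: measurable_kernel.
  exact: measurableT_comp.
by move=> x y; rewrite mule_ge0.
Qed.

Lemma measurable_potI f (x : 'rV[R]_n) : measurable_fun setT f ->
  measurable_fun setT (fun y : 'rV[R]_n => (k (x - y)%R)%:E * f y).
Proof. by move=> mf; apply: emeasurable_funM => //; exact: measurable_kernel1. Qed.

Lemma le_pot f g x : measurable_fun setT f -> (forall y, 0 <= f y) ->
  measurable_fun setT g -> (forall y, f y <= g y) -> pot k m f x <= pot k m g x.
Proof.
move=> mf f0 mg fg; apply: ge0_le_integral => //.
- by move=> y _; rewrite mule_ge0.
- exact: measurable_potI.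
- exact: measurable_potI.
- by move=> y _; rewrite lee_wpmul2l.
Qed.

(** The conclusion holds at every x because a potential does not see null sets of its measure. *)
Lemma ae_le_pot f g x : measurable_fun setT f -> (forall y, 0 <= f y) ->
  measurable_fun setT g -> (forall y, 0 <= g y) ->
  {ae m, forall y, f y <= g y} -> pot k m f x <= pot k m g x.
Proof.
move=> mf f0 mg g0 fg; apply: ae_ge0_le_integral => //.
- by move=> y _; rewrite mule_ge0.
- exact: measurable_potI.
- by move=> y _; rewrite mule_ge0.
- exact: measurable_potI.
- by apply: filterS fg => y fgy _; rewrite lee_wpmul2l.
Qed.

Lemma potZ (a : R) f x : (0 <= a)%R -> measurable_fun setT f -> (forall y, 0 <= f y) ->
  pot k m (fun y => a%:E * f y) x = a%:E * pot k m f x.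
Proof.
move=> a0 mf f0; rewrite /pot; under eq_integral do rewrite muleCA.
rewrite ge0_integralZl//; last by move=> y _; rewrite mule_ge0.
exact: measurable_potI.
Qed.

Lemma cvg_pot (F : nat -> 'rV[R]_n -> \bar R) f x :
  (forall i, measurable_fun setT (F i)) -> (forall i y, 0 <= F i y) ->
  (forall y, {homo F^~ y : i j / (i <= j)%N >-> i <= j}) ->
  (forall y, F i y @[i --> \oo] --> f y) ->
  pot k m (F i) x @[i --> \oo] --> pot k m f x.
Proof.
move=> mF F0 ndF Ff; apply: cvg_integral_nd.
- by move=> i; exact: measurable_potI.
- by move=> i y; rewrite mule_ge0.
- by move=> y i j ij; rewrite lee_wpmul2l// ndF.
- by move=> y; apply: cvgeZl => //; exact: Ff.
Qed.

End one_measure.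

(** Self-adjointness of the potential: Tonelli and the evenness of [k]. *)
Lemma pot_exchange (m1 m2 : {sigma_finite_measure set 'rV[R]_n -> \bar R}) f g :
  measurable_fun setT f -> (forall y, 0 <= f y) ->
  measurable_fun setT g -> (forall y, 0 <= g y) ->
  \int[m1]_x (g x * pot k m2 f x) = \int[m2]_y (f y * pot k m1 g y).
Proof.
move=> mf f0 mg g0.
transitivity (\int[m1]_x \int[m2]_y (g x * ((k (x - y)%R)%:E * f y))).
  apply: eq_integral => x _; rewrite ge0_integralZl//.
    exact: measurable_potI.
  by move=> y _; rewrite mule_ge0.
rewrite (tonelli_exchange (F := fun x y : 'rV[R]_n => g x * ((k (x - y)%R)%:E * f y))); first last.
- by move=> x y; rewrite !mule_ge0.
- apply: emeasurable_funM; first exact: measurableT_comp.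
  apply: emeasurable_funM; first exact: measurable_kernel.
  exact: measurableT_comp.
apply: eq_integral => y _; rewrite -ge0_integralZl//.
- by apply: eq_integral => x _; rewrite kC muleCA [RHS]muleC -muleA muleCA.
- exact: measurable_potI.
- by move=> x _; rewrite mule_ge0.
Qed.

Lemma conv_measure_mrestrE (m : {measure set 'rV[R]_n -> \bar R}) (B : set 'rV[R]_n)
    (mB : measurable B) x :
  conv_measure k (mrestr m mB) x = pot k m (fun y => (\1_B y)%:E) x.
Proof.
rewrite /conv_measure ge0_integral_mrestr//; last exact: measurable_kernel1.
exact: integral_indicr.
Qed.

End potentials.

(** * Conjugate exponents and Young's inequality *)

Section conjugate_exponents.
Context {R : realType}.
Variables (p q : R).
Hypotheses (q_gt1 : 1 < q) (pq : p^-1 + q^-1 = 1).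

Lemma conj_neq0 : p != 0.
Proof.
apply/eqP => p0; move: pq; rewrite p0 invr0 add0r => q1.
have : q = 1 by rewrite -[q]invrK q1 invr1.
by move=> q1'; move: q_gt1; rewrite q1' ltxx.
Qed.

Lemma conj_mul : (p - 1) * (q - 1) = 1.
Proof.
have q0 : q != 0 by rewrite gt_eqF// (lt_trans ltr01).
have /(congr1 (fun x => p * q * x)) := pq.
have -> : p * q * (p^-1 + q^-1) = p + q by field; rewrite q0 conj_neq0.
by rewrite mulr1 => E; rewrite mulrBl mul1r mulrBr !mulr1 -E; ring.
Qed.

Lemma conj_gt1 : 1 < p.
Proof.
rewrite -subr_gt0; have q1 : 0 < q - 1 by rewrite subr_gt0.
by rewrite -(pmulr_lgt0 _ q1) conj_mul.
Qed.

Lemma conj_mulr : (p - 1) * q = p.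
Proof. by have := conj_mul; rewrite mulrBr mulr1 => /eqP; rewrite subr_eq => /eqP ->; ring. Qed.

Lemma conj_mull : (q - 1) * p = q.
Proof. by have := conj_mul; rewrite mulrC mulrBr mulr1 => /eqP; rewrite subr_eq => /eqP ->; ring. Qed.

(** If b is at most (t a)^(p - 1), the second term alone dominates. Otherwise t a is at most b^(q -
    1) and the first one does. A large t makes the term in b small enough to be absorbed. *)
Lemma weighted_young (t : R) (a b : \bar R) : 0 < t -> (0 <= a)%E -> (0 <= b)%E ->
  (a * b <= (t^-1)%:E * b `^ q + (t `^ (p - 1))%:E * a `^ p)%E.
Proof.
move=> t0; have p1 := conj_gt1.
have p0 : 0 < p by exact: lt_trans p1.
have q0 : 0 < q by exact: lt_trans q_gt1.
have t1 : 0 < t^-1 by rewrite invr_gt0.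
have tp : 0 < t `^ (p - 1) by exact: powR_gt0.
case: a => [a| |]//; last first.
  move=> _ b0; rewrite poweRyr ?gt_eqF// [X in (_ + X)%E]gt0_muley ?lte_fin// addey ?leey//.
  by rewrite gt_eqF// (lt_le_trans (ltNyr 0))// mule_ge0 ?poweR_ge0// lee_fin ltW.
case: b => [b| |]//; last first.
  by move=> a0 _; rewrite poweRyr ?gt_eqF// [X in (X + _)%E]gt0_muley ?lte_fin// addye ?leey//.
move=> a0 b0; rewrite lee_fin in a0; rewrite lee_fin in b0; rewrite !poweR_EFin -!EFinM -EFinD lee_fin.
have ta0 : 0 <= t * a by rewrite mulr_ge0// ltW.
have [le|lt] := leP b ((t * a) `^ (p - 1)).
  apply: (@le_trans _ _ (t `^ (p - 1) * a `^ p)).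
    rewrite -(mulr_powRB1 a0 p0) mulrCA ler_wpM2l// -powRM// ltW//.
  by rewrite lerDr mulr_ge0// ?powR_ge0// ltW.
apply: (@le_trans _ _ (t^-1 * b `^ q)); last first.
  by rewrite lerDl mulr_ge0// ?powR_ge0// ltW.
rewrite -(mulr_powRB1 b0 q0) mulrC mulrCA ler_wpM2l// -(ler_pM2l t0) mulrA divff ?gt_eqF// mul1r.
rewrite [leLHS](_ : _ = (t * a) `^ (p - 1) `^ (q - 1)); last by rewrite -powRrM conj_mul powRr1.
by apply: ge0_ler_powR; rewrite ?nnegrE ?powR_ge0// ?subr_ge0 ltW.
Qed.

End conjugate_exponents.

(** * Powers of monotone limits *)

Section poweR_limits.
Local Open Scope ereal_scope.
Context {R : realType}.

Lemma lee_poweR (x y : \bar R) (p : R) : (0 <= p)%R -> 0 <= x -> x <= y ->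
  x `^ p <= y `^ p.
Proof.
move=> p0 x0 xy; rewrite gt0_ler_poweR// in_itv/= leey andbT//.
exact: le_trans xy.
Qed.

(** Both limits are suprema, and the inverse power carries the bound of one to the other; this
    includes an infinite limit. *)
Lemma cvg_poweR_nd (F : nat -> \bar R) (l : \bar R) (p : R) : (0 < p)%R ->
  (forall i, 0 <= F i) -> {homo F : i j / (i <= j)%N >-> i <= j} ->
  F i @[i --> \oo] --> l -> F i `^ p @[i --> \oo] --> l `^ p.
Proof.
move=> p0 F0 ndF Fl.
have ndP : {homo (fun i => F i `^ p) : i j / (i <= j)%N >-> i <= j}.
  by move=> i j ij; apply: lee_poweR; rewrite ?(ltW p0)// ndF.
have cP := ereal_nondecreasing_cvgn ndP.
have Fub i : F i <= l.
  rewrite -(cvg_lim _ Fl)// (cvg_lim _ (ereal_nondecreasing_cvgn ndF))//.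
  by apply: ereal_sup_ubound; exists i.
have l0 : 0 <= l by apply: le_trans (F0 0%N) (Fub 0%N).
set s := ereal_sup _ in cP.
have Fs i : F i `^ p <= s by apply: ereal_sup_ubound; exists i.
have s0 : 0 <= s by apply: le_trans (Fs 0%N); exact: poweR_ge0.
rewrite (_ : l `^ p = s)//; apply/eqP; rewrite eq_le; apply/andP; split; last first.
  apply: ge_ereal_sup => _ [i _ <-]; apply: lee_poweR; rewrite ?(ltW p0)//.
have ls : l <= s `^ p^-1.
  rewrite -(cvg_lim _ Fl)//; apply: lime_le; first by apply/cvg_ex; exists l.
  apply: nearW => j; rewrite -[leLHS]poweRe1// -(divff (lt0r_neq0 p0)) poweRrM.
  by apply: lee_poweR; rewrite ?invr_ge0 ?(ltW p0)// poweR_ge0.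
rewrite -[leRHS]poweRe1// -(mulVf (lt0r_neq0 p0)) poweRrM.
by apply: lee_poweR; rewrite ?(ltW p0).
Qed.

End poweR_limits.

(** * Layer cake and truncation *)

Section layer_cake.
Local Open Scope ereal_scope.
Context {R : realType}.

Lemma measure_integral_indic d (T : measurableType d) (m : {measure set T -> \bar R}) A :
  measurable A -> m A = \int[m]_x (\1_A x)%:E.
Proof. by move=> mA; rewrite integral_indic ?setIT. Qed.

(** A kernel value written as the measure of the levels below it, in a form to which Tonelli
    applies. *)
Lemma integral_layer (a : R) : (0 <= a)%R ->
  \int[lebesgue_measure]_t (if (0 < t)%R && (t < a)%R then 1 else 0) = a%:E.
Proof.
move=> a0; transitivity (lebesgue_measure `]0%R, a[%classic).
  rewrite measure_integral_indic//; apply: eq_integral => t _.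
  by rewrite indicE mem_setE in_itv/=; case: ifP.
rewrite lebesgue_measure_itv/= lte_fin; case: ltP => [_|a0']; first by rewrite sube0.
by congr EFin; apply/eqP; rewrite eq_le a0.
Qed.

End layer_cake.

Section min_limit.
Local Open Scope ereal_scope.
Context {R : realType}.

Lemma cvg_mine_nat (w : \bar R) : 0 <= w -> mine w (N%:R)%:E @[N --> \oo] --> w.
Proof.
case: w => [w| |]// w0.
  apply: cvg_near_cst; exists (Num.Def.trunc w).+1 => // N /= wN.
  apply/min_idPl; rewrite lee_fin ltW//; apply: (lt_le_trans (truncnS_gt _)).
  by rewrite ler_nat.
rewrite (_ : (fun N => _) = fun N : nat => (N%:R : R)%:E); first exact/cvgeryP/cvgr_idn.
by apply/funext => N; apply/min_idPr; rewrite leey.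
Qed.

(** One step of the dyadic decomposition of V: only the set where V exceeds [a] pays for doubling
    the truncation level. *)
Lemma mine_doubling (V : \bar R) (a : R) : (0 <= a)%R ->
  mine V (2 * a)%:E <= mine V a%:E + (if a%:E < V then a%:E else 0).
Proof.
move=> a0; have [aV|Va] := ltP a%:E V.
  rewrite -EFinD.
  by rewrite ge_min lee_fin (_ : 2 * a = a + a)%R ?lexx ?orbT//; ring.
by rewrite adde0 ge_min lexx.
Qed.

End min_limit.

(** * Doubling radial kernels *)

Section radial_kernel.
Local Open Scope ereal_scope.
Context {R : realType} {n : nat}.
Variables (k : 'rV[R]_n -> R) (h : R -> R) (D : R).
Hypotheses (n_gt0 : (0 < n)%N) (k_gt0 : forall x, (0 < k x)%R)
  (kE : forall x, x != 0%R -> k x = h (enorm x))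
  (h_dec : forall r s : R, (0 < r)%R -> (r <= s)%R -> (h s <= h r)%R)
  (hD : forall r : R, (0 < r)%R -> (h r <= D * h (2 * r))%R).

Local Notation lam := (lebesgue_rV n : {sigma_finite_measure set 'rV[R]_n -> \bar R}).

Lemma exists_enorm (r : R) : (0 < r)%R -> exists x : 'rV[R]_n, enorm x = r.
Proof.
move=> r0; pose u : 'rV[R]_n := const_mx 1%R.
have u0 : (0 < enorm u)%R.
  rewrite enorm_gt0; apply/eqP => /rowP /(_ (Ordinal n_gt0)).
  by rewrite !mxE => /eqP; rewrite oner_eq0.
exists ((r / enorm u) *: u)%R; rewrite enormZ ger0_norm ?divr_ge0 ?ltW//.
by rewrite divfK// gt_eqF.
Qed.

Lemma profile_gt0 (r : R) : (0 < r)%R -> (0 < h r)%R.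
Proof.
move=> r0; have [x xr] := exists_enorm r0; rewrite -xr -kE//.
by rewrite -enorm_gt0 xr.
Qed.

Lemma doubling_gt0 : (0 < D)%R.
Proof.
have h1 : (0 < h 1)%R by exact: profile_gt0.
have h2 : (0 < h (2 * 1))%R by apply: profile_gt0; rewrite mulr1.
by rewrite -(pmulr_lgt0 _ h2); apply: lt_le_trans (hD ltr01).
Qed.

Lemma radial_even x : k (- x)%R = k x.
Proof.
have [->|x0] := eqVneq x 0%R; first by rewrite oppr0.
by rewrite !kE ?oppr_eq0// enormN.
Qed.

Lemma measurable_radial : measurable_fun setT k.
Proof.
(* [h] is monotone on positive radii only; composed with the exponential it is monotone on the whole
   line. *)
rewrite (_ : k = fun x => if enorm x == 0 then k 0 else h (expR (ln (enorm x))))%R; last first.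
  apply/funext => x; rewrite enorm_eq0; case: eqVneq => [->//|x0].
  by rewrite lnK ?posrE ?enorm_gt0// kE.
apply: measurable_fun_ifT.
- by apply: measurable_fun_eqr => //; exact: measurable_enorm.
- exact: measurable_cst.
- apply: (measurableT_comp (f := h \o expR)).
    apply: nonincreasing_measurable => // r s rs /=.
    by apply: h_dec; rewrite ?expR_gt0// ler_expR.
  apply: (measurableT_comp (@measurable_ln R)); exact: measurable_enorm.
Qed.

(** One doubling step; the factor 2 is what the triangle inequality produces in the applications.
    The origin is excluded because [h] does not determine [k 0]. *)
Lemma quasi_metric (a b : 'rV[R]_n) : a != 0%R -> b != 0%R ->
  (enorm a <= 2 * enorm b)%R -> (k b <= D * k a)%R.
Proof.
move=> a0 b0 ab; rewrite !kE//; apply: le_trans (hD _) _; first by rewrite enorm_gt0.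
by rewrite ler_wpM2l ?(ltW doubling_gt0)// h_dec// enorm_gt0.
Qed.

Lemma lebesgue_rV_set1 (x : 'rV[R]_n) : lam.-negligible [set x].
Proof.
exists [set y : 'rV[R]_n | forall i, (x ord0 i - 0 <= y ord0 i <= x ord0 i + 0)%R]; split.
- exact: measurable_cube.
- by rewrite lebesgue_cube// mulr0 expr0n gtn_eqF.
- by move=> y /= -> i; rewrite subr0 addr0 lexx.
Qed.

Lemma ae_neq (x : 'rV[R]_n) : {ae lam, forall y, y != x}.
Proof.
apply: negligibleS (lebesgue_rV_set1 x) => y /=.
by move/negP; rewrite negbK => /eqP.
Qed.

Let mk := measurable_radial.
Let kN := radial_even.
Let k_ge0 x : 0 <= (k x)%:E. Proof. by rewrite lee_fin ltW. Qed.

(** Points are ranked by their distance to x. If z is at least as far from x as y, then |y - z| is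
    at most 2 |x - z|, so the upper mass at y is at most [D] times the potential at y. *)
Lemma pot_power f x (s : R) : (0 <= s)%R ->
  measurable_fun setT f -> (forall y, 0 <= f y) -> pot k lam f x < +oo ->
  pot k lam f x `^ (s + 1)%R <=
    (4 `^ s * 2 * D `^ s)%:E * pot k lam (fun y => f y * pot k lam f y `^ s) x.
Proof.
move=> s0 mf f0 fin; have D0 := doubling_gt0.
have mp := measurable_pot mk k_gt0 lam mf f0.
have p0 y : 0 <= pot k lam f y by exact: pot_ge0.
have mg := measurable_potI mk x mf.
have mr : measurable_fun setT (fun y : 'rV[R]_n => enorm (x - y)%R).
  apply: (measurableT_comp measurable_enorm); exact: measurable_subrV.
have g0 y : 0 <= (k (x - y)%R)%:E * f y by rewrite mule_ge0.
apply: le_trans (rank_power s0 mg g0 mr fin) _.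
rewrite (_ : (_ * D `^ s)%:E = (4 `^ s * 2)%:E * (D `^ s)%:E)// -muleA lee_wpmul2l//.
have mb (y : 'rV[R]_n) : measurable_fun setT (fun z : 'rV[R]_n => (enorm (x - y) <= enorm (x - z))%R).
  by apply: measurable_fun_ler.
have mfp : measurable_fun setT (fun y => f y * pot k lam f y `^ s).
  by apply: emeasurable_funM => //; exact: measurable_poweR.
have fp0 y : 0 <= f y * pot k lam f y `^ s by rewrite mule_ge0// poweR_ge0.
rewrite -potZ// ?powR_ge0//.
apply: ge0_le_integral => //.
- by move=> y _; rewrite mule_ge0// poweR_ge0.
- apply: emeasurable_funM => //; apply: measurable_poweR.
  apply: (measurable_integral2 (F := fun y z : 'rV[R]_n => if (enorm (x - y) <= enorm (x - z))%R
    then (k (x - z)%R)%:E * f z else 0)); last by move=> y z; case: ifP.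
  apply: measurable_fun_ifT => //.
    by apply: measurable_fun_ler; apply: (measurableT_comp mr).
  exact: (measurableT_comp mg).
- by apply: measurable_potI => //; apply: emeasurable_funM => //; exact: measurable_cst.
move=> y _; rewrite -!muleA [X in _ <= _ * X]muleCA lee_wpmul2l// lee_wpmul2l//.
rewrite -poweR_EFin -poweRM//; last by rewrite lee_fin ltW.
rewrite gt0_ler_poweR// ?in_itv/= ?leey ?andbT//.
- by apply: integral_ge0 => z _; case: ifP.
- by rewrite mule_ge0// lee_fin ltW.
rewrite -potZ ?(ltW D0)// /pot.
apply: ae_ge0_le_integral => //.
- by move=> z _; case: ifP.
- exact: measurable_if0.
- by move=> z _; rewrite !mule_ge0// lee_fin ltW.
- by apply: measurable_potI => //; apply: emeasurable_funM => //; exact: measurable_cst.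
apply: filterS2 (ae_neq x) (ae_neq y) => z zx zy _; case: ifP => [xyz|_]; last first.
  by rewrite !mule_ge0// lee_fin ltW.
rewrite muleA lee_wpmul2r// -EFinM lee_fin mulrC; apply: quasi_metric.
- by rewrite subr_eq0 eq_sym.
- by rewrite subr_eq0 eq_sym.
- apply: le_trans (ler_enorm_trans y x z) _; rewrite enormB; lra.
Qed.

Let h_gt0 := profile_gt0.
Let D_gt0 := doubling_gt0.

Let mB (c : 'rV[R]_n) s : measurable_fun setT (fun y : 'rV[R]_n => (\1_(eball c s) y : R)%:E).
Proof. by apply: measurable_indicE; exact: measurable_eball. Qed.

Let mrho (x : 'rV[R]_n) : measurable_fun setT (fun z : 'rV[R]_n => enorm (x - z)%R).
Proof. by apply: (measurableT_comp measurable_enorm); exact: measurable_subrV. Qed.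

(** The overview's Phi, before its finiteness is known; [phi] is the real-valued version. *)
Definition ball_mass (s : R) := \int[lam]_y ((k y)%:E * (\1_(eball 0 s) y)%:E).
Hypothesis ball_mass_fin : forall s, ball_mass s < +oo.

Lemma pot_eball x s : pot k lam (fun y => (\1_(eball x s) y)%:E) x = ball_mass s.
Proof.
rewrite /ball_mass -(lebesgue_rV_reflect x (f := fun v => (k v)%:E * (\1_(eball 0 s) v)%:E)).
- apply: eq_integral => y _; congr (_ * (_ : bool)%:R%:E).
  by apply/idP/idP; rewrite !inE /eball/= subr0 enormB.
- apply: emeasurable_funM; first exact/measurable_EFinP.
  by apply: measurable_indicE; exact: measurable_eball.
- by move=> y; rewrite mule_ge0// indicE_ge0.
Qed.

(** Within distance 1 of x the kernel has total mass [ball_mass 1], whatever x is; beyond it is at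
    most [h 1]. *)
Lemma pot_bounded (r M : R) : (0 <= M)%R -> exists C : R, forall (g : 'rV[R]_n -> \bar R) x,
  measurable_fun setT g -> (forall y, 0 <= g y) ->
  (forall y, g y <= M%:E * (\1_(eball 0 r) y)%:E) -> pot k lam g x <= C%:E.
Proof.
move=> M0.
have [B BE] : exists B : R, lam (eball 0 r) = B%:E.
  exists (fine (lam (eball 0 r))); rewrite fineK// ge0_fin_numE//.
  have [r0|r0] := leP 0%R r; first by apply: le_lt_trans (lebesgue_eball_le _ r0) _; exact: ltry.
  rewrite (_ : eball 0 r = set0) ?measure0//.
  rewrite -subset0 => x; rewrite /eball/= => /lt_trans /(_ r0).
  by rewrite ltNge enorm_ge0.
have [P PE] : exists P : R, ball_mass 1 = P%:E.
  exists (fine (ball_mass 1)); rewrite fineK// ge0_fin_numE ?ball_mass_fin//.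
  by apply: integral_ge0 => y _; rewrite mule_ge0// indicE_ge0.
have h1 : (0 < h 1)%R by exact: profile_gt0.
exists (M * (P + h 1 * B))%R => g x mg g0 gM.
apply: (@le_trans _ _ (\int[lam]_y (M%:E * ((k (x - y)%R)%:E * (\1_(eball x 1) y)%:E +
    (h 1)%:E * (\1_(eball 0 r) y)%:E)))).
  apply: ge0_le_integral => //.
  - by move=> y _; rewrite mule_ge0.
  - exact: measurable_potI.
  - apply: emeasurable_funM; first exact: measurable_cst.
    apply: emeasurable_funD; first exact: measurable_potI.
    by apply: emeasurable_funM; first exact: measurable_cst.
  move=> y _; apply: (@le_trans _ _ ((k (x - y)%R)%:E * (M%:E * (\1_(eball 0 r) y)%:E))).
    by rewrite lee_wpmul2l.
  rewrite muleCA lee_wpmul2l// !indicE.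
  have [xy|xy] := boolP (y \in eball x 1).
    rewrite mule1; case: (_ \in _); rewrite ?mule1 ?mule0 ?adde0//.
    by rewrite leeDl// lee_fin ltW.
  rewrite mule0 add0e lee_wpmul2r// lee_fin kE.
    apply: h_dec => //; move: xy; rewrite notin_setE /eball/= => /negP.
    by rewrite -leNgt enormB.
  apply: contra xy => /eqP xy; rewrite inE /eball/= enormB xy enorm0//.
rewrite ge0_integralZl//; last 2 first.
- apply: emeasurable_funD; first exact: measurable_potI.
  by apply: emeasurable_funM; first exact: measurable_cst.
- by move=> y _; rewrite adde_ge0// mule_ge0// ?indicE_ge0// lee_fin ltW.
rewrite ge0_integralD//; last 4 first.
- by move=> y _; rewrite mule_ge0// indicE_ge0.
- exact: measurable_potI.
- by move=> y _; rewrite mule_ge0// ?indicE_ge0// lee_fin ltW.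
- by apply: emeasurable_funM; first exact: measurable_cst.
rewrite ge0_integralZl ?lee_fin ?(ltW h1)//.
rewrite integral_indic//; last exact: measurable_eball.
rewrite setIT -[X in _ * (X + _)]/(pot k lam (fun y => (\1_(eball x 1) y)%:E) x).
rewrite pot_eball; rewrite [X in _ * (_ + _ * X) <= _](_ : _ = B%:E)//.
by rewrite [X in _ * (X + _) <= _](_ : _ = P%:E)// -!EFinM -EFinD lee_fin.
Qed.

(** * From a supersolution to the trace inequality *)

Variables p q : R.
Hypotheses (q_gt1 : (1 < q)%R) (pq : (p^-1 + q^-1 = 1)%R).

Let p_gt1 := conj_gt1 q_gt1 pq.
Let q_gt0 : (0 < q)%R. Proof. exact: lt_trans ltr01 q_gt1. Qed.

Lemma trace_of_supersolution (omega : {sigma_finite_measure set 'rV[R]_n -> \bar R})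
    (u : 'rV[R]_n -> \bar R) (e : R) : (0 < e)%R ->
  measurable_fun setT u -> (forall x, 0 <= u x) ->
  {ae lam, forall x, u x < +oo} ->
  {ae lam, forall x, pot k lam (fun y => u y `^ q) x <= u x} ->
  {ae lam, forall x, e%:E * pot k omega (cst 1) x <= u x} ->
  exists C : R, forall f, measurable_fun setT f -> (forall x, 0 <= f x) ->
    \int[omega]_x (pot k lam f x `^ p) <= C%:E * \int[lam]_x (f x `^ p).
Proof.
move=> e0 mu u0 ufin supu wu.
have p1 : (1 < p)%R by exact: conj_gt1 pq.
have p0 : (0 < p)%R by exact: lt_trans p1.
have pm0 : (0 <= p - 1)%R by rewrite subr_ge0 ltW.
have D0 : (0 < D)%R by exact: doubling_gt0.
pose C0 := (4 `^ (p - 1) * 2 * D `^ (p - 1))%R.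
have C00 : (0 < C0)%R by rewrite !mulr_gt0// powR_gt0.
(* Young's inequality with this weight returns [J] with coefficient [C0 / t], that is 1/2. *)
pose t := (2 * C0)%R.
have t0 : (0 < t)%R by rewrite mulr_gt0.
have mw : measurable_fun setT (pot k omega (cst 1)) by exact: measurable_pot.
have w0 x : 0 <= pot k omega (cst 1) x by exact: pot_ge0.
have muq : measurable_fun setT (fun y => u y `^ q) by exact: measurable_poweR.
have uq0 y : 0 <= u y `^ q by exact: poweR_ge0.
(* The term to be absorbed must be finite, hence the truncation of f. *)
have bounded_case (g : 'rV[R]_n -> \bar R) (N : nat) : measurable_fun setT g ->
    (forall x, 0 <= g x) ->
    (forall x, g x <= N%:R%:E * (\1_(eball 0 N%:R) x)%:E) ->
    (forall x, g x * u x <= (N%:R * N%:R)%:E * (\1_(eball 0 N%:R) x)%:E) ->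
    \int[omega]_x (pot k lam g x `^ p) <=
      (e^-1 * (C0 * (2 * t `^ (p - 1))))%:E * \int[lam]_x (g x `^ p).
  move=> mg g0 gN guN.
  pose V := pot k lam g.
  have mV : measurable_fun setT V by exact: measurable_pot.
  have V0 x : 0 <= V x by exact: pot_ge0.
  have [M VM] : exists M : R, forall x, V x <= M%:E.
    have [M HM] := pot_bounded N%:R (ler0n R N).
    by exists M => x; exact: HM.
  have Vfin x : V x < +oo by apply: le_lt_trans (VM x) _; exact: ltry.
  have mVp r : measurable_fun setT (fun x => V x `^ r) by exact: measurable_poweR.
  pose gV x := g x * V x `^ (p - 1).
  have mgV : measurable_fun setT gV by exact: emeasurable_funM.
  have gV0 x : 0 <= gV x by rewrite mule_ge0// poweR_ge0.
  have Vle x : V x `^ p <= C0%:E * pot k lam gV x.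
    have := pot_power pm0 mg g0 (Vfin x).
    by rewrite subrK.
  have mpgV : measurable_fun setT (pot k lam gV) by exact: measurable_pot.
  have pgV0 x : 0 <= pot k lam gV x by exact: pot_ge0.
  pose J := \int[lam]_x (gV x * u x).
  have mJ : measurable_fun setT (fun x => gV x * u x) by exact: emeasurable_funM.
  have J0 x : 0 <= gV x * u x by rewrite mule_ge0.
  pose I := \int[lam]_x (u x `^ q * V x `^ p).
  have mI : measurable_fun setT (fun x => u x `^ q * V x `^ p) by exact: emeasurable_funM.
  have I0 x : 0 <= u x `^ q * V x `^ p by rewrite mule_ge0// poweR_ge0.
  pose G := \int[lam]_x (g x `^ p).
  have G0 : 0 <= G by apply: integral_ge0 => x _; exact: poweR_ge0.
  (* After the pointwise power bound, the potential is moved onto [u ^ q], where it is at most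
     [u]. *)
  have IJ : I <= C0%:E * J.
    apply: (@le_trans _ _ (\int[lam]_x (C0%:E * (u x `^ q * pot k lam gV x)))).
      apply: ge0_le_integral => //.
        apply: emeasurable_funM; first exact: measurable_cst.
        exact: emeasurable_funM.
      by move=> x _; rewrite muleCA lee_wpmul2l.
    rewrite ge0_integralZl//; last 3 first.
    - exact: emeasurable_funM.
    - by move=> x _; rewrite mule_ge0.
    - by rewrite lee_fin ltW.
    rewrite lee_wpmul2l//; first by rewrite lee_fin ltW.
    rewrite (pot_exchange mk k_gt0 kN)//; apply: ae_ge0_le_integral => //.
    - by move=> x _; rewrite mule_ge0// pot_ge0.
    - by apply: emeasurable_funM => //; exact: measurable_pot.
    - by apply: filterS supu => x ux _; rewrite lee_wpmul2l.
  have Jfin : J < +oo.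
    have M0 : (0 <= M)%R by rewrite -lee_fin; apply: le_trans (VM 0%R).
    apply: (@le_lt_trans _ _ (\int[lam]_x ((M `^ (p - 1) * (N%:R * N%:R))%:E *
        (\1_(eball 0 N%:R) x)%:E))).
      apply: ge0_le_integral => //.
        apply: emeasurable_funM; first exact: measurable_cst.
        by apply: measurable_indicE; exact: measurable_eball.
      move=> x _; rewrite /gV muleAC muleC EFinM -muleA.
      apply: lee_pmul; rewrite ?poweR_ge0 ?mule_ge0//.
      rewrite -poweR_EFin gt0_ler_poweR// ?in_itv/= ?leey ?andbT//.
    rewrite ge0_integralZl//; last by rewrite lee_fin mulr_ge0 ?powR_ge0 ?mulr_ge0.
    rewrite integral_indic//; last exact: measurable_eball.
    rewrite setIT lte_mul_pinfty// ?lee_fin ?mulr_ge0 ?powR_ge0//.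
    by apply: le_lt_trans (lebesgue_eball_le _ (ler0n R N)) _; exact: ltry.
  (* Young for the factors g and V^(p - 1) u; the power q of the latter is V^p u^q because (p - 1) q
     = p. *)
  have JIG : J <= (t^-1)%:E * I + (t `^ (p - 1))%:E * G.
    rewrite -ge0_integralZl//; last by rewrite lee_fin invr_ge0 ltW.
    rewrite -ge0_integralZl//; last 3 first.
    - exact: measurable_poweR.
    - by move=> x _; exact: poweR_ge0.
    - by rewrite lee_fin powR_ge0.
    rewrite -ge0_integralD//; last 4 first.
    - by move=> x _; rewrite mule_ge0// lee_fin invr_ge0 ltW.
    - by apply: emeasurable_funM; first exact: measurable_cst.
    - by move=> x _; rewrite mule_ge0 ?poweR_ge0// lee_fin powR_ge0.
    - by apply: emeasurable_funM; [exact: measurable_cst|exact: measurable_poweR].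
    apply: ge0_le_integral => //.
      apply: emeasurable_funD.
        by apply: emeasurable_funM; first exact: measurable_cst.
      by apply: emeasurable_funM; [exact: measurable_cst|exact: measurable_poweR].
    move=> x _; rewrite /gV -muleA.
    apply: le_trans (weighted_young q_gt1 pq t0 (g0 x) _) _.
      by rewrite mule_ge0// poweR_ge0.
    by rewrite poweRM ?poweR_ge0// -poweRrM (conj_mulr q_gt1 pq) [u x `^ q * _]muleC.
  have J2 : J <= (2 * t `^ (p - 1))%:E * G.
    have [Ginf|Gfin] := eqVneq G +oo; last first.
    - have [G' GE] : exists G', G = G'%:E.
        by exists (fine G); rewrite fineK// ge0_fin_numE// ltey.
      have [j JE] : exists j, J = j%:E.
        by exists (fine J); rewrite fineK// ge0_fin_numE// integral_ge0.
      have : J <= (t^-1)%:E * (C0%:E * J) + (t `^ (p - 1))%:E * G.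
        by apply: le_trans JIG _; rewrite leeD2r// lee_wpmul2l// lee_fin invr_ge0 ltW.
      rewrite GE JE -!EFinM -EFinD !lee_fin mulrA (_ : t^-1 * C0 = 2^-1)%R; last first.
        by rewrite /t; field; rewrite gt_eqF.
      by move=> jG; rewrite -mulrA; lra.
    - by rewrite Ginf gt0_muley ?leey// lte_fin mulr_gt0// powR_gt0.
  apply: (@le_trans _ _ (C0%:E * \int[lam]_x (gV x * pot k omega (cst 1) x))).
    have <- : \int[omega]_x (cst 1 x * pot k lam gV x) = \int[lam]_x (gV x * pot k omega (cst 1) x).
      by apply: (pot_exchange mk k_gt0 kN omega lam).
    rewrite -ge0_integralZl//; last 3 first.
    - by apply: emeasurable_funM; first exact: measurable_cst.
    - by move=> x _; rewrite mul1e.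
    - by rewrite lee_fin ltW.
    apply: ge0_le_integral => //.
    - by move=> x _; exact: poweR_ge0.
    - apply: emeasurable_funM; first exact: measurable_cst.
      by apply: emeasurable_funM; first exact: measurable_cst.
    by move=> x _; rewrite mul1e.
  have cE : (C0 * (2 * t `^ (p - 1)))%:E * G = C0%:E * ((2 * t `^ (p - 1))%:E * G).
    by rewrite EFinM muleA.
  rewrite [leRHS](_ : _ = (e^-1)%:E * (C0%:E * ((2 * t `^ (p - 1))%:E * G))); last first.
    by rewrite -cE muleA -EFinM.
  rewrite -(@lee_pmul2l _ e%:E) ?lte_fin// muleCA.
  rewrite [leRHS]muleA -EFinM divff ?gt_eqF// mul1e lee_wpmul2l ?lee_fin ?(ltW C00)//.
  apply: le_trans J2; rewrite -ge0_integralZl//; last 3 first.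
  - exact: emeasurable_funM.
  - by move=> x _; rewrite mule_ge0.
  - by rewrite lee_fin ltW.
  apply: ae_ge0_le_integral => //.
  - by move=> x _; apply: mule_ge0; [rewrite lee_fin ltW|exact: mule_ge0].
  - by apply: emeasurable_funM; [exact: measurable_cst|exact: emeasurable_funM].
  by apply: filterS wu => x wx _; rewrite muleCA lee_wpmul2l.
exists (e^-1 * (C0 * (2 * t `^ (p - 1))))%R => f mf f0.
set C := (e^-1 * _)%R.
have C_ge0 : (0 <= C)%R by rewrite !mulr_ge0 ?powR_ge0 ?invr_ge0 ?ltW.
(* Cutting where [u] is large, besides truncating f, bounds the product of the truncation with [u];
   this makes [J] finite. *)
pose b (N : nat) x := (enorm x < N%:R)%R && (u x <= N%:R%:E).
pose F (N : nat) x := if b N x then mine (f x) N%:R%:E else 0.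
have mF N : measurable_fun setT (F N).
  apply: measurable_if0; last exact: measurable_mine.
  apply: measurable_and; first by apply: measurable_fun_ltr => //; exact: measurable_enorm.
  by apply: (measurable_fun_bool true); exact: emeasurable_fun_infty_c.
have F0 N x : 0 <= F N x.
  by rewrite /F; case: ifP => // _; rewrite le_min f0 lee_fin/=.
have ndF x : {homo F^~ x : i j / (i <= j)%N >-> i <= j}.
  move=> i j ij; rewrite /F /b; have ijR : (i%:R <= j%:R :> R)%R by rewrite ler_nat.
  case: ifP => [/andP[xi ui]|_]; last by case: ifP => // _; rewrite le_min f0 lee_fin/=.
  rewrite (lt_le_trans xi ijR) (le_trans ui)/= ?lee_fin//.
  by rewrite le_min ge_min lexx/= ge_min lee_fin ijR orbT.
pose g x := ereal_sup (range (F^~ x)).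
have Fg x : F i x @[i --> \oo] --> g x by exact: ereal_nondecreasing_cvgn.
have g0 x : 0 <= g x by apply: le_trans (F0 0%N x) _; apply: ereal_sup_ubound; exists 0%N.
have mg : measurable_fun setT g.
  by apply: (emeasurable_fun_cvg F) => // x _; exact: Fg.
(* The truncations vanish where [u] is infinite, so their supremum recovers f only almost
   everywhere; the potentials ignore the difference. *)
have fg : {ae lam, forall x, f x <= g x}.
  apply: filterS ufin => x ux; rewrite leNgt; apply/negP => gf.
  have [s gE] : exists s, g x = s%:E.
    by exists (fine (g x)); rewrite fineK// ge0_fin_numE// (lt_le_trans gf)// leey.
  have [v uE] : exists v, u x = v%:E by exists (fine (u x)); rewrite fineK// ge0_fin_numE.
  pose N := (Num.Def.trunc (Num.max (Num.max s v) (enorm x))).+1.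
  have : (Num.max (Num.max s v) (enorm x) < N%:R)%R by exact: truncnS_gt.
  rewrite !gt_max => /andP[/andP[sN vN] xN].
  have : F N x <= g x by apply: ereal_sup_ubound; exists N.
  rewrite /F /b xN uE lee_fin (ltW vN)/= leNgt; apply/negP; rewrite negbK.
  by rewrite lt_min gf gE lte_fin.
have mpf : measurable_fun setT (pot k lam f) by exact: measurable_pot.
have mpg : measurable_fun setT (pot k lam g) by exact: measurable_pot.
apply: (@le_trans _ _ (\int[omega]_x (pot k lam g x `^ p))).
  apply: ge0_le_integral => //.
  - by move=> x _; exact: poweR_ge0.
  - exact: measurable_poweR.
  - exact: measurable_poweR.
  by move=> x _; apply: lee_poweR; [exact: ltW|exact: pot_ge0|exact: ae_le_pot].
apply: (le_integral_nd (F := fun N x => pot k lam (F N) x `^ p)).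
- by move=> N; apply: measurable_poweR; exact: measurable_pot.
- by move=> N x; exact: poweR_ge0.
- move=> x i j ij; apply: lee_poweR; [exact: ltW|exact: pot_ge0|].
  by apply: le_pot => // y; exact: ndF.
- move=> x; apply: cvg_poweR_nd => //.
  + by move=> i; exact: pot_ge0.
  + by move=> i j ij; apply: le_pot => // y; exact: ndF.
  + by apply: cvg_pot.
move=> N; apply: le_trans (bounded_case (F N) N _ _ _ _) _ => //.
- move=> x; rewrite /F /b indicE; case: ifP => [/andP[xN _]|_]; last by rewrite mule_ge0.
  rewrite mem_set; last by rewrite /eball/= subr0.
  by rewrite mule1 ge_min lexx orbT.
- move=> x; rewrite /F /b indicE; case: ifP => [/andP[xN uN]|_]; last by rewrite mul0e mule_ge0.
  rewrite mem_set; last by rewrite /eball/= subr0.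
  rewrite mule1 EFinM; apply: lee_pmul => //.
    by rewrite le_min f0 lee_fin/=.
  by rewrite ge_min lexx orbT.
rewrite -/C lee_wpmul2l ?lee_fin//; apply: ge0_le_integral => //.
- by move=> x _; exact: poweR_ge0.
- exact: measurable_poweR.
- exact: measurable_poweR.
move=> x _; apply: lee_poweR; [exact: ltW|exact: F0|].
by rewrite /F; case: ifP => // _; rewrite ge_min lexx.
Qed.

(** * The mass of the kernel over balls *)

Lemma measure_eballE (m : {measure set 'rV[R]_n -> \bar R}) c s :
  m (eball c s) = \int[m]_y (\1_(eball c s) y)%:E.
Proof. by apply: measure_integral_indic; exact: measurable_eball. Qed.

Lemma kernel_lower_bound (r : R) : (0 < r)%R -> exists2 a : R, (0 < a)%R &
  forall x, (enorm x <= r)%R -> (a <= k x)%R.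
Proof.
move=> r0; exists (Num.min (k 0%R) (h r)); first by rewrite lt_min k_gt0 h_gt0.
move=> x xr; have [->|x0] := eqVneq x 0%R; first by rewrite ge_min lexx.
by rewrite ge_min (kE x0) h_dec ?orbT// enorm_gt0.
Qed.

Definition phi (s : R) : R := fine (ball_mass s).

Lemma phiE s : ball_mass s = (phi s)%:E.
Proof.
rewrite fineK// ge0_fin_numE ?ball_mass_fin//.
by apply: integral_ge0 => y _; rewrite mule_ge0// indicE_ge0.
Qed.

Lemma phi_gt0 s : (0 < s)%R -> (0 < phi s)%R.
Proof.
move=> s0; have [a a0 ak] := kernel_lower_bound s0.
rewrite -lte_fin -phiE.
apply: (@lt_le_trans _ _ (a%:E * lam (eball 0%R s))).
  rewrite mule_gt0 ?lte_fin//; apply: lt_le_trans (lebesgue_eball_ge _ s0).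
  by rewrite lte_fin mulr_gt0 ?exprn_gt0// divr_gt0.
rewrite measure_eballE.
rewrite -ge0_integralZl ?lee_fin ?(ltW a0)//.
apply: ge0_le_integral => //.
- by move=> y _; rewrite mule_ge0 ?indicE_ge0// lee_fin ltW.
- by apply: emeasurable_funM; first exact: measurable_cst.
- by apply: emeasurable_funM => //; exact/measurable_EFinP.
move=> y _; rewrite indicE; have [yB|_] := boolP (y \in _); last by rewrite !mule0.
by rewrite !mule1 lee_fin ak//; move: yB; rewrite inE /eball/= subr0 => /ltW.
Qed.

(** The annulus between radii r and 2 r contains a ball of radius r / 2 centred at distance 3 r / 2,
    and there [k] is at least [h (2 * r)]. *)
Lemma annulus_phi r : (0 < r)%R ->
  (h (2 * r) * ((2 / n.+1%:R) ^+ n * (r / 2) ^+ n) <= phi (2 * r) - phi r)%R.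
Proof.
move=> r0; have r20 : (0 < r / 2)%R by rewrite divr_gt0.
have [c cE] := @exists_enorm (3 / 2 * r)%R ltac:(by rewrite mulr_gt0).
rewrite lerBrDl -lee_fin EFinD -!phiE.
apply: (@le_trans _ _ (ball_mass r + (h (2 * r))%:E * lam (eball c (r / 2)))).
  rewrite leeD2l// EFinM lee_wpmul2l ?lee_fin ?(ltW (h_gt0 _)) ?mulr_gt0//.
  exact: lebesgue_eball_ge.
rewrite measure_eballE.
have h2 : (0 <= h (2 * r))%R by rewrite ltW// h_gt0// mulr_gt0.
rewrite -ge0_integralZl ?lee_fin//.
have kB s : measurable_fun setT (fun y : 'rV[R]_n => (k y)%:E * (\1_(eball 0 s) y)%:E).
  by apply: emeasurable_funM => //; exact/measurable_EFinP.
rewrite -ge0_integralD//; last 3 first.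
- by move=> y _; rewrite mule_ge0// indicE_ge0.
- by move=> y _; rewrite mule_ge0// indicE_ge0.
- by apply: emeasurable_funM; first exact: measurable_cst.
apply: ge0_le_integral => //.
- by move=> y _; rewrite adde_ge0 ?mule_ge0 ?indicE_ge0.
- by apply: emeasurable_funD => //; apply: emeasurable_funM; first exact: measurable_cst.
move=> y _; rewrite !indicE.
have [yc|yc] := boolP (y \in eball c _); last first.
  rewrite mule0 adde0 lee_wpmul2l// lee_fin ler_nat; case: (boolP (y \in eball 0 r)) => // yr.
  rewrite mem_set//; move: yr; rewrite inE /eball/= subr0 => /lt_trans; apply.
  by rewrite ltr_pMl// ltr1n.
have ny1 : (r < enorm y)%R.
  have := ler_enorm_trans c y 0%R; rewrite !subr0 cE enormB.
  by move: yc; rewrite inE /eball/=; lra.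
have ny2 : (enorm y < 2 * r)%R.
  have := ler_enorm_trans y c 0%R; rewrite !subr0 cE.
  by move: yc; rewrite inE /eball/=; lra.
rewrite memNset ?mule0 ?add0e; last by rewrite /eball/= subr0; apply/negP; rewrite -leNgt ltW.
rewrite mem_set ?mule1; last by rewrite /eball/= subr0.
have y0 : (0 < enorm y)%R by apply: lt_trans ny1.
by rewrite lee_fin kE -?enorm_gt0// h_dec// ltW.
Qed.

(** The graph of the convex function x^(1 - p) lies above its tangent at b. This turns an increment
    of [phi] into a telescoping difference. *)
Lemma powR_convex_gap (a b : R) : (0 < a)%R -> (a <= b)%R ->
  ((p - 1) * ((b - a) * b `^ (- p)) <= a `^ (1 - p) - b `^ (1 - p))%R.
Proof.
move=> a0 ab; have b0 : (0 < b)%R by exact: lt_le_trans ab.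
have p1 := conj_gt1 q_gt1 pq.
have -> : (b `^ (- p) = b `^ (1 - p) / b)%R.
  rewrite [X in (b `^ X)%R = _](_ : _ = (1 - p) + (- 1))%R; last by ring.
  by rewrite powRD ?(gt_eqF b0) ?implybT// powR_inv1 ?(ltW b0).
have -> : (a `^ (1 - p) = b `^ (1 - p) * (a / b) `^ (1 - p))%R.
  by rewrite -powRM ?divr_ge0 ?ltW// mulrC divfK// gt_eqF.
have x0 : (0 < a / b)%R by rewrite divr_gt0.
have bern : ((p - 1) * (1 - a / b) + 1 <= (a / b) `^ (1 - p))%R.
  rewrite /powR gt_eqF//; apply: le_trans (expR_ge1Dx _).
  have : (ln (a / b) <= a / b - 1)%R.
    by have := @le_ln1Dx R (a / b - 1)%R; rewrite (_ : 1 + (a / b - 1) = a / b)%R; [apply|ring]; rewrite ltrBrDr addNr.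
  move=> /(ler_wpM2l (x := (p - 1)%R) _) => /(_ ltac:(by rewrite subr_ge0 ltW)); lra.
have bp : (0 < b `^ (1 - p))%R by rewrite powR_gt0.
rewrite -[X in (_ * _ - X)%R]mulr1 -mulrBr.
rewrite [leLHS](_ : _ = b `^ (1 - p) * ((p - 1) * (1 - a / b)))%R; last first.
  by field; rewrite gt_eqF.
by rewrite ler_pM2l// lerBrDr.
Qed.

Variable omega : {sigma_finite_measure set 'rV[R]_n -> \bar R}.
Hypothesis lf : locally_finite omega.

Let W c r := pot k omega (fun y => (\1_(eball c r) y)%:E).

Let mW c r : measurable_fun setT (W c r).
Proof. exact: measurable_pot. Qed.

Let W0 c r x : 0 <= W c r x.
Proof. by apply: pot_ge0 => // y; exact: indicE_ge0. Qed.

(** * The testing condition on balls *)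

Section testing.

Variable C4 : R.
Hypothesis C4_gt0 : (0 < C4)%R.
Hypothesis test : forall (c : 'rV[R]_n) (r : R), (0 < r)%R ->
  \int[lam]_(x in eball c r)
    (W c r x `^ q) <= C4%:E * omega (eball c r).

Let w c r : R := fine (omega (eball c r)).

Let wE c r : omega (eball c r) = (w c r)%:E.
Proof. by rewrite fineK// ge0_fin_numE// locally_finite_eball. Qed.

Let w_ge0 c r : (0 <= w c r)%R. Proof. exact: fine_ge0. Qed.

(* Only finiteness matters: the supremum over c is absorbed in [ball_growth]. *)
Lemma crude_growth (r : R) : (0 < r)%R -> exists M : R, forall c, (w c r <= M)%R.
Proof.
move=> r0; have [a a0 ak] := @kernel_lower_bound (2 * r)%R ltac:(by rewrite mulr_gt0).
pose v : R := ((2 / n.+1%:R) ^+ n * r ^+ n)%R.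
have v0 : (0 < v)%R by rewrite mulr_gt0 ?exprn_gt0// divr_gt0.
have q10 : (0 < q - 1)%R by rewrite subr_gt0.
exists ((C4 / (a `^ q * v)) `^ (q - 1)^-1)%R => c.
have [w0|wp] := leP (w c r) 0%R; first by apply: le_trans w0 _; exact: powR_ge0.
have Wge x : eball c r x -> (a * w c r)%:E <= W c r x.
  move=> xc; rewrite EFinM -wE measure_eballE -ge0_integralZl ?lee_fin ?(ltW a0)//.
  apply: ge0_le_integral => //.
  - by move=> y _; rewrite mule_ge0 ?indicE_ge0// lee_fin ltW.
  - by apply: emeasurable_funM; first exact: measurable_cst.
  - exact: measurable_potI.
  move=> y _; rewrite indicE; have [yc|_] := boolP (y \in _); last by rewrite !mule0.
  rewrite !mule1 lee_fin ak//; have := ler_enorm_trans x c y; rewrite [enorm (c - y)]enormB.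
  by move: yc xc; rewrite inE /eball/=; lra.
(* The left side grows like the power q > 1 of the mass and the right side linearly, which bounds
   the mass. *)
have : ((a * w c r) `^ q * v)%:E <= C4%:E * omega (eball c r).
  apply: le_trans (test c r0); rewrite integral_indicr; last exact: measurable_eball.
  apply: (@le_trans _ _ (((a * w c r) `^ q)%:E * lam (eball c r))).
    by rewrite EFinM lee_wpmul2l ?lee_fin ?powR_ge0//; exact: lebesgue_eball_ge.
  rewrite measure_eballE -ge0_integralZl ?lee_fin ?powR_ge0//.
  apply: ge0_le_integral => //.
  - by move=> y _; rewrite mule_ge0 ?indicE_ge0// lee_fin powR_ge0.
  - by apply: emeasurable_funM; first exact: measurable_cst.
  - by apply: emeasurable_funM; [apply: measurable_poweR; exact: mW|exact: mB].
  move=> y _; rewrite indicE; have [yc|_] := boolP (y \in _); last by rewrite !mule0.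
  rewrite !mule1 -poweR_EFin; apply: lee_poweR; rewrite ?lee_fin.
  - by rewrite ltW// (lt_trans ltr01).
  - by rewrite mulr_ge0// ltW.
  - by apply: Wge; rewrite inE in yc.
rewrite wE -EFinM lee_fin powRM ?(ltW a0)// -(@mulr_powRB1 _ (w c r) q) ?(lt_trans ltr01)// => H.
have aq : (0 < a `^ q)%R by rewrite powR_gt0.
have wq : (w c r `^ (q - 1) <= C4 / (a `^ q * v))%R.
  rewrite ler_pdivlMr ?(mulr_gt0 aq v0)// -(ler_pM2l wp); apply: (@le_trans _ _ (C4 * w c r)%R).
    by apply: le_trans H; rewrite le_eqVlt; apply/orP; left; apply/eqP; ring.
  by rewrite mulrC.
rewrite [leLHS](_ : _ = w c r `^ (q - 1) `^ (q - 1)^-1)%R; last first.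
  by rewrite -powRrM divff ?gt_eqF// powRr1.
by apply: ge0_ler_powR; rewrite ?nnegrE ?powR_ge0 ?invr_ge0 ?(ltW q10)// (le_trans (powR_ge0 _ _) wq).
Qed.

(** The upper volume bound for radius 3 r divided by the lower one for radius r. *)
Let cov : R := (3 * n.+1%:R) ^+ n.

(** Averaging replaces a covering: integrate the mass of the ball of radius r around y over all y
    within 3 r of c. Each z within 2 r of c is then counted with the volume of a full ball of radius
    r. *)
Lemma doubling_average (r G : R) c : (0 < r)%R -> (forall y, w y r <= G)%R ->
  (w c (2 * r) <= cov * G)%R.
Proof.
move=> r0 wG.
have G0 : (0 <= G)%R by apply: le_trans (wG 0%R).
pose F (y z : 'rV[R]_n) := (\1_(eball c (3 * r)) y : R)%:E * (\1_(eball 0 r) (y - z)%R : R)%:E.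
have mF : measurable_fun setT (fun u : 'rV[R]_n * 'rV[R]_n => F u.1 u.2).
  apply: emeasurable_funM; first exact: (measurableT_comp (mB c _) measurable_fst).
  by apply: (measurableT_comp (mB 0%R r)); exact: measurable_subrV.
have F0 y z : 0 <= F y z by rewrite mule_ge0// indicE_ge0.
have Fball y z : (\1_(eball 0 r) (y - z)%R : R) = \1_(eball y r) z.
  rewrite !indicE; congr ((_ : bool)%:R).
  by apply/idP/idP; rewrite !inE /eball/= subr0 enormB.
have Fball' y z : (\1_(eball 0 r) (y - z)%R : R) = \1_(eball z r) y.
  by rewrite !indicE; congr ((_ : bool)%:R); apply/idP/idP; rewrite !inE /eball/= subr0.
pose v : R := ((2 / n.+1%:R) ^+ n * r ^+ n)%R.
have v0 : (0 < v)%R by rewrite mulr_gt0 ?exprn_gt0// divr_gt0.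
have lo : (v * w c (2 * r))%:E <= \int[omega]_z \int[lam]_y F y z.
  rewrite EFinM -wE measure_eballE -ge0_integralZl ?lee_fin ?(ltW v0)//.
  apply: ge0_le_integral => //.
  - by move=> y _; rewrite mule_ge0 ?indicE_ge0// lee_fin ltW.
  - by apply: emeasurable_funM; first exact: measurable_cst.
  - exact: (measurable_integral1 mF F0).
  move=> z _; rewrite indicE; have [zc|_] := boolP (z \in _); last first.
    by rewrite mule0; apply: integral_ge0.
  rewrite mule1; apply: le_trans (lebesgue_eball_ge z r0) _.
  rewrite measure_eballE; apply: ge0_le_integral => //.
  - exact: (measurable_section1 mF).
  move=> y _; rewrite /F Fball' !indicE.
  have [yz|_] := boolP (y \in eball z r); last by rewrite mule0.
  rewrite mem_set ?mul1e//; have := ler_enorm_trans y z c.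
  by move: yz zc; rewrite !inE /eball/=; lra.
have hi : \int[omega]_z \int[lam]_y F y z <= (G * (2 ^+ n * (3 * r) ^+ n))%:E.
  rewrite -(tonelli_exchange mF F0).
  apply: (@le_trans _ _ (G%:E * lam (eball c (3 * r)))); last first.
    rewrite EFinM lee_wpmul2l ?lee_fin//; apply: lebesgue_eball_le.
    by rewrite mulr_ge0// ltW.
  rewrite measure_eballE -ge0_integralZl ?lee_fin//.
  apply: ge0_le_integral => //.
  - by move=> y _; apply: integral_ge0.
  - exact: (measurable_integral2 mF F0).
  - by apply: emeasurable_funM; first exact: measurable_cst.
  move=> y _; rewrite /F ge0_integralZl ?indicE_ge0//; last first.
    by under eq_fun do rewrite Fball; exact: mB.
  rewrite muleC lee_wpmul2r ?indicE_ge0//.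
  under eq_integral do rewrite Fball.
  by rewrite (_ : \int[omega]_z _ = (w y r)%:E) ?lee_fin// -wE measure_eballE.
have := le_trans lo hi; rewrite lee_fin => H.
rewrite -(ler_pM2l v0); apply: le_trans H _; rewrite le_eqVlt; apply/orP; left; apply/eqP.
rewrite /v /cov !exprMn exprVn; field.
by rewrite expf_neq0// pnatr_eq0.
Qed.

Lemma ball_growth : exists2 K : R, (0 < K)%R & forall c r, (0 < r)%R ->
  (w c r <= K * (r ^+ n * phi r `^ (- p)))%R.
Proof.
have N0 : (0 < cov)%R by rewrite exprn_gt0// mulr_gt0.
pose K := (2 * (2 * C4 * cov) `^ (p - 1) * (4 ^+ n))%R.
have K0 : (0 < K)%R by rewrite !mulr_gt0 ?exprn_gt0 ?powR_gt0// !mulr_gt0.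
exists K => // c0 r r0.
have ph0 : (0 < phi r)%R by exact: phi_gt0 r0.
have [M wM] := crude_growth r0.
pose S := [set w c r | c in setT].
have hS : has_sup S by split; [exists (w 0%R r), 0%R|exists M => _ [c _ <-]].
pose G := sup S.
have wG c : (w c r <= G)%R by apply: ub_le_sup; [exact: hS.2|exists c].
have G0 : (0 <= G)%R by apply: le_trans (wG 0%R).
(* Chosen so that [t^-1 * C4 * cov] equals half of [phi r], the share that the supremum [G] can
   absorb. *)
pose t := (2 * C4 * cov / phi r)%R.
have t0 : (0 < t)%R by rewrite divr_gt0// !mulr_gt0.
have r20 : (0 < 2 * r)%R by rewrite mulr_gt0.
pose Z := (t `^ (p - 1) * (2 ^+ n * (2 * r) ^+ n))%R.
(* A ball of radius r around a point of the inner ball stays in the doubled ball, whose indicator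
   thus has potential at least [phi r] there. Exchange, Young and testing on the doubled ball
   follow. *)
have main c : (phi r * w c r <= phi r * G / 2 + Z)%R.
  rewrite -lee_fin.
  apply: (@le_trans _ _ (\int[lam]_x ((\1_(eball c (2 * r)) x)%:E * W c (2 * r) x))).
    rewrite (pot_exchange mk k_gt0 kN lam omega)//; try by move=> y; exact: indicE_ge0.
    rewrite EFinM -wE measure_eballE -ge0_integralZl ?lee_fin ?(ltW ph0)//.
    apply: ge0_le_integral => //.
    - by move=> y _; rewrite mule_ge0 ?indicE_ge0// lee_fin ltW.
    - by apply: emeasurable_funM; first exact: measurable_cst.
    - by apply: emeasurable_funM => //; exact: measurable_pot.
    move=> z _; rewrite !indicE; have [zc|_] := boolP (z \in eball c r); last first.
      rewrite mule0 mule_ge0// ?lee_fin//.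
      by apply: pot_ge0 => // y; exact: indicE_ge0.
    rewrite mule1 mem_set; last first.
      by move: zc; rewrite inE /eball/= => /lt_trans; apply; rewrite ltr_pMl// ltr1n.
    rewrite mul1e -phiE// -(pot_eball z).
    apply: le_pot => //; try by move=> y; exact: indicE_ge0.
    move=> y; rewrite lee_fin !indicE ler_nat.
    case: (boolP (y \in eball z r)) => // yz; rewrite mem_set//.
    have := ler_enorm_trans y z c; move: yz zc; rewrite !inE /eball/=; lra.
  apply: (@le_trans _ _ ((t^-1)%:E * (C4%:E * omega (eball c (2 * r))) +
    (t `^ (p - 1))%:E * lam (eball c (2 * r)))); last first.
    rewrite wE.
    apply: (@le_trans _ _ ((t^-1 * (C4 * w c (2 * r)))%:E + Z%:E)).
      rewrite !EFinM leeD2l// lee_wpmul2l ?lee_fin ?powR_ge0// -EFinM.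
      by apply: lebesgue_eball_le; exact: ltW.
    rewrite -EFinD lee_fin lerD2r.
    apply: (@le_trans _ _ (t^-1 * (C4 * (cov * G)))%R).
      rewrite ler_wpM2l ?invr_ge0 ?(ltW t0)// ler_wpM2l ?(ltW C4_gt0)//.
      exact: doubling_average.
    rewrite le_eqVlt; apply/orP; left; apply/eqP; rewrite /t; field.
    by rewrite !gt_eqF.
  have tt := test c r20; rewrite integral_indicr in tt; last exact: measurable_eball.
  apply: le_trans (leeD2r _ (lee_wpmul2l _ tt)); last by rewrite lee_fin invr_ge0 ltW.
  rewrite measure_eballE.
  have mWq : measurable_fun setT (fun x => W c (2 * r)%R x `^ q).
    by apply: measurable_poweR; exact: mW.
  have mWq1 : measurable_fun setT (fun x => W c (2 * r)%R x `^ q * (\1_(eball c (2 * r)) x)%:E).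
    exact: emeasurable_funM.
  have Wq0 x : 0 <= W c (2 * r)%R x `^ q * (\1_(eball c (2 * r)) x)%:E.
    by rewrite mule_ge0 ?poweR_ge0 ?indicE_ge0.
  rewrite -ge0_integralZl ?lee_fin ?invr_ge0 ?(ltW t0)//.
  rewrite -ge0_integralZl ?lee_fin ?powR_ge0//.
  rewrite -ge0_integralD//; last 4 first.
  - by move=> x _; apply: mule_ge0; [rewrite lee_fin invr_ge0 ltW|exact: Wq0].
  - by apply: emeasurable_funM; [exact: measurable_cst|exact: mWq1].
  - by move=> x _; apply: mule_ge0; [rewrite lee_fin powR_ge0|exact: indicE_ge0].
  - by apply: emeasurable_funM; first exact: measurable_cst.
  apply: ge0_le_integral => //.
  - by move=> x _; rewrite mule_ge0 ?indicE_ge0.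
  - exact: emeasurable_funM.
  - by apply: emeasurable_funD; apply: emeasurable_funM => //; exact: measurable_cst.
  move=> x _; rewrite !indicE; have [xc|_] := boolP (x \in _); last by rewrite mul0e !mule0 adde0.
  rewrite !mule1; apply: le_trans (weighted_young q_gt1 pq t0 _ (W0 _ _ _)) _ => //.
  by rewrite poweR1r mule1.
have Gle : (phi r * G <= phi r * G / 2 + Z)%R.
  rewrite -ler_pdivlMl//; apply: ge_sup; first exact: hS.1.
  by move=> _ [c _ <-]; rewrite ler_pdivlMl//; exact: main.
apply: le_trans (wG c0) _.
have {}Gle : (phi r * G <= 2 * Z)%R by lra.
rewrite -(ler_pM2l ph0); apply: le_trans Gle _.
rewrite le_eqVlt; apply/orP; left; apply/eqP.
rewrite /Z /t /K powRM ?invr_ge0 ?mulr_ge0 ?(ltW ph0) ?(ltW C4_gt0) ?(ltW N0)//.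
have -> : ((phi r)^-1 `^ (p - 1) = phi r * phi r `^ (- p))%R.
  rewrite -powR_inv1 ?(ltW ph0)// -powRrM mulN1r opprB.
  by rewrite powRD ?(gt_eqF ph0) ?implybT// powRr1 ?ltW.
have -> : (4 = 2 * 2 :> R)%R by ring.
by rewrite !exprMn; ring.
Qed.

Section tail_bound.

Variable K : R.
Hypothesis K_gt0 : (0 < K)%R.
Hypothesis growth : forall c r, (0 < r)%R ->
  (fine (omega (eball c r)) <= K * (r ^+ n * phi r `^ (- p)))%R.

Definition tail (x : 'rV[R]_n) (s : R) :=
  \int[omega]_z (if (s <= enorm (x - z))%R then (k (x - z)%R)%:E else 0).

(** By doubling and the growth bound, the contribution of one dyadic annulus is of order r^n h(2 r)
    Phi(2 r)^(-p). Here r^n h(2 r) is controlled by the increment of Phi, and the tangent inequality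
    applies. *)
Lemma tail_dyadic_step : exists2 K' : R, (0 < K')%R & forall x r, (0 < r)%R ->
  (h r * fine (omega (eball x (2 * r))) <=
    K' * (phi r `^ (1 - p) - phi (2 * r) `^ (1 - p)))%R.
Proof.
pose c0 : R := ((2 / n.+1%:R) ^+ n)%R.
have c00 : (0 < c0)%R by rewrite exprn_gt0// divr_gt0.
have p10 : (0 < p - 1)%R by rewrite subr_gt0.
pose K' := (K * D * 4 ^+ n / c0 / (p - 1))%R.
have K'0 : (0 < K')%R by rewrite divr_gt0// divr_gt0// !mulr_gt0// exprn_gt0.
exists K' => // x r r0; have r20 : (0 < 2 * r)%R by rewrite mulr_gt0.
have ph1 := phi_gt0 r0; have ph2 := phi_gt0 r20.
have hr := h_gt0 r0; have h2r := h_gt0 r20.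
have ann := annulus_phi r0.
have ph12 : (phi r <= phi (2 * r))%R.
  rewrite -subr_ge0; apply: le_trans ann; rewrite !mulr_ge0 ?exprn_ge0 ?divr_ge0 ?ltW//.
have gap := powR_convex_gap ph1 ph12.
have gr := growth x r20.
set P2 := (phi (2 * r) `^ (- p))%R in gap gr.
have P20 : (0 < P2)%R by rewrite powR_gt0.
apply: (@le_trans _ _ (D * h (2 * r) * (K * ((2 * r) ^+ n * P2)))%R).
  apply: ler_pM => //; [exact: ltW|exact: fine_ge0|exact: hD].
apply: (@le_trans _ _ (K * D * 4 ^+ n / c0 * (phi (2 * r) - phi r) * P2)%R).
  rewrite (_ : _ * _ = (K * D * 4 ^+ n / c0 * P2) * (h (2 * r) * (c0 * (r / 2) ^+ n)))%R.
    rewrite [leRHS]mulrAC; apply: ler_wpM2l => //.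
    by rewrite mulr_ge0 ?(ltW P20)// divr_ge0 ?(ltW c00)// !mulr_ge0 ?exprn_ge0 ?(ltW K_gt0) ?(ltW D_gt0).
  have -> : (4 = 2 * 2 :> R)%R by ring.
  by rewrite !exprMn exprVn; field; rewrite gt_eqF//= expf_neq0.
rewrite [leRHS](_ : _ = K * D * 4 ^+ n / c0 / (p - 1) *
    (phi r `^ (1 - p) - phi (2 * r) `^ (1 - p)))%R//.
rewrite -[leLHS]mulrA -[leRHS]mulrA ler_wpM2l// ?ler_pdivlMl//.
by rewrite divr_ge0 ?(ltW c00)// !mulr_ge0 ?exprn_ge0 ?(ltW K_gt0) ?(ltW D_gt0).
Qed.

Lemma tail_bound : exists2 K' : R, (0 < K')%R & forall x s, (0 < s)%R ->
  tail x s <= (K' * phi s `^ (1 - p))%:E.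
Proof.
have [K' K'0 step] := tail_dyadic_step; exists K' => // x s s0.
pose F (N : nat) z := if (s <= enorm (x - z)%R)%R && (enorm (x - z)%R < 2 ^+ N * s)%R
  then (k (x - z)%R)%:E else 0.
have mF N : measurable_fun setT (F N).
  apply: measurable_if0; last exact: measurable_kernel1.
  by apply: measurable_and; [apply: measurable_fun_ler|apply: measurable_fun_ltr].
have F0 N z : 0 <= F N z by rewrite /F; case: ifP.
have pow_le i j : (i <= j)%N -> (2 ^+ i * s <= 2 ^+ j * s)%R.
  by move=> ij; rewrite ler_pM2r// ler_eXn2l// ltr1n.
have s_pos N : (0 < 2 ^+ N * s)%R by rewrite mulr_gt0// exprn_gt0.
apply: (le_integral_nd (F := F)) => //.
- move=> z i j ij; rewrite /F; case: ifP => [/andP[sz zi]|_]; last by case: ifP.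
  by rewrite sz (lt_le_trans zi (pow_le _ _ ij)).
- move=> z; apply: cvg_near_cst; pose M := Num.Def.trunc (enorm (x - z)%R / s).
  exists M.+1 => // j /= Mj; rewrite /F (_ : (enorm (x - z) < 2 ^+ j * s)%R) ?andbT//.
  rewrite -ltr_pdivrMr//; apply: (lt_le_trans (truncnS_gt _)).
  rewrite -natrX ler_nat; apply: (leq_trans Mj); apply: ltnW; exact: ltn_expl.
(* Keeping the subtracted term lets the induction on [N] telescope. *)
move=> N; apply: (@le_trans _ _ (K' * (phi s `^ (1 - p) - phi (2 ^+ N * s) `^ (1 - p)))%:E); last first.
  by rewrite lee_fin ler_pM2l// gerBl powR_ge0.
elim: N => [|N IH].
  rewrite expr0 mul1r subrr mulr0 /F integral0_eq// => z _.
  by rewrite expr0 mul1r; case: ifP => // /andP[/le_lt_trans H /H]; rewrite ltxx.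
pose r := (2 ^+ N * s)%R; have r0 : (0 < r)%R by exact: s_pos.
have h_ge0 : (0 <= h r)%R by rewrite ltW// h_gt0.
apply: (@le_trans _ _ (\int[omega]_z (F N z + (h r)%:E * (\1_(eball x (2 * r)) z)%:E))).
  apply: ge0_le_integral => //.
    by apply: emeasurable_funD => //; apply: emeasurable_funM; first exact: measurable_cst.
  move=> z _; rewrite /F exprS -mulrA -/r.
  have [sz|_] := leP s _; last by rewrite /= add0e mule_ge0 ?indicE_ge0.
  have [zr|rz] := ltP (enorm (x - z)%R) r; rewrite /=.
    case: ifP => _; last by rewrite adde_ge0 ?mule_ge0 ?indicE_ge0.
    by rewrite leeDl// mule_ge0 ?indicE_ge0.
  rewrite add0e; case: ifP => [z2r|_]; last by rewrite mule_ge0 ?indicE_ge0.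
  rewrite indicE mem_set /=; last by rewrite /eball/= enormB.
  by rewrite mule1 lee_fin kE -?enorm_gt0 ?(lt_le_trans r0)// h_dec.
have -> : \int[omega]_z (F N z + (h r)%:E * (\1_(eball x (2 * r)) z)%:E) =
    \int[omega]_z F N z + (h r * fine (omega (eball x (2 * r))))%:E.
  clear -lf mF F0 h_ge0 mB.
  rewrite ge0_integralD//; last 2 first.
  - by move=> z _; rewrite mule_ge0 ?indicE_ge0.
  - by apply: emeasurable_funM; first exact: measurable_cst.
  congr (_ + _); rewrite ge0_integralZl ?lee_fin// EFinM; congr (_ * _).
  rewrite -measure_eballE fineK// ge0_fin_numE//; exact: locally_finite_eball.
have st : (h r * fine (omega (eball x (2 * r))))%:E <=
    (K' * (phi r `^ (1 - p) - phi (2 * r) `^ (1 - p)))%:E.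
  by rewrite lee_fin; exact: (step x r r0).
apply: le_trans (leeD IH st) _; rewrite -EFinD lee_fin exprS -mulrA -/r.
rewrite -mulrDr addrA subrK; exact: lexx.
Qed.

End tail_bound.

(** By Tonelli the diagonal is null for the product of the two measures, since its sections by fixed
    z are Lebesgue-null. *)
Lemma ae_no_atom : {ae lam, forall x, omega [set x] = 0}.
Proof.
pose F (x z : 'rV[R]_n) : \bar R := if (enorm (x - z) == 0)%R then 1 else 0.
have mF : measurable_fun setT (fun u : 'rV[R]_n * 'rV[R]_n => F u.1 u.2).
  apply: measurable_if0; last exact: measurable_cst.
  apply: measurable_fun_eqr; last exact: measurable_cst.
  by apply: (measurableT_comp measurable_enorm); exact: measurable_subrV.
have F0 x z : 0 <= F x z by rewrite /F; case: ifP.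
have Fx x : \int[omega]_z F x z = omega [set x].
  rewrite (measure_integral_indic _ (measurable_rV_set1 x)).
  apply: eq_integral => z _; rewrite /F enorm_eq0 subr_eq0 indicE.
  have [<-|xz] := eqVneq x z; first by rewrite mem_set.
  by rewrite memNset// => zx; move: xz; rewrite zx eqxx.
have int0 : \int[lam]_x `|\int[omega]_z F x z| = 0.
  under eq_integral do rewrite gee0_abs ?integral_ge0//.
  rewrite (tonelli_exchange mF F0) integral0_eq// => z _.
  rewrite (@ae_eq_integral _ _ _ lam setT (cst 0)) ?integral0//.
  - exact: (measurable_section1 mF).
  - apply: filterS (ae_neq z) => y yz _ /=; rewrite /F enorm_eq0 subr_eq0.
    by rewrite (negbTE yz).
have [/(_ int0) ae0 _] := ae_eq_integral_abs lam measurableT (measurable_integral2 (m2 := omega) mF F0).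
by apply: filterS ae0 => x /(_ I); rewrite Fx.
Qed.

(** The ranking inequality, now for omega, writes the power q of the tail as an integral in z of a
    tail to the power q - 1. After exchanging integrals, y runs over the points with 2 |x - y| at
    most |x - z|. *)
Lemma far_part (K' : R) : (0 < K')%R ->
  (forall x s, (0 < s)%R -> tail x s <= (K' * phi s `^ (1 - p))%:E) ->
  forall x, \int[lam]_y ((k (x - y)%R)%:E * tail x (2 * enorm (x - y)) `^ q) <=
    (4 `^ (q - 1) * 2 * K' `^ (q - 1))%:E * pot k omega (cst 1) x.
Proof.
move=> K'0 tb x.
have q0 : (0 < q)%R by rewrite (lt_trans ltr01).
have q10 : (0 <= q - 1)%R by rewrite subr_ge0 ltW.
pose rho z := enorm (x - z)%R.
have mr : measurable_fun setT rho by exact: mrho.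
pose kx z := (k (x - z)%R)%:E.
have mkx : measurable_fun setT kx by exact: measurable_kernel1.
have kx0 z : 0 <= kx z by exact: k_ge0.
pose T z z' := if (rho z <= rho z')%R then kx z' else 0.
have mT : measurable_fun setT (fun u : 'rV[R]_n * 'rV[R]_n => T u.1 u.2).
  apply: measurable_if0; last exact: (measurableT_comp mkx).
  by apply: measurable_fun_ler; apply: (measurableT_comp mr).
have T0 z z' : 0 <= T z z' by rewrite /T; case: ifP.
pose tau z := tail x (rho z) `^ (q - 1).
have tau0 z : 0 <= tau z by exact: poweR_ge0.
have mtau : measurable_fun setT tau.
  by apply: measurable_poweR; exact: (measurable_integral2 (m2 := omega) mT T0).
pose g y z := if (2 * rho y <= rho z)%R then kx z else 0.
have mg : measurable_fun setT (fun u : 'rV[R]_n * 'rV[R]_n => g u.1 u.2).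
  apply: measurable_if0; last exact: (measurableT_comp mkx).
  apply: measurable_fun_ler; last exact: (measurableT_comp mr).
  by apply: measurable_funM => //; exact: (measurableT_comp mr).
have g0 y z : 0 <= g y z by rewrite /g; case: ifP.
have mtail : measurable_fun setT (fun y => tail x (2 * rho y)).
  exact: (measurable_integral2 (m2 := omega) mg g0).
have tail_pow y : (0 < rho y)%R -> tail x (2 * rho y) `^ q <=
    (4 `^ (q - 1) * 2)%:E * \int[omega]_z (g y z * tau z).
  move=> ry; have r2 : (0 < 2 * rho y)%R by rewrite mulr_gt0.
  have mgy : measurable_fun setT (g y) by exact: (measurable_section2 mg).
  have fin : \int[omega]_z g y z < +oo.
    by apply: le_lt_trans (tb x _ r2) _; exact: ltry.
  have := rank_power q10 mgy (g0 y) mr fin; rewrite subrK => /le_trans; apply.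
  rewrite lee_wpmul2l ?lee_fin ?mulr_ge0 ?powR_ge0//.
  have mG : measurable_fun setT (fun z => \int[omega]_z' (if (rho z <= rho z')%R then g y z' else 0)).
    apply: (measurable_integral2 (F := fun z z' => if (rho z <= rho z')%R then g y z' else 0)).
      apply: measurable_if0; last exact: (measurableT_comp mgy).
      by apply: measurable_fun_ler; apply: (measurableT_comp mr).
    by move=> z z'; case: ifP.
  apply: ge0_le_integral => //.
  - by move=> z _; rewrite mule_ge0// poweR_ge0.
  - by apply: emeasurable_funM => //; exact: measurable_poweR.
  - exact: emeasurable_funM.
  move=> z _; rewrite lee_wpmul2l//; apply: lee_poweR => //.
    by apply: integral_ge0 => z' _; case: ifP.
  apply: ge0_le_integral => //.
  - by move=> z' _; case: ifP.
  - by apply: measurable_if0 => //; apply: measurable_fun_ler.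
  - exact: (measurable_section2 mT).
  by move=> z' _; rewrite /g; case: ifP => // _; case: ifP.
pose F y z := kx y * (g y z * tau z).
have mF : measurable_fun setT (fun u : 'rV[R]_n * 'rV[R]_n => F u.1 u.2).
  apply: emeasurable_funM; first exact: (measurableT_comp mkx).
  by apply: emeasurable_funM => //; exact: (measurableT_comp mtau).
have F0 y z : 0 <= F y z by rewrite /F !mule_ge0.
have c0 : (0 <= 4 `^ (q - 1) * 2 :> R)%R by rewrite mulr_ge0 ?powR_ge0.
apply: (@le_trans _ _ ((4 `^ (q - 1) * 2)%:E * \int[lam]_y \int[omega]_z F y z)).
  rewrite -ge0_integralZl ?lee_fin//; last 2 first.
  - exact: (measurable_integral2 (m2 := omega) mF F0).
  - by move=> y _; apply: integral_ge0.
  apply: ae_ge0_le_integral => //.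
  - by move=> y _; rewrite mule_ge0// poweR_ge0.
  - by apply: emeasurable_funM => //; exact: measurable_poweR.
  - by move=> y _; rewrite mule_ge0 ?lee_fin// integral_ge0.
  - apply: emeasurable_funM; first exact: measurable_cst.
    exact: (measurable_integral2 (m2 := omega) mF F0).
  apply: filterS (ae_neq x) => y yx _.
  have ry : (0 < rho y)%R by rewrite enorm_gt0 subr_eq0 eq_sym.
  rewrite ge0_integralZl//; last 2 first.
  - by apply: emeasurable_funM => //; exact: (measurable_section2 mg).
  - by move=> z _; rewrite mule_ge0.
  by rewrite muleCA lee_wpmul2l// tail_pow.
rewrite [leRHS](_ : _ = (4 `^ (q - 1) * 2)%:E *
    ((K' `^ (q - 1))%:E * pot k omega (cst 1) x)); last by rewrite [in LHS]EFinM muleA.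
rewrite lee_wpmul2l ?lee_fin// (tonelli_exchange mF F0).
rewrite -potZ ?powR_ge0//.
apply: ge0_le_integral => //.
- by move=> z _; exact: integral_ge0.
- exact: (measurable_integral1 (m1 := lam) mF F0).
- by apply: measurable_potI.
move=> z _; rewrite mule1 -/(kx z).
have FE y : F y z = (tau z * kx z) * (if (2 * rho y <= rho z)%R then kx y else 0).
  by rewrite /F /g; case: ifP => _; [rewrite muleC [kx z * _]muleC|rewrite mul0e !mule0].
have mi : measurable_fun setT (fun y => if (2 * rho y <= rho z)%R then kx y else 0).
  apply: measurable_if0 => //; apply: measurable_fun_ler => //.
  exact: measurable_funM.
under eq_integral do rewrite FE.
rewrite ge0_integralZl ?mule_ge0//; last by move=> y _; case: ifP.
(* For z = x the domain of y is reduced to x, a null set. *)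
have [rz|rz] := ltP 0%R (rho z); last first.
  rewrite (@ae_eq_integral _ _ _ lam setT (cst 0)) ?integral0//.
    by rewrite mule0 mule_ge0// lee_fin powR_ge0.
  apply: filterS (ae_neq x) => y yx _ /=.
  have ry : (0 < rho y)%R by rewrite enorm_gt0 subr_eq0 eq_sym.
  by rewrite ifF//; apply/negbTE; rewrite -ltNge (le_lt_trans rz)// mulr_gt0.
rewrite muleAC muleC lee_wpmul2l//.
have ph := phi_gt0 rz.
(* The cancellation: (1 - p)(q - 1) = -1 for the tail factor, against the kernel mass of a ball of
   radius [rho z]. *)
apply: (@le_trans _ _ ((K' `^ (q - 1) * (phi (rho z))^-1)%:E * (phi (rho z))%:E)).
  apply: lee_pmul => //.
  - by apply: integral_ge0 => y _; case: ifP.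
  - apply: (@le_trans _ _ ((K' * phi (rho z) `^ (1 - p))%:E `^ (q - 1))).
      by apply: lee_poweR => //; [apply: integral_ge0 => y _; case: ifP|exact: tb].
    rewrite poweR_EFin lee_fin powRM ?powR_ge0 ?(ltW K'0)// -powRrM.
    rewrite (_ : (1 - p) * (q - 1) = -1)%R ?powR_inv1 ?(ltW ph)//.
    by rewrite -[in RHS](conj_mul q_gt1 pq); ring.
  rewrite -phiE -(pot_eball x).
  apply: ge0_le_integral => //.
  - by move=> y _; case: ifP.
  - by apply: measurable_potI.
  move=> y _; case: ifP => [ry|_]; last by rewrite mule_ge0 ?indicE_ge0.
  rewrite indicE mem_set ?mule1//= /eball/= enormB.
  have ryz : (rho y <= rho z / 2)%R by rewrite ler_pdivlMr// mulrC.
  by apply: (le_lt_trans ryz); rewrite ltr_pdivrMr// ltr_pMr// ltr1n.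
by rewrite -EFinM lee_fin mulfVK// gt_eqF.
Qed.

(** The near part of the potential at y. Unlike in [tail], the kernel stays centred at y, since k (y
    - z) and k (x - z) are not comparable here. *)
Let vic (x : 'rV[R]_n) y :=
  \int[omega]_z (if (enorm (x - z) < 2 * enorm (x - y))%R then (k (y - z)%R)%:E else 0).

Let vic_ge0 x y : 0 <= vic x y.
Proof. by apply: integral_ge0 => z _; case: ifP. Qed.

Let measurable_vic x : measurable_fun setT (vic x).
Proof.
apply: (measurable_integral2 (F := fun y z : 'rV[R]_n =>
  if (enorm (x - z) < 2 * enorm (x - y))%R then (k (y - z)%R)%:E else 0)).
  apply: measurable_if0; last exact: measurable_kernel.
  apply: measurable_fun_ltr; first exact: (measurableT_comp (mrho x)).
  by apply: measurable_funM => //; exact: (measurableT_comp (mrho x)).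
by move=> y z; case: ifP.
Qed.

(** At level t, the y with k (x - y) > t, apart from x, lie in a ball around x, and testing on the
    doubled ball leaves its omega-mass. By doubling, t < D k (x - z) for z in it other than x, so
    integrating over t rebuilds the potential. The cutoff [M] keeps the radii bounded. *)
Lemma vicinity_part x (M : R) : omega [set x] = 0 ->
  \int[lam]_y (if (enorm (x - y) < M)%R then vic x y `^ q * (k (x - y)%R)%:E else 0)
    <= (C4 * D)%:E * pot k omega (cst 1) x.
Proof.
move=> noatom.
have q0 : (0 < q)%R by rewrite (lt_trans ltr01).
pose rho z := enorm (x - z)%R.
have mr : measurable_fun setT rho by exact: mrho.
have mkr : measurable_fun setT (fun z : 'rV[R]_n => k (x - z)%R).
  by apply/measurable_EFinP; exact: measurable_kernel1.
have mVq : measurable_fun setT (fun y => vic x y `^ q) by exact: measurable_poweR.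
have Vq0 y : 0 <= vic x y `^ q by exact: poweR_ge0.
pose G (y : 'rV[R]_n) (t : measurableTypeR R) :=
  if ((0 < t) && (t < k (x - y)))%R && (rho y < M)%R then vic x y `^ q else 0.
have mpos : measurable_fun setT (fun u : 'rV[R]_n * measurableTypeR R => (0 < u.2)%R).
  by apply: measurable_fun_ltr.
have mG : measurable_fun setT (fun u : 'rV[R]_n * measurableTypeR R => G u.1 u.2).
  apply: measurable_if0; last exact: (measurableT_comp mVq).
  apply: measurable_and.
    by apply: measurable_and => //; apply: measurable_fun_ltr => //; exact: (measurableT_comp mkr).
  by apply: measurable_fun_ltr => //; exact: (measurableT_comp mr).
have G0 y t : 0 <= G y t by rewrite /G; case: ifP.
pose H (z : 'rV[R]_n) (t : measurableTypeR R) : \bar R :=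
  if (0 < t)%R && (t < D * k (x - z))%R then 1 else 0.
have mH : measurable_fun setT (fun u : 'rV[R]_n * measurableTypeR R => H u.1 u.2).
  apply: measurable_if0 => //; apply: measurable_and => //; apply: measurable_fun_ltr => //.
  by apply: measurable_funM => //; exact: (measurableT_comp mkr).
have H0 z t : 0 <= H z t by rewrite /H; case: ifP.
have GE y : \int[lebesgue_measure]_t G y t =
    if (rho y < M)%R then vic x y `^ q * (k (x - y)%R)%:E else 0.
  rewrite /G; case: (rho y < M)%R; last by rewrite integral0_eq// => t _; rewrite andbF.
  rewrite -(integral_layer (ltW (k_gt0 (x - y)%R))) -ge0_integralZl//.
  - by apply: eq_integral => t _; rewrite andbT; case: ifP => _; rewrite ?mule1 ?mule0.
  - by apply: measurable_if0 => //; apply: measurable_and; apply: measurable_fun_ltr.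
  - by move=> t _; case: ifP.
have Dk z : (0 <= D * k (x - z))%R by rewrite mulr_ge0 ?ltW.
have HE : \int[omega]_z \int[lebesgue_measure]_t H z t = D%:E * pot k omega (cst 1) x.
  rewrite -potZ ?(ltW D_gt0)//; apply: eq_integral => z _.
  by rewrite /H (integral_layer (Dk z)) mule1 -EFinM mulrC.
rewrite (eq_integral (fun y => \int[lebesgue_measure]_t G y t)); last by move=> y _; rewrite GE.
rewrite (tonelli_exchange mG G0) EFinM -muleA -HE (tonelli_exchange mH H0).
rewrite -ge0_integralZl//; last 3 first.
- exact: (measurable_integral1 (m1 := omega) mH H0).
- by move=> t _; exact: integral_ge0.
- by rewrite lee_fin ltW.
apply: ge0_le_integral => //.
- by move=> t _; exact: integral_ge0.
- exact: (measurable_integral1 (m1 := lam) mG G0).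
- apply: emeasurable_funM; first exact: measurable_cst.
  exact: (measurable_integral1 (m1 := omega) mH H0).
move=> t _.
have rhs0 : 0 <= C4%:E * \int[omega]_z H z t.
  by rewrite mule_ge0 ?integral_ge0// lee_fin ltW.
have [t0|t0] := ltP 0%R t; last first.
  by rewrite integral0_eq// => y _; rewrite /G ltNge t0.
pose S := [set r : R | [/\ (0 < r)%R, (r < M)%R & (t < h r)%R]].
have GS y : y != x -> G y t != 0 -> S (rho y).
  move=> yx; rewrite /G; case: ifP => [/andP[/andP[_ tk] yN] _|]; last by rewrite eqxx.
  have xy : (x - y)%R != 0%R by rewrite subr_eq0 eq_sym.
  by split; rewrite ?enorm_gt0// -kE.
have [S0|/set0P[s0 Ss0]] := eqVneq S set0.
  rewrite (@ae_eq_integral _ _ _ lam setT (cst 0)) ?integral0//.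
    exact: (measurable_section1 mG).
  apply: filterS (ae_neq x) => y yx _ /=.
  by apply/eqP; apply: contraT => /(GS _ yx); rewrite S0.
have hS : has_sup S by split; [exists s0|exists M => r [_ /ltW]].
pose r := sup S.
have Sr s : S s -> (s <= r)%R by move=> Ss; apply: ub_le_sup => //; exact: hS.2.
have r0 : (0 < r)%R by apply: lt_le_trans (Sr _ Ss0); case: Ss0.
(* Doubled because [vic x y] involves the z up to distance 2 |x - y| from x. *)
have r20 : (0 < 2 * r)%R by rewrite mulr_gt0.
have tt := test x r20.
rewrite integral_indicr in tt; last exact: measurable_eball.
apply: (@le_trans _ _ (C4%:E * omega (eball x (2 * r)))).
  apply: le_trans tt; apply: ae_ge0_le_integral => //.
  - exact: (measurable_section1 mG).
  - by move=> y _; apply: mule_ge0; [exact: poweR_ge0|exact: indicE_ge0].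
  - by apply: emeasurable_funM; [apply: measurable_poweR; exact: mW|exact: mB].
  apply: filterS (ae_neq x) => y yx _.
  have [->|Gn0] := eqVneq (G y t) 0.
    by apply: mule_ge0; [exact: poweR_ge0|exact: indicE_ge0].
  have ry := Sr _ (GS _ yx Gn0).
  rewrite indicE mem_set; last first.
    rewrite /eball/= enormB; apply: (le_lt_trans ry); by rewrite ltr_pMl// ltr1n.
  rewrite mule1 /G; case: ifP => _; last by apply: poweR_ge0.
  apply: lee_poweR; rewrite ?(ltW q0)//; apply: ge0_le_integral => //.
  - by move=> z _; case: ifP.
  - apply: measurable_if0; last exact: measurable_kernel1.
    by apply: measurable_fun_ltr.
  - exact: measurable_potI.
  move=> z _; case: ifP => [zy|_]; last by rewrite mule_ge0 ?indicE_ge0.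
  rewrite indicE mem_set ?mule1//= /eball/= enormB; apply: (lt_le_trans zy).
  by rewrite ler_pM2l.
rewrite lee_wpmul2l ?lee_fin ?(ltW C4_gt0)// measure_integral_indic; last exact: measurable_eball.
apply: ae_ge0_le_integral => //.
- exact: (measurable_section1 mH).
(* At z = x the value [k 0] need not exceed t / D, hence the assumption that x is not an atom. *)
have neg : omega.-negligible [set x].
  by exists [set x]; split => //; exact: measurable_rV_set1.
have aex : {ae omega, forall z, z != x}.
  by apply: negligibleS neg => z /=; move/negP; rewrite negbK => /eqP.
apply: filterS aex => z zx _; rewrite indicE /H t0/=.
have [zr|_] := boolP (z \in _); last by case: ifP.
have rz : (0 < rho z)%R by rewrite enorm_gt0 subr_eq0 eq_sym.
have zr2 : (rho z / 2 < sup S)%R.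
  by rewrite ltr_pdivrMr// mulrC -/r; move: zr; rewrite inE /eball/= enormB.
(* The supremum need not belong to [S], but half the distance to z is strictly below it. *)
have [s Ss zs] : exists2 s, S s & (rho z / 2 < s)%R.
  have [s Ss] := sup_adherent (eps := (sup S - rho z / 2)%R) ltac:(by rewrite subr_gt0) hS.
  by rewrite opprB addrC subrK => ?; exists s.
have [_ _ ts] := Ss.
rewrite ifT// kE; last by rewrite -enorm_gt0.
apply: (lt_le_trans ts); have rz2 : (0 < rho z / 2)%R by rewrite divr_gt0.
apply: (@le_trans _ _ (h (rho z / 2))); first by apply: h_dec => //; exact: ltW.
by apply: le_trans (hD rz2) _; rewrite [(2 * _)%R]mulrC divfK.
Qed.

Local Notation w1 := (pot k omega (cst 1)).

Let mw1 : measurable_fun setT w1. Proof. exact: measurable_pot. Qed.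

Let w1_ge0 x : 0 <= w1 x. Proof. exact: pot_ge0. Qed.

Let exists_tail_bound : exists2 K' : R, (0 < K')%R & forall x s, (0 < s)%R ->
  tail x s <= (K' * phi s `^ (1 - p))%:E.
Proof.
have [K K0 growth] := ball_growth.
exact: (tail_bound K0 growth).
Qed.

Lemma testing_ae_finite : {ae lam, forall x, w1 x < +oo}.
Proof.
have [K' K'0 tb] := exists_tail_bound.
have fin N : {ae lam, forall x, eball 0 N.+1%:R x -> w1 x < +oo}.
  (* Testing makes the part of omega inside [B] finite almost everywhere. The doubled radius keeps
     the rest at distance at least N + 1 from x, where the tail bound applies. *)
  pose B : set 'rV[R]_n := eball 0 (2 * N.+1%:R)%R.
  have mBB : measurable B by exact: measurable_eball.
  pose WB := pot k omega (fun y => (\1_B y)%:E).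
  have mWB : measurable_fun setT WB by apply: measurable_pot => //; exact: measurable_indicE.
  have mWBq : measurable_fun setT (fun x => WB x `^ q) by exact: measurable_poweR.
  have : lam.-integrable B (fun x => WB x `^ q).
    apply/integrableP; split; first exact: measurable_funTS.
    under eq_integral do rewrite gee0_abs ?poweR_ge0//.
    apply: le_lt_trans (test _ _) _; first by rewrite mulr_gt0.
    by rewrite lte_mul_pinfty ?lee_fin ?(ltW C4_gt0)// locally_finite_eball.
  move=> /(integrable_ae mBB); apply: filterS => x WBfin xN.
  have xB : B x by move: xN; rewrite /B /eball/= => /lt_le_trans; apply; rewrite ler_pMl// ler1n.
  have WBx : WB x < +oo.
    have := WBfin xB; rewrite ge0_fin_numE ?poweR_ge0//.
    by apply: lty_poweRy; rewrite gt_eqF.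
  apply: (@le_lt_trans _ _ (WB x + tail x N.+1%:R)); last first.
    rewrite lte_add_pinfty//; apply: (le_lt_trans (tb _ _ _)); rewrite ?ltry//.
  have mt : measurable_fun setT (fun z : 'rV[R]_n => if (N.+1%:R <= enorm (x - z))%R then (k (x - z)%R)%:E else 0).
    apply: measurable_if0; last exact: measurable_kernel1.
    by apply: measurable_fun_ler.
  rewrite -ge0_integralD//; last 3 first.
  - by move=> z _; rewrite mule_ge0 ?indicE_ge0.
  - by apply: measurable_potI => //; exact: measurable_indicE.
  - by move=> z _; case: ifP.
  apply: ge0_le_integral => //.
  - by move=> z _; rewrite mule_ge0.
  - exact: measurable_potI.
  - by apply: emeasurable_funD => //; apply: measurable_potI => //; exact: measurable_indicE.
  move=> z _; rewrite mule1 indicE; have [zB|zB] := boolP (z \in B).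
    by rewrite mule1 leeDl//; case: ifP.
  rewrite mule0 add0e ifT//; move: zB xN; rewrite notin_setE /B /eball/= => /negP.
  rewrite -leNgt !subr0 => zN xN; have := ler_enorm_trans z x 0%R.
  by rewrite !subr0 [enorm (z - x)]enormB; lra.
have := ae_foralln fin; apply: filterS => x xfin.
have [N _ xN] : (\bigcup_j eball (0 : 'rV[R]_n) j.+1%:R) x by rewrite bigcup_eball.
exact: xfin xN.
Qed.

Lemma testing_pointwise : exists C' : R, {ae lam, forall x,
  pot k lam (fun y => w1 y `^ q) x <= C'%:E * w1 x}.
Proof.
have [K' K'0 tb] := exists_tail_bound.
pose C1 := (C4 * D)%R; pose C2 := (4 `^ (q - 1) * 2 * K' `^ (q - 1))%R.
have C10 : (0 <= C1)%R by rewrite mulr_ge0 ?ltW.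
have C20 : (0 <= C2)%R by rewrite !mulr_ge0 ?powR_ge0.
exists (2 `^ q * (C1 + D `^ q * C2))%R.
apply: filterS ae_no_atom => x noatom.
pose V := vic x.
have V0 y : 0 <= V y by exact: vic_ge0.
have mV : measurable_fun setT V by exact: measurable_vic.
pose T y := tail x (2 * enorm (x - y)%R).
have T0 y : 0 <= T y by apply: integral_ge0 => z _; case: ifP.
have mT : measurable_fun setT T.
  apply: (measurable_integral2 (F := fun y z : 'rV[R]_n =>
    if (2 * enorm (x - y) <= enorm (x - z))%R then (k (x - z)%R)%:E else 0)).
    apply: measurable_if0; last exact: (measurableT_comp (measurable_kernel1 mk x)).
    apply: measurable_fun_ler; last exact: (measurableT_comp (mrho x)).
    by apply: measurable_funM => //; exact: (measurableT_comp (mrho x)).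
  by move=> y z; case: ifP.
(* For z beyond distance 2 |x - y| from x, |x - z| is at most 2 |y - z|, so recentring the kernel at
   x costs [D]. *)
have split y : y != x -> w1 y <= V y + D%:E * T y.
  move=> yx; have xy : (0 < enorm (x - y)%R)%R by rewrite enorm_gt0 subr_eq0 eq_sym.
  have mV1 : measurable_fun setT (fun z : 'rV[R]_n =>
      if (enorm (x - z) < 2 * enorm (x - y))%R then (k (y - z)%R)%:E else 0).
    apply: measurable_if0; last exact: measurable_kernel1.
    by apply: measurable_fun_ltr.
  have mT1 : measurable_fun setT (fun z : 'rV[R]_n =>
      if (2 * enorm (x - y) <= enorm (x - z))%R then (k (x - z)%R)%:E else 0).
    apply: measurable_if0; last exact: measurable_kernel1.
    by apply: measurable_fun_ler.
  rewrite -ge0_integralZl ?lee_fin ?(ltW D_gt0)//; last by move=> z _; case: ifP.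
  rewrite -ge0_integralD//; last 3 first.
  - by move=> z _; case: ifP.
  - by move=> z _; apply: mule_ge0; [rewrite lee_fin ltW|case: ifP].
  - by apply: emeasurable_funM; first exact: measurable_cst.
  apply: ge0_le_integral => //.
  - by move=> z _; rewrite mule_ge0.
  - exact: measurable_potI.
  - by apply: emeasurable_funD => //; apply: emeasurable_funM; first exact: measurable_cst.
  move=> z _; rewrite mule1; have [xz|xz] := ltP (enorm (x - z))%R (2 * enorm (x - y))%R.
    by rewrite leeDl//; apply: mule_ge0 => //; rewrite lee_fin ltW.
  rewrite add0e -EFinM lee_fin.
  have tri := ler_enorm_trans x y z.
  apply: quasi_metric; rewrite -?enorm_gt0; lra.
have pow2 (a b : \bar R) : 0 <= a -> 0 <= b -> (a + b) `^ q <= (2 `^ q)%:E * (a `^ q + b `^ q).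
  move=> a0 b0; wlog ab : a b a0 b0 / a <= b.
    by move=> Hw; have [ba|/ltW ab] := leP b a; [rewrite addeC [X in _ * X]addeC|]; exact: Hw.
  apply: (@le_trans _ _ ((2%:E * b) `^ q)).
    apply: lee_poweR; rewrite ?adde_ge0 ?(ltW q_gt0)//.
    have -> : 2%:E * b = b + b by rewrite -[in RHS](mul1e b) -ge0_muleDl// -EFinD.
    exact: leeD.
  by rewrite poweRM ?lee_fin// poweR_EFin lee_wpmul2l ?lee_fin ?powR_ge0// leeDr// poweR_ge0.
pose F (N : nat) (y : 'rV[R]_n) := if (enorm (x - y) < N%:R)%R then (k (x - y)%R)%:E * w1 y `^ q else 0.
have mkw : measurable_fun setT (fun y : 'rV[R]_n => (k (x - y)%R)%:E * w1 y `^ q).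
  by apply: measurable_potI => //; exact: measurable_poweR.
apply: (le_integral_nd (F := F)).
- move=> N; apply: measurable_if0 => //; exact: measurable_fun_ltr.
- by move=> N y; rewrite /F; case: ifP => // _; rewrite mule_ge0 ?poweR_ge0.
- move=> y i j ij; rewrite /F; case: ifP => [yi|_].
    by rewrite (lt_le_trans yi)// ler_nat.
  by case: ifP => // _; rewrite mule_ge0 ?poweR_ge0.
- move=> y; apply: cvg_near_cst; exists (Num.Def.trunc (enorm (x - y)%R)).+1 => // j /= yj.
  by rewrite /F ifT//; apply: (lt_le_trans (truncnS_gt _)); rewrite ler_nat.
move=> N.
have vp := @vicinity_part x N%:R noatom.
have fp := far_part K'0 tb x.
have mVN : measurable_fun setT (fun y : 'rV[R]_n => if (enorm (x - y) < N%:R)%R then V y `^ q * (k (x - y)%R)%:E else 0).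
  apply: measurable_if0; first exact: measurable_fun_ltr.
  by apply: emeasurable_funM; [exact: measurable_poweR|exact: measurable_kernel1].
have mTq : measurable_fun setT (fun y : 'rV[R]_n => (k (x - y)%R)%:E * T y `^ q).
  by apply: measurable_potI => //; exact: measurable_poweR.
have VN0 y : 0 <= if (enorm (x - y) < N%:R)%R then V y `^ q * (k (x - y)%R)%:E else 0.
  by case: ifP => // _; rewrite mule_ge0 ?poweR_ge0.
have Tq0 y : 0 <= (k (x - y)%R)%:E * T y `^ q by rewrite mule_ge0 ?poweR_ge0.
apply: (@le_trans _ _ (\int[lam]_y ((2 `^ q)%:E *
  ((if (enorm (x - y) < N%:R)%R then V y `^ q * (k (x - y)%R)%:E else 0) +
   (D `^ q)%:E * ((k (x - y)%R)%:E * T y `^ q))))).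
  apply: ae_ge0_le_integral => //.
  - by move=> y _; rewrite /F; case: ifP => // _; rewrite mule_ge0 ?poweR_ge0.
  - by apply: measurable_if0 => //; exact: measurable_fun_ltr.
  - move=> y _; apply: mule_ge0; first by rewrite lee_fin powR_ge0.
    by apply: adde_ge0 => //; apply: mule_ge0 => //; rewrite lee_fin powR_ge0.
  - apply: emeasurable_funM; first exact: measurable_cst.
    by apply: emeasurable_funD => //; apply: emeasurable_funM; first exact: measurable_cst.
  apply: filterS (ae_neq x) => y yx _; rewrite /F; case: ifP => [_|_]; last first.
    apply: mule_ge0; first by rewrite lee_fin powR_ge0.
    by apply: adde_ge0 => //; apply: mule_ge0 => //; rewrite lee_fin powR_ge0.
  apply: (@le_trans _ _ ((k (x - y)%R)%:E * ((2 `^ q)%:E * (V y `^ q + (D%:E * T y) `^ q)))).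
    rewrite lee_wpmul2l//; apply: (@le_trans _ _ ((V y + D%:E * T y) `^ q)).
      by apply: lee_poweR; rewrite ?(ltW q_gt0)//; exact: split.
    by apply: pow2 => //; apply: mule_ge0 => //; rewrite lee_fin ltW.
  rewrite muleCA lee_wpmul2l ?lee_fin ?powR_ge0//.
  rewrite ge0_muleDr ?poweR_ge0// muleC leeD2l//.
  by rewrite poweRM ?lee_fin ?(ltW D_gt0)// poweR_EFin muleCA.
rewrite ge0_integralZl ?lee_fin ?powR_ge0//; last 2 first.
- by apply: emeasurable_funD => //; apply: emeasurable_funM; first exact: measurable_cst.
- by move=> y _; apply: adde_ge0 => //; apply: mule_ge0 => //; rewrite lee_fin powR_ge0.
rewrite ge0_integralD//; last 2 first.
- by move=> y _; apply: mule_ge0 => //; rewrite lee_fin powR_ge0.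
- by apply: emeasurable_funM; first exact: measurable_cst.
rewrite ge0_integralZl ?lee_fin ?powR_ge0//.
rewrite [leRHS](_ : _ = (2 `^ q)%:E * (C1%:E * w1 x + (D `^ q)%:E * (C2%:E * w1 x))); last first.
  rewrite [in LHS]EFinM -muleA EFinD ge0_muleDl ?lee_fin ?(mulr_ge0 (powR_ge0 _ _) C20)//.
  by rewrite (_ : (D `^ q * C2)%:E = (D `^ q)%:E * C2%:E)// -muleA.
rewrite lee_wpmul2l ?lee_fin ?powR_ge0//; apply: leeD; first exact: vp.
by rewrite lee_wpmul2l ?lee_fin ?powR_ge0.
Qed.

End testing.

(** * Capacity *)

Section capacity_implies_testing.

Variable C5 : R.
Hypothesis C5_gt0 : (0 < C5)%R.
Hypothesis cap : forall E : set 'rV[R]_n, compact E -> omega E <= C5%:E * capacity p k E.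

Let p_gt0 : (0 < p)%R := lt_trans ltr01 p_gt1.

Let powR2_lt1 : (2 `^ (1 - p) < 1 :> R)%R.
Proof.
rewrite -[ltRHS](powRr0 2) /powR !gt_eqF// ltr_expR ltr_pM2r ?ln_gt0 ?ltr1n//.
by rewrite subr_lt0.
Qed.

(** f divided by s competes for the capacity of every compact subset of [A]; inner regularity passes
    to [A] itself. *)
Lemma capacity_weak_type (f : 'rV[R]_n -> \bar R) (s : R) (A : set 'rV[R]_n) c r :
  measurable_fun setT f -> (forall x, 0 <= f x) -> (0 < s)%R ->
  measurable A -> A `<=` eball c r -> (forall x, A x -> s%:E <= pot k lam f x) ->
  omega A <= (C5 * s `^ (- p))%:E * \int[lam]_x (f x `^ p).
Proof.
move=> mf f0 s0 mA AB Af; apply/lee_addgt0Pr => e e0.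
have s1 : (0 <= s^-1)%R by rewrite invr_ge0 ltW.
have [E [cE EA] AE] := compact_inner_regular lf mA AB e0.
apply: (le_trans AE); rewrite leeD2r//; apply: le_trans (cap cE) _.
rewrite EFinM -muleA lee_wpmul2l ?lee_fin ?(ltW C5_gt0)//.
apply: ereal_inf_lbound; exists (fun x => (s^-1)%:E * f x).
  split.
  - by apply: emeasurable_funM; first exact: measurable_cst.
  - by move=> x; rewrite mule_ge0.
  move=> x /EA /Af sf; rewrite conv_funE potZ//.
  rewrite -(@lee_pmul2l _ s%:E) ?lte_fin// mule1 muleA -EFinM divff ?gt_eqF// mul1e.
  exact: sf.
rewrite -ge0_integralZl ?lee_fin ?powR_ge0//.
- apply: eq_integral => x _; rewrite poweRM// poweR_EFin; congr (_%:E * _).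
  by rewrite -powR_inv1 ?(ltW s0)// -powRrM mulN1r.
- exact: measurable_poweR.
- by move=> x _; exact: poweR_ge0.
Qed.

(* With [V := pot f], summing the weak type bound over the levels [2 ^ j * t] costs only a
   geometric series of ratio [2 ^ (1 - p)]. *)
Lemma capacity_weak_to_strong (f : 'rV[R]_n -> \bar R) (t I : R) c r :
  measurable_fun setT f -> (forall x, 0 <= f x) -> (0 < t)%R ->
  \int[lam]_x (f x `^ p) = I%:E -> (exists M : R, forall x, pot k lam f x <= M%:E) ->
  \int[omega]_x ((\1_(eball c r) x)%:E * pot k lam f x) <=
    t%:E * omega (eball c r) + (C5 * t `^ (1 - p) / (1 - 2 `^ (1 - p)) * I)%:E.
Proof.
move=> mf f0 t0 IE [M VM].
pose V := pot k lam f.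
have mV : measurable_fun setT V by exact: measurable_pot.
have V0 x : 0 <= V x by exact: pot_ge0.
have I0 : (0 <= I)%R by rewrite -lee_fin -IE integral_ge0// => x _; exact: poweR_ge0.
pose rho : R := (2 `^ (1 - p))%R.
have rho0 : (0 < rho)%R by rewrite powR_gt0.
have rho1 : (rho < 1)%R by exact: powR2_lt1.
have r1 : (0 < 1 - rho)%R by rewrite subr_gt0.
pose c0 : R := (C5 * t `^ (1 - p))%R.
have c00 : (0 <= c0)%R by rewrite mulr_ge0 ?powR_ge0 ?ltW.
have mB1 := mB c r.
pose L (J : nat) x := (\1_(eball c r) x : R)%:E * mine (V x) (2 ^+ J * t)%:E.
have tJ J : (0 < 2 ^+ J * t)%R by rewrite mulr_gt0// exprn_gt0.
have mL J : measurable_fun setT (L J).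
  by apply: emeasurable_funM => //; apply: measurable_mine => //; exact: measurable_cst.
have L0 J x : 0 <= L J x by rewrite mule_ge0 ?indicE_ge0// le_min V0 lee_fin ltW.
have step J : \int[omega]_x L J x <=
    t%:E * omega (eball c r) + (c0 * ((1 - rho ^+ J) / (1 - rho)) * I)%:E.
  elim: J => [|J IH].
    rewrite expr0 subrr mul0r mulr0 mul0r adde0 measure_eballE.
    rewrite -ge0_integralZl ?lee_fin ?(ltW t0)//.
    apply: ge0_le_integral => //; first by apply: emeasurable_funM; first exact: measurable_cst.
    move=> x _; rewrite /L expr0 mul1r muleC lee_wpmul2r ?indicE_ge0//.
    by rewrite ge_min lexx orbT.
  pose A := eball c r `&` [set x | (2 ^+ J * t)%:E < V x].
  have mA : measurable A.
    by apply: measurableI; [exact: measurable_eball|rewrite -[X in measurable X]setTI; exact: emeasurable_fun_o_infty].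
  (* Level times weak type bound leaves the level to the power 1 - p, hence the ratio [rho]. *)
  have wA : (2 ^+ J * t)%:E * omega A <= (c0 * rho ^+ J * I)%:E.
    have := @capacity_weak_type f (2 ^+ J * t)%R A c r mf f0 (tJ J) mA (@subIsetl _ _ _) _.
    rewrite IE => /(_ ltac:(by move=> x [_ /ltW])) wt.
    apply: (@le_trans _ _ ((2 ^+ J * t)%:E * ((C5 * (2 ^+ J * t) `^ (- p))%:E * I%:E))).
      by rewrite lee_wpmul2l// lee_fin ltW.
    rewrite -!EFinM lee_fin mulrA; apply: ler_wpM2r => //.
    rewrite mulrCA -{1}(powRr1 (ltW (tJ J))) -powRD ?(gt_eqF (tJ J)) ?implybT//.
    rewrite powRM ?exprn_ge0 ?(ltW t0)// -(powR_mulrn J (ler0n R 2)) powRAC powR_mulrn ?powR_ge0//.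
    rewrite /c0 -mulrA [(t `^ _ * _)%R]mulrC; exact: lexx.
  apply: (@le_trans _ _ (\int[omega]_x (L J x + (2 ^+ J * t)%:E * (\1_A x)%:E))).
    have mA1 : measurable_fun setT (fun x : 'rV[R]_n => (\1_A x : R)%:E) by exact: measurable_indicE.
    apply: ge0_le_integral => //.
      by apply: emeasurable_funD => //; apply: emeasurable_funM; first exact: measurable_cst.
    move=> x _; rewrite /L !indicE in_setI.
    have [xB|_] := boolP (x \in eball c r); last by rewrite !mul0e mule0 adde0.
    rewrite !mul1e exprS -mulrA; apply: le_trans (mine_doubling _ (ltW (tJ J))) _.
    rewrite leeD2l//=; have [VJ|VJ] := ltP (2 ^+ J * t)%:E (V x).
      by rewrite mem_set ?mule1.
    by rewrite memNset ?mule0//= ltNge VJ.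
  have mA1 : measurable_fun setT (fun x : 'rV[R]_n => (\1_A x : R)%:E) by exact: measurable_indicE.
  rewrite ge0_integralD//; last 2 first.
  - by move=> x _; rewrite mule_ge0 ?indicE_ge0// lee_fin ltW.
  - by apply: emeasurable_funM; first exact: measurable_cst.
  rewrite ge0_integralZl ?lee_fin ?(ltW (tJ J))// -measure_integral_indic//.
  apply: le_trans (leeD IH wA) _; rewrite -addeA -EFinD leeD2l// lee_fin.
  rewrite le_eqVlt; apply/orP; left; apply/eqP; rewrite exprS; field.
  by rewrite gt_eqF.
(* The potential is bounded, so finitely many levels exhaust it: 2^(J + 1) exceeds J + 1, which
   exceeds M / t. *)
pose J := Num.Def.trunc (M / t).
have VJ x : V x <= (2 ^+ J.+1 * t)%:E.
  apply: le_trans (VM x) _; rewrite lee_fin -ler_pdivrMr//.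
  apply: (le_trans (ltW (truncnS_gt _))); rewrite -natrX ler_nat ltnW// ltn_expl//.
rewrite (eq_integral (L J.+1)); last by move=> x _; rewrite /L (min_idPl (VJ x)).
apply: le_trans (step J.+1) _; rewrite leeD2l// lee_fin -/rho -/c0.
rewrite ler_wpM2r// ler_wpM2l// ler_pdivrMr// mulVf ?gt_eqF//.
by rewrite gerBl exprn_ge0// ltW.
Qed.

Lemma capacity_implies_testing : exists2 C4 : R, (0 < C4)%R &
  forall (c : 'rV[R]_n) (r : R), (0 < r)%R ->
    \int[lam]_(x in eball c r)
      (pot k omega (fun y => (\1_(eball c r) y)%:E) x `^ q) <= C4%:E * omega (eball c r).
Proof.
have p10 : (0 < p - 1)%R by rewrite subr_gt0.
pose S : R := ((1 - 2 `^ (1 - p))^-1)%R.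
have S0 : (0 < S)%R.
  by rewrite invr_gt0 subr_gt0 powR2_lt1.
(* Makes the coefficient of the integral of f^p equal to 1/2, so that it can be absorbed. *)
pose t : R := ((2 * C5 * S) `^ (p - 1)^-1)%R.
have CS : (0 < 2 * C5 * S)%R by rewrite !mulr_gt0.
have t0 : (0 < t)%R by rewrite powR_gt0.
have tE : (C5 * t `^ (1 - p) / (1 - 2 `^ (1 - p)) = 2^-1)%R.
  have -> : (t `^ (1 - p) = (2 * C5 * S)^-1)%R.
    rewrite /t -powRrM (_ : (p - 1)^-1 * (1 - p) = -1)%R ?powR_inv1 ?(ltW CS)//; field.
    by rewrite gt_eqF.
  by rewrite -/S; move: (S) S0 => s s0; field; rewrite !gt_eqF.
exists (2 * t)%R; first by rewrite mulr_gt0.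
move=> c r r0; rewrite integral_indicr; last exact: measurable_eball.
have mB1 := mB c r.
pose V := W c r.
have mV : measurable_fun setT V by exact: mW.
have V0 x : 0 <= V x by exact: W0.
have q10 : (0 < q - 1)%R by rewrite subr_gt0.
have q0 : (0 < q)%R by exact: lt_trans q_gt1.
(* Truncation makes the integral to be absorbed finite and the potential of [f] bounded. *)
pose m (N : nat) x := mine (V x) (N%:R)%:E.
have m0 N x : 0 <= m N x by rewrite le_min V0 lee_fin/=.
have mm N : measurable_fun setT (m N) by apply: measurable_mine => //; exact: measurable_cst.
rewrite (eq_integral (fun x => (\1_(eball c r) x)%:E * V x `^ q)); last by move=> x _; rewrite muleC.
apply: (le_integral_nd (F := fun N x => (\1_(eball c r) x)%:E * m N x `^ q)).
- by move=> N; apply: emeasurable_funM => //; exact: measurable_poweR.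
- by move=> N x; rewrite mule_ge0 ?poweR_ge0 ?indicE_ge0.
- move=> x i j ij; rewrite lee_wpmul2l ?indicE_ge0//; apply: lee_poweR; rewrite ?(ltW q0)//.
  by rewrite /m le_min !ge_min lexx/= lee_fin ler_nat ij orbT.
- move=> x; apply: cvgeZl => //; apply: cvg_poweR_nd => //; last exact: cvg_mine_nat.
  by move=> i j ij; rewrite /m le_min !ge_min lexx/= lee_fin ler_nat ij orbT.
move=> N.
pose f x := (\1_(eball c r) x : R)%:E * m N x `^ (q - 1).
have mf : measurable_fun setT f by apply: emeasurable_funM => //; exact: measurable_poweR.
have f0 x : 0 <= f x by rewrite mule_ge0 ?poweR_ge0 ?indicE_ge0.
have fp x : f x `^ p = (\1_(eball c r) x)%:E * m N x `^ q.
  rewrite poweRM ?poweR_ge0 ?indicE_ge0// -poweRrM (conj_mull q_gt1 pq) indicE.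
  by case: (_ \in _); rewrite ?poweR1r// poweR0r ?mul0e// gt_eqF.
have fbound x : f x <= (N%:R `^ (q - 1))%:E * (\1_(eball c r) x)%:E.
  rewrite /f muleC lee_wpmul2r ?indicE_ge0// -poweR_EFin; apply: lee_poweR; rewrite ?(ltW q10)//.
  by rewrite ge_min lexx orbT.
have [I IE] : exists I : R, \int[lam]_x (f x `^ p) = I%:E.
  exists (fine (\int[lam]_x (f x `^ p))); rewrite fineK// ge0_fin_numE; last first.
    by apply: integral_ge0 => x _; exact: poweR_ge0.
  apply: (@le_lt_trans _ _ (\int[lam]_x ((N%:R `^ q)%:E * (\1_(eball c r) x)%:E))).
    apply: ge0_le_integral => //.
    - by move=> x _; exact: poweR_ge0.
    - exact: measurable_poweR.
    - by apply: emeasurable_funM; first exact: measurable_cst.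
    move=> x _; rewrite fp muleC lee_wpmul2r ?indicE_ge0// -poweR_EFin.
    by apply: lee_poweR; rewrite ?(ltW q0)// ge_min lexx orbT.
  rewrite ge0_integralZl ?lee_fin ?powR_ge0// -measure_eballE lte_mul_pinfty ?lee_fin ?powR_ge0//.
  by apply: le_lt_trans (lebesgue_eball_le _ (ltW r0)) _; exact: ltry.
have Vbound : exists M : R, forall x, pot k lam f x <= M%:E.
  have [M HM] := pot_bounded (enorm c + r)
    (powR_ge0 N%:R (q - 1)).
  exists M => x; apply: HM => // y; apply: le_trans (fbound y) _.
  rewrite lee_wpmul2l ?lee_fin ?powR_ge0// !indicE ler_nat.
  case: (boolP (y \in eball c r)) => // yc; rewrite mem_set//.
  have := ler_enorm_trans y c 0%R; move: yc; rewrite inE /eball/= !subr0; lra.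
have ws := capacity_weak_to_strong c r mf f0 t0 IE Vbound.
rewrite tE in ws.
(* By duality the right side is the integral of [f * V]; since (q - 1) p = q and the truncation is
   below [V], it dominates that of f^p. *)
have IW : I%:E <= \int[omega]_x ((\1_(eball c r) x)%:E * pot k lam f x).
  have -> : \int[omega]_x ((\1_(eball c r) x)%:E * pot k lam f x) = \int[lam]_x (f x * V x).
    by apply: (pot_exchange mk k_gt0 kN omega lam) => // y; exact: indicE_ge0.
  rewrite -IE; apply: ge0_le_integral => //.
  - by move=> x _; exact: poweR_ge0.
  - exact: measurable_poweR.
  - exact: emeasurable_funM.
  move=> x _; rewrite fp /f -muleA lee_wpmul2l ?indicE_ge0//.
  have -> : m N x `^ q = m N x `^ (q - 1) * m N x.
    rewrite -[X in _ = _ * X]poweRe1// -poweRD ?subrK//.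
    by rewrite add_neq0_poweRD_def// subrK gt_eqF.
  by rewrite lee_wpmul2l ?poweR_ge0// ge_min lexx.
rewrite (eq_integral (fun x => f x `^ p)); last by move=> x _; rewrite fp.
have [w wE] : exists w : R, omega (eball c r) = w%:E.
  by exists (fine (omega (eball c r))); rewrite fineK// ge0_fin_numE// locally_finite_eball.
have := le_trans IW ws; rewrite IE wE -!EFinM -EFinD !lee_fin; lra.
Qed.

End capacity_implies_testing.

End radial_kernel.

(** * Solutions of the integral equation *)

Section solutions.
Local Open Scope ereal_scope.
Context {R : realType} {n : nat}.
Variables (k : 'rV[R]_n -> R) (q : R).
Hypotheses (mk : measurable_fun setT k) (k_gt0 : forall x, (0 < k x)%R) (q_gt1 : (1 < q)%R).

Local Notation lam := (lebesgue_rV n : {sigma_finite_measure set 'rV[R]_n -> \bar R}).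

(* With [w] the given function, [2 * e *: w] is a supersolution once [(2 * e) ^ q * C <= e],
   and the monotone iteration started at 0 stays below it. *)
Lemma monotone_iteration (w : 'rV[R]_n -> \bar R) (C : R) :
  measurable_fun setT w -> (forall x, 0 <= w x) ->
  {ae lam, forall x, w x < +oo} ->
  {ae lam, forall x, pot k lam (fun y => w y `^ q) x <= C%:E * w x} ->
  exists2 e0 : R, (0 < e0)%R & forall e, (0 < e)%R -> (e < e0)%R ->
    exists u, is_solution k q (fun x => e%:E * w x) u.
Proof.
move=> mw w0 wfin wC.
have q0 : (0 < q)%R by exact: lt_trans q_gt1.
have q10 : (0 < q - 1)%R by rewrite subr_gt0.
pose C1 : R := Num.max C 1%R; have C10 : (0 < C1)%R by rewrite lt_max ltr01 orbT.
(* The condition (2 e)^q C1 <= e amounts to e^(q - 1) <= 1 / (2^q C1), which gives the threshold. *)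
have A0 : (0 < 2 `^ q * C1)%R by rewrite mulr_gt0// powR_gt0.
exists ((2 `^ q * C1)^-1 `^ (q - 1)^-1)%R; first by rewrite powR_gt0// invr_gt0.
move=> e e_gt0 ee0.
have eC : ((2 * e) `^ q * C1 <= e)%R.
  have : (e `^ (q - 1) <= (2 `^ q * C1)^-1)%R.
    have -> : ((2 `^ q * C1)^-1 = (2 `^ q * C1)^-1 `^ (q - 1)^-1 `^ (q - 1))%R.
      by rewrite -powRrM mulVf ?gt_eqF// powRr1// invr_ge0 ltW.
    by apply: ge0_ler_powR; rewrite ?nnegrE ?powR_ge0 ?(ltW q10) ?(ltW e_gt0)// ltW.
  rewrite -[leRHS]mul1r ler_pdivlMr// => H.
  rewrite powRM ?(ltW e_gt0)// -(mulr_powRB1 (ltW e_gt0) q0).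
  rewrite [leLHS](_ : _ = e * (e `^ (q - 1) * (2 `^ q * C1)))%R; last by ring.
  by rewrite -[leRHS]mulr1 ler_pM2l.
pose u := fix u (j : nat) : 'rV[R]_n -> \bar R :=
  if j is i.+1 then fun x => pot k lam (fun y => u i y `^ q) x + e%:E * w x else cst 0.
have uE j x : u j.+1 x = pot k lam (fun y => u j y `^ q) x + e%:E * w x by [].
have u_ge0 j x : 0 <= u j x.
  case: j => [|j]//=; apply: adde_ge0; first by apply: pot_ge0 => // y; exact: poweR_ge0.
  by apply: mule_ge0 => //; rewrite lee_fin ltW.
have mew : measurable_fun setT (fun x => e%:E * w x).
  by apply: emeasurable_funM; first exact: measurable_cst.
have mu j : measurable_fun setT (u j).
  elim: j => [|j IH]; first exact: measurable_cst.
  apply: emeasurable_funD => //; apply: measurable_pot => //.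
    exact: measurable_poweR.
  by move=> y; exact: poweR_ge0.
have muq j : measurable_fun setT (fun x => u j x `^ q) by exact: measurable_poweR.
have uS j x : u j x <= u j.+1 x.
  elim: j x => [|j IH] x; first exact: (u_ge0 1%N).
  rewrite [u j.+1 x]uE [u j.+2 x]uE leeD2r//.
  apply: le_pot => // y; first exact: poweR_ge0.
  by apply: lee_poweR; rewrite ?(ltW q0).
have ndu x : {homo u^~ x : i j / (i <= j)%N >-> i <= j}.
  by apply/nondecreasing_seqP => j; exact: uS.
have ub j : {ae lam, forall x, u j x <= (2 * e)%:E * w x}.
  elim: j => [|j IH].
    by apply: aeW => x; apply: mule_ge0 => //; rewrite lee_fin mulr_ge0 ?ltW.
  apply: filterS wC => x wCx /=.
  apply: (@le_trans _ _ (e%:E * w x + e%:E * w x)); last first.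
    by rewrite -ge0_muleDl ?lee_fin ?(ltW e_gt0)// -EFinD (_ : e + e = 2 * e)%R//; ring.
  rewrite leeD2r//.
  apply: (@le_trans _ _ (pot k lam (fun y => ((2 * e) `^ q)%:E * w y `^ q) x)).
    apply: ae_le_pot => //.
    - by move=> y; exact: poweR_ge0.
    - by apply: emeasurable_funM; [exact: measurable_cst|exact: measurable_poweR].
    - by move=> y; rewrite mule_ge0 ?poweR_ge0// lee_fin powR_ge0.
    apply: filterS IH => y uy; rewrite -poweR_EFin -poweRM//; last first.
      by rewrite lee_fin mulr_ge0 ?ltW.
    by apply: lee_poweR; rewrite ?(ltW q0).
  rewrite potZ ?powR_ge0//; last 2 first.
  - exact: measurable_poweR.
  - by move=> y; exact: poweR_ge0.
  apply: (@le_trans _ _ (((2 * e) `^ q)%:E * (C1%:E * w x))).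
    rewrite lee_wpmul2l ?lee_fin ?powR_ge0//; apply: (le_trans wCx).
    by rewrite lee_wpmul2r// lee_fin le_max lexx.
  by rewrite muleA -EFinM lee_wpmul2r// lee_fin.
pose v x := ereal_sup (range (u^~ x)).
have cu x : u j x @[j --> \oo] --> v x by exact: ereal_nondecreasing_cvgn.
have mv : measurable_fun setT v by apply: (emeasurable_fun_cvg u) => // x _; exact: cu.
have v0 x : 0 <= v x by apply: le_trans (u_ge0 0%N x) _; apply: ereal_sup_ubound; exists 0%N.
exists v; split => //.
  have := ae_foralln ub; apply: filterS2 wfin => x wx ubx; rewrite v0/=.
  apply: (@le_lt_trans _ _ ((2 * e)%:E * w x)).
    by apply: ge_ereal_sup => _ [j _ <-].
  by rewrite lte_mul_pinfty// lee_fin mulr_ge0 ?ltW.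
(* Monotone convergence gives the equation at every point; only finiteness of the limit is almost
   everywhere. *)
apply: aeW => x; rewrite conv_funE.
have cS : u j.+1 x @[j --> \oo] --> v x by have := cu x; rewrite -(cvg_shiftS (u^~ x)).
have cP : u j.+1 x @[j --> \oo] --> pot k lam (fun y => v y `^ q) x + e%:E * w x.
  apply: cvgeD.
  - apply: ge0_adde_def; rewrite inE; last by apply: mule_ge0 => //; rewrite lee_fin ltW.
    by apply: pot_ge0 => // y; exact: poweR_ge0.
  - apply: cvg_pot => //.
    + by move=> i y; exact: poweR_ge0.
    + by move=> y i j ij; apply: lee_poweR; rewrite ?(ltW q0)//; exact: ndu.
    + by move=> y; apply: cvg_poweR_nd => //; exact: ndu.
  - exact: cvg_cst.
by rewrite -(cvg_lim _ cS)// (cvg_lim _ cP).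
Qed.

End solutions.

(** * Local integrability of the kernel *)

Section local_integrability.
Local Open Scope ereal_scope.
Context {R : realType} {n : nat}.

(** On a ball, |k2| is at most 1 + |k2|^q, and both terms are integrable there. *)
Lemma in_Lsum_ball_mass (k : 'rV[R]_n -> R) (q s : R) : (1 < q)%R ->
  measurable_fun setT k -> (forall x, (0 < k x)%R) ->
  in_Lsum (lebesgue_rV n) 1 q%:E k -> ball_mass k s < +oo.
Proof.
move=> q1 mk k_gt0 [k1 [k2 [L1 Lq kE]]].
have q0 : (0 < q)%R by exact: lt_trans q1.
have i1 := Lfun1_integrable _ _; move: L1 => /i1 /integrableP[mk1 fin1].
have /integrableP[mk2 fin2] := Lfun_integrable (ltW q1) Lq.
have mB : measurable_fun setT (fun y : 'rV[R]_n => (\1_(eball 0 s) y : R)%:E).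
  by apply: measurable_indicE; exact: measurable_eball.
have ma1 : measurable_fun setT (fun x => `|(EFin \o k1) x|) by exact: measurableT_comp.
have ma2 : measurable_fun setT (fun x => `|(`|k2 x| `^ q)%:E|) by exact: measurableT_comp.
apply: (@le_lt_trans _ _ (\int[lebesgue_rV n]_x (`|(EFin \o k1) x| +
    (`|(`|k2 x| `^ q)%:E| + (\1_(eball 0 s) x)%:E)))).
  apply: ae_ge0_le_integral => //.
  - by move=> x _; rewrite mule_ge0 ?indicE_ge0// lee_fin ltW.
  - by apply: emeasurable_funM => //; exact/measurable_EFinP.
  - by move=> x _; rewrite !adde_ge0 ?indicE_ge0.
  - by apply: emeasurable_funD => //; exact: emeasurable_funD.
  apply: filterS kE => x kx _; rewrite indicE.
  case: (_ \in _); last by rewrite mule0 !adde_ge0.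
  rewrite mule1 kx /= -!EFinD lee_fin (ger0_norm (powR_ge0 _ _)).
  apply: lerD; first exact: ler_norm.
  apply: (le_trans (ler_norm _)); have [k21|k21] := leP `|k2 x|%R 1%R.
    by apply: (le_trans k21); rewrite lerDr powR_ge0.
  apply: (@le_trans _ _ (`|k2 x| `^ q)%R); last by rewrite lerDl.
  by apply: le1r_powR; exact: ltW.
rewrite ge0_integralD//; last 2 first.
- by move=> x _; rewrite !adde_ge0 ?indicE_ge0.
- exact: emeasurable_funD.
rewrite ge0_integralD// lte_add_pinfty// lte_add_pinfty// -measure_eballE.
have [s0|s0] := leP 0%R s; first by apply: le_lt_trans (lebesgue_eball_le _ s0) _; exact: ltry.
rewrite (_ : eball 0 s = set0) ?measure0// -subset0 => x; rewrite /eball/= => /lt_trans /(_ s0).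
by rewrite ltNge enorm_ge0.
Qed.

End local_integrability.

Section sigma_finite_copy.
Context {R : realType} {n : nat}.
Variables (mu : {measure set 'rV[R]_n -> \bar R}) (lf : locally_finite mu).

(* An alias on which mu carries its sigma-finite structure, as Tonelli's theorem requires. *)
Definition sfinite_copy of locally_finite mu : set 'rV[R]_n -> \bar R := mu.

HB.instance Definition _ := Measure.copy (sfinite_copy lf) mu.

HB.instance Definition _ := Measure_isSigmaFinite.Build _ _ _ (sfinite_copy lf)
  (locally_finite_sigma_finite lf).

End sigma_finite_copy.

Lemma capacity_ge0 {R : realType} {n : nat} (p : R) (k : 'rV[R]_n -> R) E :
  (0 <= capacity p k E)%E.
Proof.
by apply: le_ereal_inf_tmp => _ [g _ <-]; apply: integral_ge0 => x _; exact: poweR_ge0.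
Qed.

Lemma compact_rV_measurable {R : realType} {n : nat} (E : set 'rV[R]_n) :
  compact E -> measurable E.
Proof.
move=> cE; apply: closed_rV_measurable.
by apply: compact_closed => //; exact: norm_hausdorff.
Qed.

Lemma iff_cycle6 (P1 P2 P3 P4 P5 P6 : Prop) :
  (P1 -> P6) -> (P6 -> P5) -> (P5 -> P2) -> (P2 -> P4) -> (P4 -> P3) -> (P3 -> P1) ->
  [<-> P1; P2; P3; P4; P5; P6].
Proof. by move=> *; tfae; tauto. Qed.

Theorem theorem6p1 (R : realType) (n : nat) (p q : R)
    (k : 'rV[R]_n -> R) (h : R -> R)
    (omega : {measure set 'rV[R]_n -> \bar R}) :
  (0 < n)%N ->
  1 < q ->
  p^-1 + q^-1 = 1 ->
  (forall x, 0 < k x) ->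
  (forall x, x != 0 -> k x = h (enorm x)) ->
  (forall r s : R, 0 < r -> r <= s -> h s <= h r) ->
  0 < inf [set h (2 * r) / h r | r in [set r : R | 0 < r]] ->
  in_Lsum (lebesgue_rV n) 1%E q%:E k ->
  locally_finite omega ->
  [<-> (* (1) *)
       exists C : R, forall f : 'rV[R]_n -> \bar R,
         measurable_fun setT f -> (forall x, (0 <= f x)%E) ->
         (\int[omega]_x (conv_fun k f x `^ p)
            <= C%:E * \int[lebesgue_rV n]_x (f x `^ p))%E;
       (* (2) *)
       {ae lebesgue_rV n, forall x, (conv_measure k omega x < +oo)%E} /\
       (exists C' : R, {ae lebesgue_rV n, forall x,
         (conv_fun k (fun y => conv_measure k omega y `^ q) x
            <= C'%:E * conv_measure k omega x)%E});
       (* (3) *)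
       Zset k q (conv_measure k omega);
       (* (3), equivalent form *)
       exists2 e0 : R, 0 < e0 & forall e : R, 0 < e -> e < e0 ->
         exists u, is_solution k q
           (fun x => e%:E * conv_measure k omega x)%E u;
       (* (4) *)
       exists C : R, forall (c : 'rV[R]_n) (r : R), 0 < r ->
         (\int[lebesgue_rV n]_(x in eball c r)
            (conv_measure k (mrestr omega (measurable_eball c r)) x `^ q)
            <= C%:E * omega (eball c r))%E;
       (* (5) *)
       exists C : R, forall E : set 'rV[R]_n, compact E ->
         (omega E <= C%:E * capacity p k E)%E].
Proof.
move=> n_gt0 q_gt1 pq k_gt0 kE h_dec h_inf kL lf.
have p_gt1 := conj_gt1 q_gt1 pq.
have p_gt0 : 0 < p by exact: lt_trans p_gt1.
have q_gt0 : 0 < q by exact: lt_trans q_gt1.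
have h_gt0 := profile_gt0 n_gt0 k_gt0 kE.
set S := [set _ | _ in _] in h_inf.
(* The positive lower bound for h(2 r) / h(r) is the reciprocal of a doubling constant. *)
pose D := (inf S)^-1.
have hD r : 0 < r -> h r <= D * h (2 * r).
  move=> r0; rewrite mulrC ler_pdivlMr// -ler_pdivlMl ?h_gt0// mulrC.
  apply: inf_lbound; last by exists r.
  exists 0 => _ [s /= s0 <-]; rewrite divr_ge0 ?ltW ?h_gt0// mulr_gt0//.
have mk := measurable_radial kE h_dec.
have kN := radial_even kE.
have ball_mass_fin s : (ball_mass k s < +oo)%E.
  exact: in_Lsum_ball_mass q_gt1 mk k_gt0 kL.
pose nu : {sigma_finite_measure set 'rV[R]_n -> \bar R} := sfinite_copy lf.
have wE : conv_measure k omega = pot k nu (cst 1%E).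
  by apply/funext => x; apply: eq_integral => y _; rewrite mule1.
have mw : measurable_fun setT (pot k nu (cst 1%E)) by exact: measurable_pot.
have w0 x : (0 <= pot k nu (cst 1%E) x)%E by exact: pot_ge0.
have lf' : locally_finite nu by [].
have testE (C : R) (c : 'rV[R]_n) (r : R) :
    (\int[lebesgue_rV n]_(x in eball c r)
      (conv_measure k (mrestr omega (measurable_eball c r)) x `^ q)
        <= C%:E * omega (eball c r))%E =
    (\int[lebesgue_rV n]_(x in eball c r)
      (pot k nu (fun y => (\1_(eball c r) y)%:E) x `^ q) <= C%:E * nu (eball c r))%E.
  congr (_ <= _)%E; apply: eq_integral => x _; congr (_ `^ q)%E.
  exact: (conv_measure_mrestrE mk k_gt0 omega).
apply: iff_cycle6.
(* The given constant may be nonpositive; a positive one can be divided out, so that each competitor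
   of the capacity is treated separately. *)
- move=> [C HC]; pose C' := Num.max C 1.
  have C'0 : 0 < C' by rewrite lt_max ltr01 orbT.
  exists C' => E cE; rewrite muleC -lee_pdivrMr//.
  apply: le_ereal_inf_tmp => _ [g [mg g0 gE] <-]; rewrite lee_pdivrMr// muleC.
  apply: (@le_trans _ _ (C%:E * \int[lebesgue_rV n]_x (g x `^ p))%E); last first.
    rewrite lee_wpmul2r ?lee_fin ?le_max ?lexx//.
    by apply: integral_ge0 => x _; exact: poweR_ge0.
  apply: le_trans (HC g mg g0).
  have mE := compact_rV_measurable cE.
  rewrite measure_integral_indic//; apply: ge0_le_integral => //.
  + exact: measurable_indicE.
  + by apply: measurable_poweR; exact: (measurable_pot mk k_gt0 (lebesgue_rV n)).
  move=> x _; rewrite indicE; case: (boolP (x \in E)) => [|_]; last exact: poweR_ge0.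
  rewrite inE => /gE gx; rewrite -(poweR1r p); apply: lee_poweR => //; exact: ltW.
- move=> [C cap]; pose C' := Num.max C 1.
  have C'0 : 0 < C' by rewrite lt_max ltr01 orbT.
  have cap' (E : set 'rV[R]_n) : compact E -> (nu E <= C'%:E * capacity p k E)%E.
    move=> cE; apply: (le_trans (cap E cE)).
    by rewrite lee_wpmul2r ?capacity_ge0// lee_fin le_max lexx.
  have [C4 C40 HC4] := capacity_implies_testing n_gt0 k_gt0 kE h_dec ball_mass_fin
    q_gt1 pq lf' C'0 cap'.
  by exists C4 => c r r0; rewrite testE; exact: HC4.
- move=> [C HC]; pose C' := Num.max C 1.
  have C'0 : 0 < C' by rewrite lt_max ltr01 orbT.
  have test (c : 'rV[R]_n) (r : R) : 0 < r ->
      (\int[lebesgue_rV n]_(x in eball c r)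
        (pot k nu (fun y => (\1_(eball c r) y)%:E) x `^ q) <= C'%:E * nu (eball c r))%E.
    move=> r0; have := HC c r r0; rewrite testE => /le_trans; apply.
    by rewrite lee_wpmul2r// lee_fin le_max lexx.
  rewrite wE; split.
    exact: (testing_ae_finite n_gt0 k_gt0 kE h_dec hD ball_mass_fin q_gt1 pq lf' C'0 test).
  exact: (testing_pointwise n_gt0 k_gt0 kE h_dec hD ball_mass_fin q_gt1 pq lf' C'0 test).
- rewrite wE => -[wfin [C wC]].
  exact: (monotone_iteration mk k_gt0 q_gt1 mw w0 wfin wC).
- rewrite wE => -[e0 e00 sol]; split; first exact: mw.
  have e20 : 0 < e0 / 2 by rewrite divr_gt0.
  exists (e0 / 2) => //.
  have [|u uS] := sol _ e20; first by rewrite ltr_pdivrMr// ltr_pMr// ltr1n.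
  exists u; rewrite (_ : (fun x => _) = (fun x : 'rV[R]_n => (e0 / 2)%:E * pot k nu (cst 1%E) x)%E)//.
  by apply/funext => x; rewrite gee0_abs.
- rewrite wE => -[_ [e e_gt0 [u [mu ufin uE]]]].
  (* A solution is nonnegative only almost everywhere; its positive part has the same potential and
     is nonnegative everywhere. *)
  pose U x := maxe (u x) 0%E.
  have mU : measurable_fun setT U by exact: measurable_maxe.
  have U0 x : (0 <= U x)%E by rewrite le_max lexx orbT.
  have UE : {ae lebesgue_rV n, forall x, U x = u x}.
    by apply: filterS ufin => x /andP[u0 _]; exact/max_idPl.
  have mq (f : 'rV[R]_n -> \bar R) : measurable_fun setT f ->
      measurable_fun setT (fun x => f x `^ q)%E by exact: measurable_poweR.
  have potU x : pot k (lebesgue_rV n) (fun y => U y `^ q)%E x = conv_fun k (fun y => u y `^ q)%E x.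
    apply: ge0_ae_eq_integral => //.
    + by apply: measurable_potI => //; exact: mq.
    + by apply: measurable_potI => //; exact: mq.
    + by move=> y _; rewrite mule_ge0 ?poweR_ge0// lee_fin ltW.
    + by move=> y _; rewrite mule_ge0 ?poweR_ge0// lee_fin ltW.
    by apply: filterS UE => y -> _.
  have potU0 x : (0 <= pot k (lebesgue_rV n) (fun y => U y `^ q) x)%E.
    by apply: (pot_ge0 k_gt0 (lebesgue_rV n)) => y; exact: poweR_ge0.
  have ew0 x : (0 <= e%:E * pot k nu (cst 1) x)%E by rewrite mule_ge0// lee_fin ltW.
  have [|||C HC] := trace_of_supersolution n_gt0 k_gt0 kE h_dec hD ball_mass_fin q_gt1 pq
      (omega := nu) e_gt0 mU U0.
  + by apply: filterS2 UE ufin => x -> /andP[].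
  + apply: filterS2 UE uE => x -> ->; rewrite potU gee0_abs// leeDl//.
  + apply: filterS2 UE uE => x -> ->; rewrite -potU gee0_abs// leeDr//.
  by exists C => f mf f0; exact: HC.
Qed.
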